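(* Assume there exists a collision-resistant hash function $(\mathsf{GenH},H)$ with output length $\ell(\lambda)$. Then there exist a constant $0<\tau'<1$ and negligible functions $\mu(\cdot),\gamma(\cdot)$ such that for every $\tau\le\tau'$ there exist constants $0<r(\tau),\rho(\tau)<1$ for which there exists an $(\ell(\lambda)\cdot\mathrm{polylog}\, n,\ \tau,\ \rho(\tau),\ \gamma(\cdot),\ \mu(\cdot))$-Strong CRLDC of blocklength $n$ over the binary alphabet with rate $r(\tau)$, where $\lim_{\tau\to0}r(\tau)=1$ and $\lim_{\tau\to0}\rho(\tau)=1$. In particular, if $\ell(\lambda)=\mathrm{polylog}\,\lambda$ and $\lambda\in\Theta(n)$, then the code is a $(\mathrm{polylog}\, n,\tau,\rho,\gamma,\mu(\cdot))$-Strong CRLDC.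
   Context: A function $\nu$ is negligible if $\nu(\lambda)=\lambda^{-\omega(1)}$. PPT means probabilistic polynomial time. Collision-resistant hash function (CRHF): a pair $(\mathsf{GenH},H)$ of PPT algorithms where $\mathsf{GenH}(1^\lambda)$ outputs a public seed $s$ and $H(s,\cdot)$ is a deterministic map from arbitrary-length strings to $\{0,1\}^{\ell(\lambda)}$, such that for every PPT adversary $\mathcal A$ the probability (over $s$ and $\mathcal A$'s coins) that $\mathcal A(s)$ outputs $x\ne x'$ with $H(s,x)=H(s,x')$ is negligible in $\lambda$. Local (decoding) code: a tuple $(\mathsf{Gen},\mathsf{Enc},\mathsf{Dec})$ of probabilistic algorithms: $\mathsf{Gen}(1^\lambda)$ outputs a public seed $s$; $\mathsf{Enc}(s,x)$ maps $x\in\Sigma^k$ to $c\in\Sigma^n$; $\mathsf{Dec}$ takes $s$ and an index $i\in[k]$, has oracle access to $w\in\Sigma^n$, and outputs a symbol or $\bot$ (intended to be $x_i$). The rate is $k/n$. Computational adversarial channel $\mathcal A$ with error rate $\tau$: in a round, $s\leftarrow\mathsf{Gen}(1^\lambda)$ is given to everyone; $\mathcal A(s)$ picks a message $x$; $c=\mathsf{Enc}(s,x)$; $\mathcal A$ changes at most $\tau n$ entries of $c$ to get $w$ and picks $i\in[k]$; the receiver outputs $b\leftarrow\mathsf{Dec}^w(s,i)$. Let $p_{\mathcal A,s}=\Pr[b\notin\{\bot,x_i\}]$ over $\mathsf{Dec}$'s coins. $\mathsf{Fool}_{\mathcal A,s}(\gamma,\tau,\lambda)$ is the event $p_{\mathcal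 A,s}>\gamma$; $\mathsf{Limit}_{\mathcal A,s}(\rho,\tau,\lambda)$ is the event $|\mathsf{Good}_{\mathcal A,s}|<\rho k$, where $\mathsf{Good}_{\mathcal A,s}$ is the set of $j\in[k]$ with $\Pr[\mathsf{Dec}^w(s,j)=x_j]>2/3$. A local code is a $(q,\tau,\rho,\gamma(\cdot),\mu(\cdot))$-CRLDC (against all PPT channels, $\mu$ negligible) if $\mathsf{Dec}^w$ makes at most $q$ queries and: (1) for all $s$, if $w=\mathsf{Enc}(s,x)$ then $\mathsf{Dec}^w(s,i)=x_i$; (2) for every PPT $\mathcal A$, $\Pr[\mathsf{Fool}_{\mathcal A,s}(\gamma(\lambda),\tau,\lambda)]\le\mu(\lambda)$; (3) for every PPT $\mathcal A$, $\Pr[\mathsf{Limit}_{\mathcal A,s}(\rho,\tau,\lambda)]\le\mu(\lambda)$ (probabilities over $s\leftarrow\mathsf{Gen}(1^\lambda)$ and $\mathcal A$'s coins). A code satisfying (1), (2) and (3) is a Strong CRLDC. *)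

(* Defs.v *)
From mathcomp Require Import all_boot all_order all_algebra.
From mathcomp Require Import classical_sets reals topology normedtype sequences.

Set Implicit Arguments.
Unset Strict Implicit.
Unset Printing Implicit Defensive.

Import Order.TTheory GRing.Theory Num.Theory.
Import numFieldNormedType.Exports.

Local Open Scope classical_set_scope.
Local Open Scope ring_scope.

Notation bits := (seq bool).

(** Finite random experiments: [Flip r1 r0] tosses a fair coin. *)

Inductive rand (A : Type) : Type :=
| Ret of A
| Flip of rand A & rand A.

Fixpoint bind (A B : Type) (r : rand A) (f : A -> rand B) : rand B :=
  match r with
  | Ret a => f a
  | Flip r1 r0 => Flip (bind r1 f) (bind r0 f)
  end.

Notation "x <~ r ;; e" := (bind r (fun x => e))
  (at level 100, r at next level, right associativity).

Fixpoint Pr (R : realType) (A : Type) (r : rand A) (E : A -> bool) : R :=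
  match r with
  | Ret a => (E a)%:R
  | Flip r1 r0 => (Pr R r1 E + Pr R r0 E) / 2
  end.

(* [P] holds at every outcome of positive probability. *)
Fixpoint every (A : Type) (r : rand A) (P : A -> Prop) : Prop :=
  match r with
  | Ret a => P a
  | Flip r1 r0 => every r1 P /\ every r0 P
  end.

(** The machine model: structured programs over finitely many stacks of bits.
    Every step inspects or changes the top of one stack, so that the model is
    the multi-tape Turing machine (one tape being two stacks) up to a constant
    factor in time.  [Toss] gives probabilistic machines, [Query] gives oracle
    machines.  Numbers are passed in unary, as lengths of strings: all of them
    are polynomial in the security parameter. *)

Inductive cmd : Type :=
| Skip
| Seq of cmd & cmd
| Push of nat & bool
| Pop of nat
| Case of nat & cmd & cmd & cmd (* top is: absent, [false], [true] *)
| While of nat & cmd            (* as long as the stack is non-empty *)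
| Toss of nat                   (* push a random bit *)
| Query of nat & nat.           (* [Query a x]: push on [x] the bit of the
                                   oracle at position (size of stack [a]) *)

Definition store := nat -> bits.

Definition upd (m : store) (x : nat) (v : bits) : store :=
  fun y => if y == x then v else m y.

(* [cont] is what remains to be executed, [asked] the number of queries. *)
Record config := Config { cont : seq cmd; mem : store; asked : nat }.

(* At most [t] steps from a given configuration, with oracle [w]. *)
Fixpoint run (w : bits) (t : nat) (k : seq cmd) (m : store) (q : nat)
    : rand config :=
  match k, t with
  | [::], _ | _, 0%N => Ret (Config k m q)
  | c :: k', t'.+1 =>
    match c with
    | Skip => run w t' k' m q
    | Seq c1 c2 => run w t' [:: c1, c2 & k'] m q
    | Push x b => run w t' k' (upd m x (b :: m x)) q
    | Pop x => run w t' k' (upd m x (behead (m x))) q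
    | Case x c0 c1 c2 =>
      let c' := match m x with
                | [::] => c0
                | false :: _ => c1
                | true :: _ => c2
                end in
      run w t' (c' :: k') m q
    | While x c1 =>
      if m x is [::] then run w t' k' m q else run w t' [:: c1, c & k'] m q
    | Toss x => Flip (run w t' k' (upd m x (true :: m x)) q)
                     (run w t' k' (upd m x (false :: m x)) q)
    | Query a x =>
      run w t' k' (upd m x (nth false w (size (m a)) :: m x)) q.+1
    end
  end.

Definition load (ins : seq bits) : store := fun x => nth [::] ins x.

(* Every polynomial in N is bounded by N ^ d + d for some d. *)
Definition budget (d : nat) (ins : seq bits) : nat :=
  (size (flatten ins) ^ d + d)%N.

Record ppt := Ppt {
  code :> cmd;
  deg : nat;
  ppt_halts : forall (w : bits) (ins : seq bits),
    every (run w (budget deg ins) [:: code] (load ins) 0)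
          (fun o => cont o = [::]) }.

Fixpoint coin_free (c : cmd) : bool :=
  match c with
  | Seq c1 c2 => coin_free c1 && coin_free c2
  | Case _ c0 c1 c2 => [&& coin_free c0, coin_free c1 & coin_free c2]
  | While _ c1 => coin_free c1
  | Toss _ => false
  | _ => true
  end.

Record dpt := Dpt { dpt_ppt :> ppt; dpt_coin_free : coin_free dpt_ppt }.

Definition exec_oracle (A : ppt) (w : bits) (ins : seq bits) : rand config :=
  run w (budget (deg A) ins) [:: code A] (load ins) 0.

Definition exec (A : ppt) (ins : seq bits) : rand config :=
  exec_oracle A [::] ins.

Definition output (A : ppt) (ins : seq bits) : rand bits :=
  o <~ exec A ins;; Ret (mem o 0).

(* Only used on coin-free programs, for which there is no [Flip]. *)
Fixpoint value (A : Type) (r : rand A) : A :=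
  match r with
  | Ret a => a
  | Flip _ r0 => value r0
  end.

Definition apply (F : dpt) (ins : seq bits) : bits := value (output F ins).

Definition unary (n : nat) : bits := nseq n true.

Definition negligible_fun (R : realType) (nu : nat -> R) : Prop :=
  forall c : nat, \forall l \near \oo, `|nu l| <= (l%:R ^+ c)^-1.

(** Collision-resistant hash functions *)

Definition collision_prob (R : realType) (GenH : ppt) (H : dpt) (A : ppt)
    (l : nat) : R :=
  Pr R (s <~ output GenH [:: unary l];;
        o <~ exec A [:: unary l; s];;
        Ret (s, mem o 0, mem o 1))
    (fun o => let: (s, x, x') := o in
       (x != x') && (apply H [:: s; x] == apply H [:: s; x'])).

Definition crhf (R : realType) (GenH : ppt) (H : dpt) (ell : nat -> nat)
    : Prop :=
  (forall l : nat, every (output GenH [:: unary l])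
     (fun s => forall x : bits, size (apply H [:: s; x]) = ell l)) /\
  (forall A : ppt, negligible_fun (collision_prob R GenH H A)).

(** Local codes over the binary alphabet.  [blen C l k] is the blocklength n
    for security parameter l and message length k; the encoder learns k from
    the message, the decoder receives it. *)

Record local_code := LocalCode {
  Gen : ppt;
  Enc : dpt;
  Dec : ppt;
  blen : nat -> nat -> nat;
  size_Enc : forall (l : nat) (s x : bits),
    size (apply Enc [:: unary l; s; x]) = blen l (size x) }.

Definition gen (C : local_code) (l : nat) : rand bits :=
  output (Gen C) [:: unary l].

Definition enc (C : local_code) (l : nat) (s x : bits) : bits :=
  apply (Enc C) [:: unary l; s; x].

Definition dec_run (C : local_code) (l k : nat) (w s : bits) (i : nat)
    : rand config :=
  exec_oracle (Dec C) w [:: unary l; unary k; s; unary i].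

(* [None] is the symbol bottom. *)
Definition dec (C : local_code) (l k : nat) (w s : bits) (i : nat)
    : rand (option bool) :=
  o <~ dec_run C l k w s i;; Ret (ohead (mem o 0)).

(** Computational adversarial channels: [pick] chooses the message and leaves
    a state for [corrupt], which sees the codeword and chooses the received
    word and the index. *)

Record channel := Channel { pick : ppt; corrupt : ppt }.

Record transcript := Transcript {
  t_seed : bits; t_msg : bits; t_word : bits; t_index : nat }.

Definition round (C : local_code) (A : channel) (l k : nat)
    : rand transcript :=
  s <~ gen C l;;
  o <~ exec (pick A) [:: unary l; unary k; s];;
  (let x := mem o 0 in
   o' <~ exec (corrupt A) [:: unary l; unary k; s; mem o 1; enc C l s x];;
   Ret (Transcript s x (mem o' 0) (size (mem o' 1)))).

Definition hamming (u v : bits) : nat :=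
  count (fun p => p.1 != p.2) (zip u v).

Section Events.
Variables (R : realType) (C : local_code) (l k : nat).

(* The channel respected the rules; a round in which it did not counts as a
   failure of the channel. *)
Definition admissible (tau : R) (t : transcript) : bool :=
  let n := blen C l k in
  [&& size (t_msg t) == k, size (t_word t) == n &
      (hamming (enc C l (t_seed t) (t_msg t)) (t_word t))%:R <= tau * n%:R].

Definition fool_prob (t : transcript) : R :=
  Pr R (dec C l k (t_word t) (t_seed t) (t_index t))
    (fun b => b \notin [:: None; Some (nth false (t_msg t) (t_index t))]).

Definition Fool (gamma tau : R) (t : transcript) : bool :=
  [&& admissible tau t, (t_index t < k)%N & gamma < fool_prob t].

Definition Good (t : transcript) : {set 'I_k} :=
  [set j : 'I_k | 2 / 3 <
     Pr R (dec C l k (t_word t) (t_seed t) j)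
       (fun b => b == Some (nth false (t_msg t) j))].

Definition Limit (rho tau : R) (t : transcript) : bool :=
  admissible tau t && (#|Good t|%:R < rho * k%:R).

End Events.

(* [k] gives the message length as a function of the security parameter.  The
   bound [mu] is the same for all channels, and each channel satisfies it for
   all sufficiently large security parameters; at a fixed security parameter
   it could not hold for all channels, since one of them has the answer
   hardwired. *)
Definition strong_crldc (R : realType) (C : local_code) (k q : nat -> nat)
    (tau rho : R) (gamma mu : nat -> R) : Prop :=
  [/\ forall (l : nat) (s w : bits) (i : nat),
        size w = blen C l (k l) -> (i < k l)%N ->
        every (dec_run C l (k l) w s i) (fun o => (asked o <= q l)%N),
      forall (l : nat) (s x : bits) (i : nat),
        size x = k l -> (i < k l)%N ->
        every (dec C l (k l) (enc C l s x) s i)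
              (fun b => b = Some (nth false x i)),
      forall A : channel, \forall l \near \oo,
        Pr R (round C A l (k l)) (Fool C l (k l) (gamma l) tau) <= mu l
    & forall A : channel, \forall l \near \oo,
        Pr R (round C A l (k l)) (Limit C l (k l) rho tau) <= mu l].

Definition poly_related (k : nat -> nat) : Prop :=
  exists c : nat, \forall l \near \oo, ((l <= k l ^ c) && (k l <= l ^ c))%N.

(* f(l) = g(l) * polylog(n(l)) *)
Definition times_polylog (d : nat) (g n f : nat -> nat) : Prop :=
  \forall l \near \oo, (f l <= g l * trunc_log 2 (n l) ^ d)%N.

(* l in Theta(n(l)) *)
Definition linearly_related (n : nat -> nat) : Prop :=
  exists c : nat, \forall l \near \oo, ((l <= c * n l) && (n l <= c * l))%N.

(* Main.v *)
(** The message is cut into blocks.  Every block carries its path in a Merkle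
    tree over all blocks (at each level, the pair of sibling hashes), and is
    encoded by an efficiently decodable code of relative distance bounded
    below: a Reed-Solomon code concatenated with a greedy binary code.  The
    encoded root of the tree is repeated in a part of the word that takes a
    fraction 1/a of its length, where a = 2 ^ u and the error rate is at most
    1 / (512 a ^ 4).  So only a fraction of the blocks and at most 1/16 of the
    copies of the root can be decoded wrongly.

    To decode a bit, read its block and t ^ 2 random copies of the root, where
    t is logarithmic, and accept if the path is consistent and leads to the
    value of the majority of the copies.  By a Chernoff bound that majority is
    the true root up to a negligible probability; then a block that is accepted
    but differs from the encoded one yields a collision.  Messages of
    length at most the hash length times a power of t form a single block
    without hashes.

    The bound mu has to work for all channels at once: there are countably many
    programs, so some negligible function eventually dominates all products of
    a power of the security parameter and a collision probability.  As the
    message length need not be computable, the collision finder guesses it,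
    which costs a polynomial factor. *)

From mathcomp Require Import all_boot all_order all_algebra.
From mathcomp Require Import boolp zify ring lra.
Require Import Defs.

Set Implicit Arguments.
Unset Strict Implicit.
Unset Printing Implicit Defensive.

(** * Random experiments and machines *)

(** The statement asks for concrete programs, so encoder, decoder and collision finder need explicit
    code with proved time bounds. A large part of the development is a calculus for this, in which a
    polynomial-time function replaces one serialised tree by another. As numbers are unary,
    exhaustive search over polynomial ranges finds the prime, the inner code and field inverses.

    The powers of [t] balance the sizes. A path takes about [2 t ell] bits, so blocks of
    [(ell + 1) t ^ 2] bits make it negligible; messages above [(ell + 1) t ^ 4] bits make the
    padding of the last block negligible and leave room for a root copy. With [t ^ 2] votes the
    error probability is [2 ^- (t ^ 2)], below every inverse power of the security parameter.

    The block code corrects a fraction [1 / (6 a ^ 3)] of errors. The root part is only about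
    [1 / a] of the word, hence the fourth power in the error rate; the constant 512 pays for
    roundings and for the 1/16. The number of copies is a power of two, so that fair coins choose a
    copy uniformly. *)

Section Rand.
Variables (A B D : Type).

Lemma bind_ret (r : rand A) : bind r (@Ret A) = r.
Proof. by elim: r => //= r1 -> r0 ->. Qed.

Lemma bindA (r : rand A) (f : A -> rand B) (g : B -> rand D) :
  bind (bind r f) g = bind r (fun a => bind (f a) g).
Proof. by elim: r => //= r1 -> r0 ->. Qed.

Lemma every_imp (P Q : A -> Prop) (r : rand A) :
  (forall a, P a -> Q a) -> every r P -> every r Q.
Proof. by move=> PQ; elim: r => [a|r1 IH1 r0 IH0] /=; [exact: PQ | case=> /IH1 ? /IH0]. Qed.

Lemma everyT (P : A -> Prop) (r : rand A) : (forall a, P a) -> every r P.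
Proof. by move=> PT; elim: r => [a|r1 IH1 r0 IH0] /=. Qed.

Lemma every_and (P Q : A -> Prop) (r : rand A) :
  every r P -> every r Q -> every r (fun a => P a /\ Q a).
Proof.
elim: r => [a|r1 IH1 r0 IH0] /=; first by [].
by move=> [p1 p0] [q1 q0]; split; [apply: IH1|apply: IH0].
Qed.

Lemma every_bind (r : rand A) (f : A -> rand B) (P : B -> Prop) :
  every (bind r f) P = every r (fun a => every (f a) P).
Proof. by elim: r => //= r1 -> r0 ->. Qed.

Lemma eq_bind_every (P : A -> Prop) (r : rand A) (f g : A -> rand B) :
  every r P -> (forall a, P a -> f a = g a) -> bind r f = bind r g.
Proof.
by move=> + fg; elim: r => [a|r1 IH1 r0 IH0] /= => [/fg//|[/IH1 -> /IH0 ->]].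
Qed.

Lemma eq_bind (r : rand A) (f g : A -> rand B) :
  f =1 g -> bind r f = bind r g.
Proof. by move=> fg; elim: r => //= r1 -> r0 ->. Qed.

Lemma every_value (P : A -> Prop) (r : rand A) : every r P -> P (value r).
Proof. by elim: r => //= r1 _ r0 IH [_ /IH]. Qed.

Lemma value_bind (r : rand A) (f : A -> rand B) :
  value (bind r f) = value (f (value r)).
Proof. by elim: r. Qed.

End Rand.

(** A run that also reports the fuel left at each outcome: the program that comes next in a sequence
    starts with exactly this fuel. *)
Fixpoint runl (w : bits) (t : nat) (k : seq cmd) (m : store) (q : nat)
    : rand (nat * config) :=
  match k, t with
  | [::], _ | _, 0%N => Ret (t, Config k m q)
  | c :: k', t'.+1 =>
    match c with
    | Skip => runl w t' k' m q
    | Seq c1 c2 => runl w t' [:: c1, c2 & k'] m q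
    | Push x b => runl w t' k' (upd m x (b :: m x)) q
    | Pop x => runl w t' k' (upd m x (behead (m x))) q
    | Case x c0 c1 c2 =>
      let c' := match m x with
                | [::] => c0
                | false :: _ => c1
                | true :: _ => c2
                end in
      runl w t' (c' :: k') m q
    | While x c1 =>
      if m x is [::] then runl w t' k' m q else runl w t' [:: c1, c & k'] m q
    | Toss x => Flip (runl w t' k' (upd m x (true :: m x)) q)
                     (runl w t' k' (upd m x (false :: m x)) q)
    | Query a x =>
      runl w t' k' (upd m x (nth false w (size (m a)) :: m x)) q.+1
    end
  end.

Definition halts w t k m q := every (run w t k m q) (fun o => cont o = [::]).

Lemma run_runl w t k m q :
  run w t k m q = bind (runl w t k m q) (fun o => Ret o.2).
Proof.
elim: t k m q => [|t IH] [|[|c1 c2|x b|x|x c0 c1 c2|x c1|x|a x] k] m q //=.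
by case: (m x) => *; rewrite IH.
by rewrite !IH.
Qed.

Lemma run_cat w t k1 k2 m q :
  run w t (k1 ++ k2) m q =
  bind (runl w t k1 m q) (fun o =>
    if cont o.2 is [::] then run w o.1 k2 (mem o.2) (asked o.2)
    else Ret (Config (cont o.2 ++ k2) (mem o.2) (asked o.2))).
Proof.
elim: t k1 m q => [|t IH] [|[|c1 c2|x b|x|x c0 c1 c2|x c1|x|a x] k] m q //=;
  rewrite -?IH //.
by case: (m x) => *; rewrite -IH.
Qed.

Lemma runl_fuel w t t' k m q : halts w t k m q ->
  runl w (t + t') k m q = bind (runl w t k m q) (fun o => Ret (o.1 + t', o.2)).
Proof.
rewrite /halts; elim: t k m q => [|t IH] [|[|c1 c2|x b|x|x c0 c1 c2|x c1|x|a x] k] m q //=;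
  try by case: t' => //.
all: try by move/IH.
- by case: (m x) => [/IH//|? ?]/IH.
- by case=> /IH -> /IH ->.
Qed.

Lemma run_mono w t t' k m q : halts w t k m q ->
  run w (t + t') k m q = run w t k m q.
Proof. by move=> h; rewrite !run_runl runl_fuel // bindA; apply: eq_bind. Qed.

Lemma run_asked w t k m q q' :
  run w t k m (q' + q) =
  bind (run w t k m q) (fun o => Ret (Config (cont o) (mem o) (q' + asked o))).
Proof.
elim: t k m q => [|t IH] [|[|c1 c2|x b|x|x c0 c1 c2|x c1|x|a x] k] m q //=.
- by case: (m x) => *; rewrite IH.
- by rewrite !IH.
- by rewrite -addnS IH.
Qed.

Lemma run_size w t k m q x :
  every (run w t k m q) (fun o => size (mem o x) <= size (m x) + t).
Proof.
elim: t k m q => [|t IH] [|[|c1 c2|y b|y|y c0 c1 c2|y c1|y|a y] k] m q //=;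
  rewrite ?addn0 ?leq_addr //.
all: have step: forall m' k' q', size (m' x) <= (size (m x)).+1 ->
     every (run w t k' m' q') (fun o => size (mem o x) <= size (m x) + t.+1)
  by move=> m' k' q' h; apply: every_imp (IH k' m' q') => o ho; lia.
all: try by apply: step.
all: try by apply: step; rewrite /upd; case: eqP => // <- /=; rewrite ?size_behead; lia.
- by case: (m y) => *; apply: step.
- by split; apply: step; rewrite /upd; case: eqP => // <-.
Qed.

(** The big-step judgement behind all time bounds. It is an equality of coin trees rather than of
    distributions, so a specification has to toss its coins in the order of the program. *)
Definition yields w c m (r : rand (store * nat)) B :=
  run w B [:: c] m 0 = bind r (fun o => Ret (Config [::] o.1 o.2)).

Lemma yields_halts w c m r B : yields w c m r B -> halts w B [:: c] m 0.
Proof. by rewrite /halts => ->; rewrite every_bind; apply: everyT. Qed.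

Lemma yields_mono w c m r B B' : yields w c m r B -> B <= B' -> yields w c m r B'.
Proof.
move=> y le; rewrite /yields -(subnKC le) run_mono //; exact: yields_halts y.
Qed.

Lemma halts_asked w t k m q q' : halts w t k m q -> halts w t k m (q' + q).
Proof. by rewrite /halts run_asked every_bind => h; apply: every_imp h. Qed.

(** Trees that agree after relabelling have the same flips, so they can be compared leaf by leaf
    although one of them carries more data. Here the extra data is the remaining fuel. *)
Lemma bind_shape (X Z D E : Type) (R : rand X) (r : rand Z) (F : X -> D)
    (G : Z -> D) (P : Z -> Prop) (K : X -> rand E) (K' : Z -> rand E) :
  bind R (fun x => Ret (F x)) = bind r (fun z => Ret (G z)) -> every r P ->
  (forall x z, P z -> F x = G z -> K x = K' z) -> bind R K = bind r K'.
Proof.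
elim: R r => [x|R1 IH1 R0 IH0] [z|r1 r0] //= => [[e] p h|[e1 e0] [p1 p0] h].
  exact: h.
by rewrite (IH1 r1) // (IH0 r0).
Qed.

(** Outcomes are indexed by a type [Z] instead of stores, so that the specification of [c2] may
    depend on the abstract result of [c1] without decoding it from the memory. *)
Lemma yields_seqZ (Z : Type) w c1 c2 m (r : rand Z) (g : Z -> store * nat)
    (h : Z -> rand (store * nat)) B1 B2 :
  yields w c1 m (bind r (fun z => Ret (g z))) B1 ->
  every r (fun z => yields w c2 (g z).1 (h z) B2) ->
  yields w (Seq c1 c2) m
    (bind r (fun z => bind (h z) (fun o => Ret (o.1, (g z).2 + o.2))))
    (B1 + B2).+1.
Proof.
move=> y1 y2; rewrite /yields /= -[[:: c1; c2]]/([:: c1] ++ [:: c2]) run_cat.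
have h1 := yields_halts y1; rewrite runl_fuel // !bindA.
apply: (bind_shape (F := fun o : nat * config => o.2)
  (G := fun z => Config [::] (g z).1 (g z).2) _ y2).
  by rewrite -run_runl y1 bindA; apply: eq_bind.
case=> t' [k' m' q'] z /= y2' [-> -> ->]; rewrite addnC.
have := halts_asked (g z).2 (yields_halts y2'); rewrite addn0 => h2.
by rewrite run_mono // -[(g z).2 in LHS]addn0 run_asked y2' !bindA.
Qed.

Lemma yields_seq w c1 c2 m r1 f B1 B2 :
  yields w c1 m r1 B1 -> every r1 (fun o => yields w c2 o.1 (f o) B2) ->
  yields w (Seq c1 c2) m
    (bind r1 (fun o => bind (f o) (fun o' => Ret (o'.1, o.2 + o'.2))))
    (B1 + B2).+1.
Proof.
move=> y1 y2; apply: (yields_seqZ (g := id)) y2.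
by rewrite (_ : bind r1 _ = r1) //; exact: bind_ret.
Qed.

Definition does c m m' B := forall w, yields w c m (Ret (m', 0)) B.

Lemma does_mono c m m' B B' : does c m m' B -> B <= B' -> does c m m' B'.
Proof. by move=> d le w; apply: yields_mono (d w) le. Qed.

Lemma does_eq c m m1 m2 B B' :
  does c m m1 B -> m1 = m2 -> B <= B' -> does c m m2 B'.
Proof. by move=> d <-; apply: does_mono. Qed.

Lemma does_seq c1 c2 m m1 m2 B1 B2 :
  does c1 m m1 B1 -> does c2 m1 m2 B2 -> does (Seq c1 c2) m m2 (B1 + B2).+1.
Proof.
by move=> d1 d2 w; exact: (yields_seq (f := fun=> Ret (m2, 0)) (d1 w) (d2 w)).
Qed.

Lemma does_skip m : does Skip m m 1. Proof. by []. Qed.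

Lemma yields_case w x c0 c1 c2 m r B :
  yields w (match m x with [::] => c0 | false :: _ => c1 | true :: _ => c2 end) m r B ->
  yields w (Case x c0 c1 c2) m r B.+1.
Proof. by []. Qed.

Lemma does_case x c0 c1 c2 m m' B :
  does (match m x with [::] => c0 | false :: _ => c1 | true :: _ => c2 end) m m' B ->
  does (Case x c0 c1 c2) m m' B.+1.
Proof. by move=> d w; apply/yields_case/d. Qed.

Lemma does_while0 x c m : m x = [::] -> does (While x c) m m 1.
Proof. by move=> e w; rewrite /yields /= e. Qed.

Lemma yields_whileS w x c m m1 r B1 B2 : m x <> [::] -> does c m m1 B1 ->
  yields w (While x c) m1 r B2 -> yields w (While x c) m r (B1 + B2).+1.
Proof.
move=> ne d y; rewrite /yields /=; case: (m x) ne => // b s _.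
have := yields_seq (f := fun=> r) (d w) y.
rewrite /yields /= => ->.
by rewrite bindA; apply: eq_bind => -[].
Qed.

Lemma does_whileS x c m m1 m2 B1 B2 : m x <> [::] -> does c m m1 B1 ->
  does (While x c) m1 m2 B2 -> does (While x c) m m2 (B1 + B2).+1.
Proof. by move=> ne d d' w; apply: yields_whileS ne d (d' w). Qed.

Lemma upd_load s x v : upd (load s) x v = load (set_nth [::] s x v).
Proof. by apply: boolp.funext => y; rewrite /upd /load nth_set_nth. Qed.

Lemma does_push x b s :
  does (Push x b) (load s) (load (set_nth [::] s x (b :: nth [::] s x))) 1.
Proof. by move=> w; rewrite /yields /= upd_load. Qed.

Lemma does_pop x s :
  does (Pop x) (load s) (load (set_nth [::] s x (behead (nth [::] s x)))) 1.
Proof. by move=> w; rewrite /yields /= upd_load. Qed.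

(** Relocation lets a subroutine run while the lower [j] stacks hold saved copies of the data. *)
Fixpoint shift j c :=
  match c with
  | Skip => Skip
  | Seq c1 c2 => Seq (shift j c1) (shift j c2)
  | Push x b => Push (j + x) b
  | Pop x => Pop (j + x)
  | Case x c0 c1 c2 => Case (j + x) (shift j c0) (shift j c1) (shift j c2)
  | While x c1 => While (j + x) (shift j c1)
  | Toss x => Toss (j + x)
  | Query a x => Query (j + a) (j + x)
  end.

Definition glue j (m0 m1 : store) : store :=
  fun y => if y < j then m0 y else m1 (y - j).

Lemma glue_at j m0 m1 x : glue j m0 m1 (j + x) = m1 x.
Proof. by rewrite /glue ltnNge leq_addr addKn. Qed.

Lemma upd_glue j m0 m1 x v :
  upd (glue j m0 m1) (j + x) v = glue j m0 (upd m1 x v).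
Proof.
apply: boolp.funext => y; rewrite /upd /glue; case: ltnP => h.
  by case: eqP => // e; lia.
by rewrite -[in y == _](subnKC h) eqn_add2l.
Qed.

Lemma run_shift j m0 w t k m q :
  run w t (map (shift j) k) (glue j m0 m) q =
  bind (run w t k m q) (fun o =>
    Ret (Config (map (shift j) (cont o)) (glue j m0 (mem o)) (asked o))).
Proof.
elim: t k m q => [|t IH] [|[|c1 c2|x b|x|x c0 c1 c2|x c1|x|a x] k] m q //=;
  rewrite ?glue_at ?upd_glue -?IH //.
  by case: (m x) => [|[] ?].
by case: (m x) => *; rewrite -IH.
Qed.

Lemma yields_shift j m0 w c m r B : yields w c m r B ->
  yields w (shift j c) (glue j m0 m)
    (bind r (fun o => Ret (glue j m0 o.1, o.2))) B.
Proof.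
move=> y; rewrite /yields (run_shift j m0 w B [:: c]) y !bindA.
by apply: eq_bind.
Qed.

Lemma glue_load s0 s : glue (size s0) (load s0) (load s) = load (s0 ++ s).
Proof. by apply: boolp.funext => y; rewrite /glue /load nth_cat. Qed.

Lemma does_shift s0 c s s' B : does c (load s) (load s') B ->
  does (shift (size s0) c) (load (s0 ++ s)) (load (s0 ++ s')) B.
Proof. by move=> d w; rewrite -!glue_load; apply: (yields_shift _ _ (d w)). Qed.

Lemma coin_free_shift j c : coin_free (shift j c) = coin_free c.
Proof. by elim: c => //= [c1 -> c2 ->|_ c0 -> c1 -> c2 ->]. Qed.

Ltac load_eq := apply: boolp.funext => -[|[|[|[|[|?]]]]]; rewrite /load //= ?nth_nil.

(** A moved stack arrives reversed, so the programs below move twice to keep the order. *)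
Definition mv x y := While x
  (Case x Skip (Seq (Push y false) (Pop x)) (Seq (Push y true) (Pop x))).

Lemma upd_same m x : upd m x (m x) = m.
Proof. by apply: boolp.funext => y; rewrite /upd; case: eqP => // ->. Qed.

Lemma does_mv' x y m : x != y ->
  does (mv x y) m (upd (upd m x [::]) y (catrev (m x) (m y))) (5 * size (m x) + 1).
Proof.
move=> xy; move eq_v: (m x) => v; elim: v m eq_v => [|b v IH] m mx.
  apply: (does_eq (does_while0 _ _)) => //=.
  apply: boolp.funext => z; rewrite /upd.
  by case: (eqVneq z y) => [->//|_]; case: (eqVneq z x) => [->|].
set m1 := upd (upd m y (b :: m y)) x v.
have step: does (Case x Skip (Seq (Push y false) (Pop x)) (Seq (Push y true) (Pop x))) m m1 4.
  have: does (Seq (Push y b) (Pop x)) m m1 3.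
    move=> w; rewrite /yields /=; do 3 f_equal.
    by rewrite /m1; congr upd; rewrite /upd (negPf xy) mx.
  by move=> d; apply: does_case; rewrite mx; case: b @m1 mx d.
have m1x : m1 x = v by rewrite /m1 /upd eqxx.
apply: (does_eq (does_whileS _ step (IH _ m1x))); rewrite ?mx // /=; last by lia.
apply: boolp.funext => z; rewrite /m1 /upd.
case: (eqVneq z y) => [_|zy]; last by case: (eqVneq z x).
by rewrite eqxx [y == x]eq_sym (negPf xy).
Qed.

Lemma does_mv x y s : x != y ->
  does (mv x y) (load s) (load (set_nth [::] (set_nth [::] s x [::]) y
    (catrev (nth [::] s x) (nth [::] s y)))) (5 * size (nth [::] s x) + 1).
Proof. by move=> xy; have := does_mv' (load s) xy; rewrite !upd_load. Qed.

Definition clear x := While x (Pop x).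

Lemma does_clear' x m : does (clear x) m (upd m x [::]) (2 * size (m x) + 1).
Proof.
move eq_v: (m x) => v; elim: v m eq_v => [|b v IH] m mx.
  by apply: (does_eq (does_while0 _ _)) => //; rewrite -mx upd_same.
have step: does (Pop x) m (upd m x v) 1 by move=> w; rewrite /yields /= mx.
have m1x : upd m x v x = v by rewrite /upd eqxx.
apply: (does_eq (does_whileS _ step (IH _ m1x))); rewrite ?mx // /=; last by lia.
by apply: boolp.funext => z; rewrite /upd; case: eqP.
Qed.

Lemma does_clear x s : does (clear x) (load s)
  (load (set_nth [::] s x [::])) (2 * size (nth [::] s x) + 1).
Proof. by have := @does_clear' x (load s); rewrite upd_load. Qed.

(* Copies stack 0 to stack 1; stack 2 is empty before and after. *)
Definition dup := Seq (mv 0 2) (While 2 (Case 2 Skip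
  (Seq (Push 0 false) (Seq (Push 1 false) (Pop 2)))
  (Seq (Push 0 true) (Seq (Push 1 true) (Pop 2))))).

Lemma does_dup v : does dup (load [:: v]) (load [:: v; v]) (12 * size v + 4).
Proof.
apply: (does_mono (B := (5 * size v + 1 + (7 * size v + 1)).+1)); last by lia.
apply: does_seq; first exact: does_mv.
rewrite /= catrevE cats0 -[in X in does _ _ X](revK v) -(size_rev v).
suff H: forall u v1 v2, does
  (While 2 (Case 2 Skip (Seq (Push 0 false) (Seq (Push 1 false) (Pop 2)))
     (Seq (Push 0 true) (Seq (Push 1 true) (Pop 2)))))
  (load [:: v1; v2; u]) (load [:: catrev u v1; catrev u v2]) (7 * size u + 1).
  have := H (rev v) [::] [::]; rewrite !catrevE !cats0; apply.
elim=> [|b u IH] v1 v2 /=.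
  by apply: (does_eq (does_while0 _ _)) => //; load_eq.
apply: (does_mono (B := (6 + (7 * size u + 1)).+1)); last by lia.
apply: (does_whileS _ _ (IH (b :: v1) (b :: v2))) => //.
apply: does_case => /=; case: b.
all: apply: does_seq (does_push _ _ _) _; apply: does_seq (does_push _ _ _) _.
all: exact: does_pop.
Qed.

Definition swap := Seq (mv 0 2) (Seq (mv 1 3) (Seq (mv 2 1) (mv 3 0))).

Lemma does_swap u v : does swap (load [:: u; v]) (load [:: v; u])
  (10 * (size u + size v) + 7).
Proof.
apply: (does_eq (does_seq (does_mv _ _) (does_seq (does_mv _ _)
  (does_seq (does_mv _ _) (does_mv _ _))))) => //=.
  by rewrite !catrevE !cats0 !revK; load_eq.
by rewrite !catrevE !cats0 !size_rev; lia.
Qed.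

(* All data of the algorithms below are serialised binary trees on stack 0. *)
Inductive tree := Leaf | Node of tree & tree.

Fixpoint ser t : bits :=
  if t is Node a b then true :: ser a ++ ser b else [:: false].

Notation tsz t := (size (ser t)).

Class rep (T : Type) := tr : T -> tree.

#[global] Instance rep_tree : rep tree := id.
#[global] Instance rep_bool : rep bool := fun b => if b then Node Leaf Leaf else Leaf.

Fixpoint tnat n := if n is n'.+1 then Node Leaf (tnat n') else Leaf.

#[global] Instance rep_nat : rep nat := tnat.
#[global] Instance rep_prod A B (ra : rep A) (rb : rep B) : rep (A * B) :=
  fun p => Node (tr p.1) (tr p.2).

Fixpoint tlist A (ra : rep A) (s : seq A) :=
  if s is x :: s' then Node (tr x) (tlist ra s') else Leaf.

#[global] Instance rep_seq A (ra : rep A) : rep (seq A) := tlist ra.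
#[global] Instance rep_tuple A (ra : rep A) n : rep (n.-tuple A) :=
  fun t => tr (tval t).

Notation sz a := (size (ser (tr a))).

Section Psz.
Variables (A : Type) (mu : A -> nat).

(* The bound by a polynomial in [mu]: the shift by 2 makes the powers of the
   base grow, so that a single exponent suffices. *)
Definition psz (u : A -> nat) := exists d, forall a, u a <= (mu a + 2) ^ d.

Lemma psz_le u v : psz v -> (forall a, u a <= v a) -> psz u.
Proof. by case=> d h le; exists d => a; apply: leq_trans (le a) (h a). Qed.

Lemma psz_const n : psz (fun=> n).
Proof.
exists n => a; case: n => // n.
apply: leq_trans (ltnW (ltn_expl _ (isT : 1 < 2))) _.
by rewrite leq_exp2r //; lia.
Qed.

Lemma psz_id : psz mu.
Proof. by exists 1 => a; rewrite expn1; lia. Qed.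

Lemma psz_add u v : psz u -> psz v -> psz (fun a => u a + v a).
Proof.
case=> d hd [e he]; exists (d + e).+1 => a.
have x2 : 1 < mu a + 2 by lia.
have p1 : (mu a + 2) ^ d <= (mu a + 2) ^ (d + e) by rewrite leq_exp2l //; lia.
have p2 : (mu a + 2) ^ e <= (mu a + 2) ^ (d + e) by rewrite leq_exp2l //; lia.
rewrite expnS; have := hd a; have := he a; nia.
Qed.

Lemma psz_mul u v : psz u -> psz v -> psz (fun a => u a * v a).
Proof.
by case=> d hd [e he]; exists (d + e) => a; rewrite expnD leq_mul.
Qed.

Lemma psz_exp u d : psz u -> psz (fun a => u a ^ d).
Proof.
move=> h; elim: d => [|d IH]; first exact: psz_const.
by apply: psz_le (psz_mul h IH) _ => a; rewrite expnS.
Qed.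

End Psz.

Lemma psz_comp (A A' : Type) (mu : A -> nat) (mu' : A' -> nat) (f : A -> A') u :
  psz mu' u -> psz mu (fun a => mu' (f a)) -> psz mu (fun a => u (f a)).
Proof.
case=> d hd hf.
apply: psz_le (psz_exp d (psz_add hf (psz_const mu 2))) _ => a; exact: hd.
Qed.

Notation pbound u := (psz (fun a => sz a) u).

(** All stacks except stack 0 are empty before and after, so such programs compose without any
    cleaning in between. *)
Definition fp A B {ra : rep A} {rb : rep B} (f : A -> B) := exists c u,
  [/\ coin_free c, pbound u &
      forall a, does c (load [:: ser (tr a)]) (load [:: ser (tr (f a))]) (u a)].

Lemma does_size c s s' B x : does c (load s) (load s') B ->
  size (nth [::] s' x) <= size (nth [::] s x) + B.
Proof.
move=> d; have := run_size [::] B [:: c] (load s) 0 x.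
by rewrite (d [::]).
Qed.

Section Fp.
Context {A B D : Type} {ra : rep A} {rb : rep B} {rd : rep D}.

(** A step pushes at most one symbol, so the running time bounds the growth. This is what closes
    polynomial time under composition. *)
Lemma fp_size (f : A -> B) : fp f -> pbound (fun a => sz (f a)).
Proof.
case=> c [u [_ pu h]]; apply: psz_le (psz_add (psz_id _) pu) _ => t.
exact: (does_size 0 (h t)).
Qed.

Lemma fp_ext (f g : A -> B) : f =1 g -> fp g -> fp f.
Proof. by move=> e; rewrite (boolp.funext e). Qed.

Lemma fp_tree (F : tree -> tree) (f : A -> B) :
  fp F -> (forall a, F (tr a) = tr (f a)) -> fp f.
Proof.
case=> c [u [cf [d pu] h]] e; exists c, (fun a => u (tr a)); split=> // [|a].
  by exists d => a; apply: pu.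
by rewrite -e; exact: h (tr a).
Qed.

Lemma fp_id : fp (@id A).
Proof. by exists Skip, (fun=> 1); split=> //; exact: psz_const. Qed.

End Fp.

Lemma fp_comp A B D {ra : rep A} {rb : rep B} {rd : rep D}
  (f : A -> B) (g : B -> D) : fp g -> fp f -> fp (fun a => g (f a)).
Proof.
move=> + FF; have sF := fp_size FF; case: FF => c [u [cf pu h]].
case=> c' [u' [cf' pu' h']].
exists (Seq c c'), (fun t => (u t + u' (f t)).+1); split=> [|| t] /=.
- by rewrite cf.
- apply: psz_le (psz_add (psz_add pu (psz_comp pu' sF)) (psz_const _ 1)) _.
  by move=> t; rewrite addn1.
- exact: does_seq (h t) (h' _).
Qed.

Fixpoint pushes x (v : bits) :=
  if v is b :: v' then Seq (pushes x v') (Push x b) else Skip.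

Lemma does_pushes x v s :
  does (pushes x v) (load s) (load (set_nth [::] s x (v ++ nth [::] s x)))
    (2 * size v + 1).
Proof.
elim: v => [|b v IH] /=.
  apply: (does_eq (does_skip _)) => //; rewrite -upd_load.
  by rewrite -[nth [::] s x]/(load s x) upd_same.
apply: (does_eq (does_seq IH (does_push _ _ _))); last by lia.
by rewrite nth_set_nth /= eqxx set_set_nth eqxx.
Qed.

Lemma coin_free_pushes x v : coin_free (pushes x v).
Proof. by elim: v => //= b v ->. Qed.

Arguments pushes : simpl never.

Lemma fp_const A B {ra : rep A} {rb : rep B} (b : B) : fp (fun _ : A => b).
Proof.
exists (Seq (clear 0) (pushes 0 (ser (tr b)))), (fun a => (2 * sz a + 1 + (2 * sz b + 1)).+1).
split=> [|| t] /=; first by rewrite coin_free_pushes.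
  apply: psz_le (psz_add (psz_mul (psz_const _ 2) (psz_id _))
    (psz_const _ (3 + 2 * sz b))) _ => t; lia.
apply: does_seq; first exact: does_clear.
apply: (does_eq (does_pushes _ _ _)) => //=.
by rewrite cats0.
Qed.

Lemma fp_pair A B D {ra : rep A} {rb : rep B} {rd : rep D}
  (F : A -> B) (G : A -> D) : fp F -> fp G -> fp (fun a => (F a, G a)).
Proof.
move=> FF FG; have sF := fp_size FF; have sG := fp_size FG.
case: FF => c [u [cf pu h]]; case: FG => c' [u' [cf' pu' h']].
exists (Seq dup (Seq (shift 1 c) (Seq swap (Seq (shift 1 c')
  (Seq (mv 0 2) (Seq (mv 2 1) (Seq (Push 1 true) (Seq (mv 1 2) (mv 2 0))))))))).
exists (fun t => 12 * sz t + u t + u' t + 10 * (sz (F t) + sz t) + 10 * sz (F t)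
   + 10 * (sz (F t) + sz (G t)) + 50).
split=> [||t].
- by rewrite /= !coin_free_shift cf cf'.
- do ![apply: psz_add | apply: psz_mul | apply: psz_const | apply: psz_id | assumption].
- apply: (does_eq (does_seq (does_dup _) (does_seq (does_shift [:: _] (h t))
    (does_seq (does_swap _ _) (does_seq (does_shift [:: _] (h' t))
    (does_seq (does_mv _ _) (does_seq (does_mv _ _) (does_seq (does_push _ _ _)
    (does_seq (does_mv _ _) (does_mv _ _)))))))))) => //=.
    by rewrite !catrevE !cats0 !revK rev_cat revK; load_eq.
  rewrite !catrevE !(size_cat, size_rev) /=; lia.
Qed.

(* Moves one serialised tree from stack 0 to stack 2 for each symbol of stack 1,
   which counts the subtrees still to be read. *)
Definition split_loop := While 1 (Case 0 Skip
  (Seq (Push 2 false) (Seq (Pop 0) (Pop 1)))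
  (Seq (Push 2 true) (Seq (Pop 0) (Push 1 true)))).

(** Reading a [Node] replaces one pending subtree by two, reading a [Leaf] removes one. The rest of
    the run is a hypothesis, so that the induction hypotheses for the two subtrees can be
    chained. *)
Lemma does_split_loop a rest n x m' B :
  does split_loop (load [:: rest; nseq n true; catrev (ser a) x]) m' B ->
  does split_loop (load [:: ser a ++ rest; nseq n.+1 true; x]) m' (B + 7 * tsz a).
Proof.
elim: a rest n x B => [|a IHa b IHb] rest n x B d.
  apply: (does_mono (B := (6 + B).+1)); last by rewrite /=; lia.
  apply: does_whileS d => //; apply: does_case => /=.
  apply: does_seq (does_push _ _ _) _; apply: does_seq (does_pop _ _) _ => /=.
  exact: does_pop.
rewrite /= -catA.
have d2 := IHa (ser b ++ rest) n.+1 (true :: x) _ (IHb rest n _ _ _).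
apply: (does_mono (B := (6 + (B + 7 * tsz b + 7 * tsz a)).+1)); last first.
  by rewrite size_cat; lia.
apply: does_whileS (d2 _ _) => //.
  apply: does_case => /=.
  apply: does_seq (does_push _ _ _) _; apply: does_seq (does_pop _ _) _ => /=.
  exact: does_push.
by move: d; rewrite /= !catrevE !rev_cat -!catA.
Qed.

Lemma does_split a rest :
  does split_loop (load [:: ser a ++ rest; [:: true]])
    (load [:: rest; [::]; rev (ser a)]) (7 * tsz a + 1).
Proof.
have -> : load [:: ser a ++ rest; [:: true]] = load [:: ser a ++ rest; nseq 1 true; [::]]
  by load_eq.
rewrite addnC; apply: does_split_loop; rewrite catrevE cats0.
exact: does_while0.
Qed.

Definition tcar t := if t is Node a _ then a else Leaf.
Definition tcdr t := if t is Node _ b then b else Leaf.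

Lemma fp_car : fp tcar.
Proof.
exists (Case 0 Skip Skip (Seq (Pop 0) (Seq (Push 1 true) (Seq split_loop
  (Seq (clear 0) (mv 2 0)))))).
exists (fun t : tree => 14 * tsz t + 20); split=> [//||[|a b]].
- apply: psz_add (psz_mul (psz_const _ _) (psz_id _)) (psz_const _ _).
- by apply: does_case => /=; apply: does_mono (does_skip _) _.
- apply: (does_mono (B := (14 * tsz (Node a b) + 19).+1)); last by lia.
  apply: does_case => /=.
  apply: (does_mono (B := (1 + (1 + (7 * tsz a + 1 + (2 * tsz b + 1 +
    (5 * tsz a + 1)).+1).+1).+1).+1)); last by rewrite size_cat; lia.
  apply: does_seq (does_pop _ _) _ => /=; apply: does_seq (does_push _ _ _) _ => /=.
  apply: does_seq (does_split a (ser b)) _; apply: does_seq; first exact: does_clear.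
  apply: (does_eq (does_mv _ _)) => //=; last by rewrite size_rev.
  by rewrite catrevE revK cats0; load_eq.
Qed.

Lemma fp_cdr : fp tcdr.
Proof.
exists (Case 0 Skip Skip (Seq (Pop 0) (Seq (Push 1 true) (Seq split_loop (clear 2))))).
exists (fun t : tree => 14 * tsz t + 20); split=> [//||[|a b]].
- apply: psz_add (psz_mul (psz_const _ _) (psz_id _)) (psz_const _ _).
- by apply: does_case => /=; apply: does_mono (does_skip _) _.
- apply: (does_mono (B := (14 * tsz (Node a b) + 19).+1)); last by lia.
  apply: does_case => /=.
  apply: (does_mono (B := (1 + (1 + (7 * tsz a + 1 + (2 * tsz a + 1)).+1).+1).+1));
    last by rewrite size_cat; lia.
  apply: does_seq (does_pop _ _) _ => /=; apply: does_seq (does_push _ _ _) _ => /=.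
  apply: does_seq (does_split a (ser b)) _.
  apply: (does_eq (does_clear _ _)) => //=; last by rewrite size_rev.
  by load_eq.
Qed.

Lemma fp_if A B {ra : rep A} {rb : rep B} (F : A -> bool) (G K : A -> B) :
  fp F -> fp G -> fp K -> fp (fun a => if F a then G a else K a).
Proof.
move=> FF FG FK; have sF := fp_size FF.
case: FF => c [u [cf pu h]]; case: FG => c1 [u1 [cf1 pu1 h1]].
case: FK => c2 [u2 [cf2 pu2 h2]].
exists (Seq dup (Seq (shift 1 c) (Case 1 Skip (Seq (clear 1) c2) (Seq (clear 1) c1)))).
exists (fun t => 12 * sz t + u t + 2 * sz (F t) + u1 t + u2 t + 20).
split=> [||t].
- by rewrite /= coin_free_shift cf cf1 cf2.
- do ![apply: psz_add | apply: psz_mul | apply: psz_const | apply: psz_id | assumption].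
- apply: (does_mono (B := (12 * sz t + 4 + (u t + (2 * sz (F t) + 1 +
    (u1 t + u2 t)).+2).+1).+1)); last by lia.
  apply: does_seq (does_dup _) _; apply: does_seq (does_shift [:: _] (h t)) _.
  apply: does_case => /=; case E: (F t) => /=.
    apply: does_seq; first by apply: does_eq (does_clear _ _) _ _.
    rewrite /=; have -> : load [:: ser (tr t); [::]] = load [:: ser (tr t)] by load_eq.
    by apply: does_mono (h1 t) _; lia.
  apply: does_seq; first by apply: does_eq (does_clear _ _) _ _.
  rewrite /=; have -> : load [:: ser (tr t); [::]] = load [:: ser (tr t)] by load_eq.
  by apply: does_mono (h2 t) _; lia.
Qed.

Lemma sz_nat (n : nat) : sz n = (2 * n).+1.
Proof. by rewrite /tr /rep_nat; elim: n => //= n ->; lia. Qed.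

(** Iteration can square or double sizes at every round; the polynomial bound on all intermediate
    states excludes an exponential blow-up. *)
Lemma fp_iter0 A S {ra : rep A} {rs : rep S} (n : A -> nat) (S0 : A -> S) (F : S -> S) :
  fp n -> fp S0 -> fp F ->
  (exists2 u, pbound u &
     forall a i, i <= n a -> sz (iter i F (S0 a)) <= u a) ->
  fp (fun a => iter (n a) F (S0 a)).
Proof.
move=> FN FS FF [b pb hb]; have sN := fp_size FN; have sS := fp_size FS.
case: FN => cn [un [cfn pun hn]]; case: FS => cs [us [cfs pus hs]].
case: FF => c [u [cf [d pu] h]].
(* A serialised number [n] is [n] times the pair [true], [false], then a single [false]: each round
   pops a pair, and the last [false] ends the loop. *)
pose W := While 0 (Case 0 Skip (Pop 0) (Seq (Pop 0) (Seq (Pop 0) (shift 1 c)))).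
exists (Seq dup (Seq (shift 1 cs) (Seq swap (Seq (shift 1 cn) (Seq swap
  (Seq W (Seq (mv 1 2) (mv 2 0)))))))).
exists (fun t => 12 * sz t + us t + 10 * (sz t + sz (S0 t)) + un t
  + 10 * (sz (S0 t) + sz (n t))
  + (n t * ((b t + 2) ^ d + 7) + 5) + 10 * b t + 60).
have pn : pbound n.
  by apply: psz_le sN _ => t; rewrite sz_nat; lia.
split=> [||t].
- by rewrite /= !coin_free_shift cf cfs cfn.
- do ![apply: psz_add | apply: psz_mul | apply: psz_exp | apply: psz_const | apply: psz_id | assumption].
- have HW: forall j s X, (forall i, i < j -> u (iter i F s) <= X) ->
    does W (load [:: ser (tr j); ser (tr s)]) (load [:: [::]; ser (tr (iter j F s))])
      (j * (X + 7) + 5).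
    elim=> [|j IH] s X hX.
      apply: (does_mono (B := (2 + 1).+1)); last by lia.
      apply: (does_whileS (m1 := load [:: [::]; ser (tr s)])) => //.
      by apply: does_case; exact: does_pop.
    apply: (does_mono (B := ((X + 4).+1 + (j * (X + 7) + 5)).+1)); last by lia.
    rewrite iterSr; apply: does_whileS (IH (F s) X _) => //; last first.
      by move=> i ij; rewrite -iterSr; apply: hX; lia.
    apply: does_case => /=; apply: (does_mono (B := (1 + (1 + X).+1).+1)); last by lia.
    apply: does_seq (does_pop _ _) _; apply: does_seq (does_pop _ _) _ => /=.
    apply: (does_shift [:: _]); apply: does_mono (h s) (hX 0 _) => //.
  have {}HW := HW (n t) (S0 t) ((b t + 2) ^ d) _.
  apply: (does_eq (does_seq (does_dup _) (does_seq (does_shift [:: _] (hs t))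
    (does_seq (does_swap _ _) (does_seq (does_shift [:: _] (hn t))
    (does_seq (does_swap _ _) (does_seq (HW _) (does_seq (does_mv _ _)
    (does_mv _ _))))))))) => //=.
  + move=> i ij; apply: leq_trans (pu _) _.
    have h1 := hb t i (ltnW ij).
    by case: (d) => // d'; rewrite leq_exp2r; lia.
  + by rewrite !catrevE !cats0 !revK; load_eq.
  + have := hb t _ (leqnn _).
    rewrite !catrevE !cats0 ?size_rev; set X := _ ^ d; lia.
Qed.

(** * Polynomial-time functions *)

Arguments tr : simpl never.

(* Closure lemmas become hints, and [fpa] follows the shape of a term. Constants are opaque so that
   the search stops at each function with a lemma of its own; the pattern below applies hypotheses
   on function variables to composed arguments. *)
Create HintDb fp discriminated.
#[global] Hint Constants Opaque : fp.
#[global] Hint Variables Opaque : fp.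
#[global] Hint Extern 0 (fp _) => assumption : fp.
#[global] Hint Extern 3 (fp _) =>
  match goal with
  | H : fp ?n |- fp (fun a => ?n (@?g a)) => refine (fp_comp (g := n) (f := g) H _)
  | H : fp (fun p => ?f p.1 p.2) |- fp (fun q => ?f (@?u q) (@?v q)) =>
      refine (fp_comp (f := fun q => (u q, v q)) H _)
  | H : fp (fun p => ?f p.1.1 p.1.2 p.2) |- fp (fun q => ?f (@?u q) (@?v q) (@?x q)) =>
      refine (fp_comp (f := fun q => (u q, v q, x q)) H _)
  end : fp.
Ltac fpa := solve [eauto 200 with fp nocore].

#[global] Hint Resolve fp_id fp_const | 1 : fp.
#[global] Hint Resolve fp_pair fp_if : fp.

Section Basic.
Context {A : Type} {ra : rep A}.

(** Programs see serialised trees only, so types with the same representation share their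
    programs. *)
Lemma fp_rep B A' B' {rb : rep B} {ra' : rep A'} {rb' : rep B'}
    (f : A -> B) (i : A' -> A) (g : A' -> B') :
  fp f -> (forall a, tr (i a) = tr a) -> (forall a, tr (f (i a)) = tr (g a)) ->
  fp g.
Proof.
case=> c [u [cf [d pu] h]] ei e; exists c, (fun a => u (i a)); split=> // [|a].
  by exists d => a; rewrite -ei; apply: pu.
by rewrite -e -ei.
Qed.

End Basic.

Section Basic1.
Context {A : Type} {ra : rep A}.

Lemma fp_cast B B' {rb : rep B} {rb' : rep B'} (f : A -> B) (g : A -> B') :
  fp f -> (forall a, tr (f a) = tr (g a)) -> fp g.
Proof. by move=> h e; exact: (fp_rep (f := f) (i := id)). Qed.

End Basic1.

Section Basic2.
Context {A : Type} {ra : rep A}.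

Lemma fp_fst B D {rb : rep B} {rd : rep D} (f : A -> B * D) :
  fp f -> fp (fun a => (f a).1).
Proof. by apply: fp_comp; apply: (fp_tree fp_car) => -[]. Qed.

Lemma fp_snd B D {rb : rep B} {rd : rep D} (f : A -> B * D) :
  fp f -> fp (fun a => (f a).2).
Proof. by apply: fp_comp; apply: (fp_tree fp_cdr) => -[]. Qed.

Definition isleaf t := if t is Leaf then true else false.

Lemma fp_isleaf : fp isleaf.
Proof.
exists (Case 0 Skip (Seq (Pop 0) (pushes 0 [:: true; false; false]))
  (Seq (clear 0) (Push 0 false))), (fun t => 2 * tsz t + 20); split=> //.
  exact: psz_add (psz_mul (psz_const _ _) (psz_id _)) (psz_const _ _).
move=> t; rewrite addnS; apply: does_case; case: t => [|a b] /=.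
  apply: (does_mono (B := (1 + 7).+1)) => //; apply: does_seq (does_pop _ _) _.
  exact: (does_pushes 0 [:: true; false; false] [:: [::]]).
apply: (does_eq (does_seq (does_clear _ _) (does_push _ _ _))) => //=.
by lia.
Qed.

Lemma fp_sz : fp (fun a : A => sz a).
Proof.
exists (Seq (Push 1 false) (Seq (While 0 (Seq (Pop 0) (pushes 1 [:: true; false])))
  (Seq (mv 1 2) (mv 2 0)))).
exists (fun a => 9 * sz a + 20 * (2 * sz a).+1 + 20); split=> //.
  have h : pbound (fun a => (2 * sz a).+1).
    apply: psz_le (psz_add (psz_mul (psz_const _ 2) (psz_id _)) (psz_const _ 1)) _.
    by move=> a; rewrite addn1.
  do ![apply: psz_add | apply: psz_mul | apply: psz_const | apply: psz_id | assumption].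
move=> a; move: (ser (tr a)) => v.
have H: forall v n, does (While 0 (Seq (Pop 0) (pushes 1 [:: true; false])))
   (load [:: v; ser (tr n)]) (load [:: [::]; ser (tr (size v + n))]) (9 * size v + 1).
  elim=> [|b {}v IH] n; first exact: does_while0.
  apply: (does_mono (B := (8 + (9 * size v + 1)).+1)); last by rewrite /=; lia.
  have -> : size (b :: v) + n = size v + n.+1 by rewrite addnS.
  apply: (does_whileS (m1 := load [:: v; ser (tr n.+1)])) => //.
  apply: (does_mono (B := (1 + 5).+1)) => //; apply: does_seq (does_pop _ _) _.
  exact: (does_pushes 1 [:: true; false] [:: v; ser (tr n)]).
have s1 := sz_nat (size v).
apply: (does_mono (B := (1 + (9 * size v + 1 + (10 * sz (size v) + 3)).+1).+1)); last by lia.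
apply: does_seq (does_push _ _ _) _; apply: does_seq (H v 0) _; rewrite addn0.
apply: (does_eq (does_seq (does_mv _ _) (does_mv _ _))) => //=.
  by rewrite !catrevE !cats0 !revK; load_eq.
by rewrite catrevE cats0 size_rev; lia.
Qed.

Lemma fp_succ (f : A -> nat) : fp f -> fp (fun a => (f a).+1).
Proof. by move=> h; apply: (fp_cast (fp_pair (fp_const Leaf) h)). Qed.

Lemma fp_pred (f : A -> nat) : fp f -> fp (fun a => (f a).-1).
Proof. by apply: fp_comp; apply: (fp_tree fp_cdr) => -[]. Qed.

Lemma fp_eq0 (f : A -> nat) : fp f -> fp (fun a => f a == 0).
Proof.
apply: (fp_comp (g := fun n : nat => n == 0)).
by apply: (fp_rep fp_isleaf (i := fun n : nat => tr n)) => // -[].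
Qed.

Lemma fp_andb (f g : A -> bool) : fp f -> fp g -> fp (fun a => f a && g a).
Proof. by move=> hf hg; have := fp_if hf hg (fp_const false). Qed.

Lemma fp_negb (f : A -> bool) : fp f -> fp (fun a => ~~ f a).
Proof. by move=> hf; have := fp_if hf (fp_const false) (fp_const true). Qed.

Section Lists.
Context {X : Type} {rx : rep X}.

Lemma fp_cons (f : A -> X) (g : A -> seq X) :
  fp f -> fp g -> fp (fun a => f a :: g a).
Proof. by move=> hf hg; apply: (fp_cast (fp_pair hf hg)). Qed.

Lemma fp_behead (f : A -> seq X) : fp f -> fp (fun a => behead (f a)).
Proof. by apply: fp_comp; apply: (fp_tree fp_cdr) => -[]. Qed.

Lemma fp_nilp (f : A -> seq X) : fp f -> fp (fun a => nilp (f a)).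
Proof. by apply: fp_comp; apply: (fp_rep fp_isleaf (i := fun n => tr n)) => // -[]. Qed.

Lemma fp_head x0 (f : A -> seq X) : fp f -> fp (fun a => head x0 (f a)).
Proof.
apply: fp_comp; have h : fp (fun t => if isleaf t then tr x0 else tcar t).
  exact: fp_if fp_isleaf (fp_const _) fp_car.
by apply: (fp_tree h) => -[].
Qed.

End Lists.
End Basic2.

Section Sizes.
Context {X : Type} {rx : rep X}.

Lemma sz_cons (x : X) s : sz (x :: s) = (sz x + sz s).+1.
Proof. by rewrite /tr /rep_seq /= size_cat. Qed.

Lemma sz_nil : sz ([::] : seq X) = 1. Proof. by []. Qed.

Lemma sz_gt0 (x : X) : 0 < sz x.
Proof. by case: (tr x). Qed.

Lemma sz_cat (s1 s2 : seq X) : sz (s1 ++ s2) + 1 = sz s1 + sz s2.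
Proof. by elim: s1 => [|y s IH]; rewrite ?cat_cons ?sz_cons ?cat0s ?sz_nil; lia. Qed.

Lemma size_sz (s : seq X) : size s <= sz s.
Proof. by elim: s => // x s IH; rewrite sz_cons /=; lia. Qed.

Lemma sz_le (s : seq X) b : (forall i x0, i < size s -> sz (nth x0 s i) <= b) ->
  sz s <= size s * b.+1 + 1.
Proof.
elim: s => // x s IH h; rewrite sz_cons /=; have := h 0 x isT => /= h0.
have := IH (fun i x0 => h i.+1 x0); lia.
Qed.

Lemma sz_pair Y {ry : rep Y} (x : X) (y : Y) : sz (x, y) = (sz x + sz y).+1.
Proof. by rewrite /tr /rep_prod /= size_cat. Qed.
End Sizes.

#[global] Hint Resolve fp_fst fp_snd fp_succ fp_pred fp_eq0 fp_andb
  fp_negb fp_cons fp_behead fp_nilp fp_head : fp.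

Section Loops.
Context {A S X : Type} {ra : rep A} {rs : rep S} {rx : rep X}.

Lemma fp_iter (n : A -> nat) (s0 : A -> S) (f : A -> S -> S) :
  fp n -> fp s0 -> fp (fun p : A * S => f p.1 p.2) ->
  (exists2 u, pbound u & forall a i, i <= n a -> sz (iter i (f a) (s0 a)) <= u a) ->
  fp (fun a => iter (n a) (f a) (s0 a)).
Proof.
move=> hn hs hf [u pu hu].
have E: forall a i, iter i (fun p : A * S => (p.1, f p.1 p.2)) (a, s0 a) =
   (a, iter i (f a) (s0 a)).
  by move=> a; elim=> //= i ->.
have: fp (fun a => iter (n a) (fun p : A * S => (p.1, f p.1 p.2)) (a, s0 a)).
  apply: fp_iter0 => //; try fpa.
  exists (fun a => (sz a + u a).+1).
    apply: psz_le (psz_add (psz_add (psz_id _) pu) (psz_const _ 1)) _ => a; lia.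
  by move=> a i /hu; rewrite E sz_pair; lia.
by move=> /fp_snd; apply: fp_ext => a; rewrite E.
Qed.

(** If a round adds an amount that depends on the input but not on the state, sizes grow linearly in
    the number of rounds. *)
Lemma fp_iter_add (n : A -> nat) (s0 : A -> S) (f : A -> S -> S) :
  fp n -> fp s0 -> fp (fun p : A * S => f p.1 p.2) ->
  (exists2 u, pbound u & forall a s, sz (f a s) <= sz s + u a) ->
  fp (fun a => iter (n a) (f a) (s0 a)).
Proof.
move=> hn hs hf [u pu hu]; apply: fp_iter => //.
have pn : pbound n.
  by apply: psz_le (fp_size hn) _ => a; rewrite sz_nat; lia.
exists (fun a => sz (s0 a) + n a * u a).
  exact: psz_add (fp_size hs) (psz_mul pn pu).
move=> a i le; apply: (@leq_trans (sz (s0 a) + i * u a)); last first.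
  by rewrite leq_add2l leq_mul2r le orbT.
elim: i {le} => [|i IH] //=; first by lia.
by have := hu a (iter i (f a) (s0 a)); lia.
Qed.

End Loops.

Section Loops1.
Context {A S X : Type} {ra : rep A} {rs : rep S} {rx : rep X}.

Lemma fp_foldl (l : A -> seq X) (s0 : A -> S) (f : A -> S -> X -> S) :
  fp l -> fp s0 -> fp (fun p : A * S * X => f p.1.1 p.1.2 p.2) ->
  (exists2 u, pbound u & forall a l1 l2, l a = l1 ++ l2 ->
     sz (foldl (f a) (s0 a) l1) <= u a) ->
  fp (fun a => foldl (f a) (s0 a) (l a)).
Proof.
move=> hl hs hf [u pu hu].
(* The loop reads elements with [head], which needs a default; over an empty type all lists are
   empty and the fold is its initial value. *)
have [[x0 _]|none] := pselect (exists x : X, True); last first.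
  apply: fp_ext hs => a; case: (l a) => // x s; case: none; by exists x.
pose step a (p : seq X * S) := if nilp p.1 then p else
  (behead p.1, f a p.2 (head x0 p.1)).
have E: forall a i l1 s, i <= size l1 ->
   iter i (step a) (l1, s) = (drop i l1, foldl (f a) s (take i l1)).
  move=> a; elim=> [|i IH] l1 s h; first by rewrite drop0 take0.
  rewrite iterSr; case: l1 h => // x l1 h; rewrite /step /= -/(step a).
  by rewrite IH.
have E': forall a l1 s j, iter (size l1 + j) (step a) (l1, s) = ([::], foldl (f a) s l1).
  move=> a l1 s j; rewrite addnC iterD E // drop_size take_size.
  by elim: j => //= j ->.
(* No program for the length of a list exists at this point. The serialised size is at least as
   large, and surplus rounds leave an exhausted list alone. *)
have: fp (fun a => iter (sz (l a)) (step a) (l a, s0 a)).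
  apply: fp_iter.
  - exact: fp_comp fp_sz hl.
  - fpa.
  - rewrite /step.
    have h1: fp (fun p : A * (seq X * S) => f p.1 p.2.2 (head x0 p.2.1)).
      apply: (fp_comp (g := fun p : A * S * X => f p.1.1 p.1.2 p.2)
        (f := fun p : A * (seq X * S) => ((p.1, p.2.2), head x0 p.2.1)) hf).
      fpa.
    fpa.
  - exists (fun a => (sz (l a) + u a).+1).
      apply: psz_le (psz_add (psz_add (fp_size hl) pu) (psz_const _ 1)) _ => a; lia.
    move=> a i _.
    case: (leqP i (size (l a))) => h.
      rewrite E // sz_pair.
      have := hu a (take i (l a)) (drop i (l a)); rewrite cat_take_drop => /(_ erefl).
      have := @sz_cat X rx (take i (l a)) (drop i (l a)); rewrite cat_take_drop.
      by have := @sz_gt0 _ (rep_seq rx) (take i (l a)); lia.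
    rewrite -(subnKC (ltnW h)) E' sz_pair sz_nil.
    have := hu a (l a) [::]; rewrite cats0 => /(_ erefl).
    by have := @sz_gt0 _ (rep_seq rx) (l a); lia.
move=> /fp_snd; apply: fp_ext => a.
by rewrite -(subnKC (size_sz (l a))) E'.
Qed.

Lemma fp_foldl_add (l : A -> seq X) (s0 : A -> S) (f : A -> S -> X -> S) :
  fp l -> fp s0 -> fp (fun p : A * S * X => f p.1.1 p.1.2 p.2) ->
  (exists2 u, pbound u & forall a s x, sz (f a s x) <= sz s + u (a, x)) ->
  fp (fun a => foldl (f a) (s0 a) (l a)).
Proof.
move=> hl hs hf [u [d pu] hu]; apply: fp_foldl => //.
exists (fun a => sz (s0 a) + sz (l a) * (sz a + sz (l a) + 3) ^ d).
  by do ![apply: psz_add|apply: psz_mul|apply: psz_exp|apply: psz_const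
    |apply: psz_id|apply: fp_size].
move=> a l1 l2 e; apply: (@leq_trans (sz (s0 a) + size l1 * (sz a + sz (l a) + 3) ^ d)).
  (* Prefixes are controlled through the sizes of their elements, because [X] has no decidable
     equality and hence no membership. *)
  have: forall l1', {subset [seq sz x | x <- l1'] <= [seq sz x | x <- l a]} -> sz (foldl (f a) (s0 a) l1') <=
    sz (s0 a) + size l1' * (sz a + sz (l a) + 3) ^ d.
    elim/last_ind => [|l1' x IH] sub; first by rewrite mul0n addn0.
    rewrite foldl_rcons size_rcons; have := hu a (foldl (f a) (s0 a) l1') x.
    have h1 : u (a, x) <= (sz a + sz (l a) + 3) ^ d.
      apply: leq_trans (pu _) _; case: (d) => // d'; rewrite leq_exp2r // sz_pair.
      have /sub : sz x \in [seq sz x | x <- rcons l1' x].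
        by rewrite map_rcons mem_rcons inE eqxx.
      elim: (l a) => // y s IH'; rewrite map_cons inE sz_cons => /orP [/eqP <-|/IH']; lia.
    have := IH _; set Y := _ ^ d in h1 *; rewrite mulSn => IH' h2.
    apply: leq_trans h2 _; rewrite addnCA addnC; apply: leq_add => //.
    by apply: IH' => y hy; apply: sub; rewrite map_rcons mem_rcons inE hy orbT.
  by apply; rewrite e map_cat => y hy; rewrite mem_cat hy.
rewrite leq_add2l leq_mul2r; apply/orP; right.
by apply: leq_trans (size_sz _); rewrite e size_cat leq_addr.
Qed.

Lemma fp_foldl_reset (l : A -> seq X) (s0 : A -> S) (f : A -> S -> X -> S) :
  fp l -> fp s0 -> fp (fun p : A * S * X => f p.1.1 p.1.2 p.2) ->
  (exists2 u, pbound u & forall a s x, sz (f a s x) <= u (a, x)) ->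
  fp (fun a => foldl (f a) (s0 a) (l a)).
Proof.
move=> hl hs hf [u pu hu]; apply: fp_foldl_add => //.
by exists u => // a s x; apply: leq_trans (hu _ _ _) _; exact: leq_addl.
Qed.

End Loops1.

Lemma pbound_snd A X {ra : rep A} {rx : rep X} : pbound (fun p : A * X => sz p.2).
Proof. by apply: psz_le (psz_id _) _ => -[a x]; rewrite sz_pair /=; lia. Qed.

Lemma pbound_nat A {ra : rep A} (f : A -> nat) : fp f -> pbound f.
Proof. by move=> h; apply: psz_le (fp_size h) _ => a; rewrite sz_nat; lia. Qed.

Section Library.
Context {A X : Type} {ra : rep A} {rx : rep X}.

Lemma fp_catrev (s t : A -> seq X) : fp s -> fp t ->
  fp (fun a => catrev (s a) (t a)).
Proof.
move=> hs ht; have: fp (fun a => foldl (fun l x => x :: l) (t a) (s a)).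
  apply: fp_foldl_add; try fpa.
  exists (fun p => sz p.2 + 1); first exact: psz_add (pbound_snd) (psz_const _ _).
  by move=> a l x; rewrite sz_cons /=; lia.
apply: fp_ext => a; elim: (s a) (t a) => //= x l IH t'; exact: IH.
Qed.

Lemma fp_rev (s : A -> seq X) : fp s -> fp (fun a => rev (s a)).
Proof. by move=> h; exact: fp_catrev h (fp_const [::]). Qed.

End Library.

Section Library1.
Context {A X : Type} {ra : rep A} {rx : rep X}.

Lemma fp_cat (s t : A -> seq X) : fp s -> fp t -> fp (fun a => s a ++ t a).
Proof.
move=> hs ht; apply: fp_ext (fp_catrev (fp_rev hs) ht) => a.
by rewrite catrevE revK.
Qed.

Lemma fp_rcons (s : A -> seq X) (t : A -> X) : fp s -> fp t ->
  fp (fun a => rcons (s a) (t a)).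
Proof.
move=> hs ht; apply: fp_ext (fp_cat hs (fp_cons ht (fp_const [::]))) => a.
by rewrite cats1.
Qed.

Lemma fp_size_seq (s : A -> seq X) : fp s -> fp (fun a => size (s a)).
Proof.
move=> hs; have: fp (fun a => foldl (fun n _ => n.+1) 0 (s a)).
  apply: fp_foldl_add; try fpa.
  exists (fun=> 2); first exact: psz_const.
  by move=> a l x; rewrite !sz_nat; lia.
apply: fp_ext => a; rewrite -[LHS]addn0; move: 0; elim: (s a) => //= x l IH n.
by rewrite -IH addSnnS.
Qed.

Lemma fp_map Y {ry : rep Y} (f : A -> X -> Y) (l : A -> seq X) :
  fp (fun p : A * X => f p.1 p.2) -> fp l -> fp (fun a => map (f a) (l a)).
Proof.
move=> hf hl; have: fp (fun a => rev (foldl (fun s x => f a x :: s) [::] (l a))).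
  apply: fp_rev; apply: (@fp_foldl_add _ _ _ _ _ _ l (fun=> [::]) (fun a s x => f a x :: s)) => //; first fpa.
    by apply: fp_cons; [apply: (fp_comp (f := fun p : A * seq Y * X => (p.1.1, p.2)) hf) | ]; fpa.
  exists (fun p => sz (f p.1 p.2) + 1); first exact: psz_add (fp_size hf) (psz_const _ _).
  by move=> a s x; rewrite sz_cons /=; lia.
suff E: forall g s (t : seq Y), rev t ++ map g s = rev (foldl (fun s (x : X) => g x :: s) t s).
  by apply: fp_ext => a; exact: (E (f a) (l a) [::]).
move=> g; elim=> /= [|x s IH] t; first by rewrite cats0.
by rewrite -IH rev_cons cat_rcons.
Qed.

Lemma fp_filter (f : A -> X -> bool) (l : A -> seq X) :
  fp (fun p : A * X => f p.1 p.2) -> fp l -> fp (fun a => filter (f a) (l a)).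
Proof.
move=> hf hl; have: fp (fun a => rev (foldl (fun s x => if f a x then x :: s else s) [::] (l a))).
  apply: fp_rev; apply: (@fp_foldl_add _ _ _ _ _ _ l (fun=> [::]) (fun a s x => if f a x then x :: s else s)) => //; first fpa.
    by apply: fp_if; [apply: (fp_comp (f := fun p : A * seq X * X => (p.1.1, p.2)) hf) | |]; fpa.
  exists (fun p => sz p.2 + 1); first exact: psz_add pbound_snd (psz_const _ _).
  by move=> a s x; case: (f a x); rewrite ?sz_cons /=; lia.
suff E: forall g s t, rev t ++ filter g s = rev (foldl (fun s (x : X) => if g x then x :: s else s) t s).
  by apply: fp_ext => a; exact: (E (f a) (l a) [::]).
move=> g; elim=> /= [|x s IH] t; first by rewrite cats0.
by rewrite -IH; case: (g x); rewrite // rev_cons cat_rcons.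
Qed.

Lemma fp_count (f : A -> X -> bool) (l : A -> seq X) :
  fp (fun p : A * X => f p.1 p.2) -> fp l -> fp (fun a => count (f a) (l a)).
Proof.
move=> hf hl; apply: fp_ext (fp_size_seq (fp_filter hf hl)) => a.
by rewrite size_filter.
Qed.

Lemma fp_all (f : A -> X -> bool) (l : A -> seq X) :
  fp (fun p : A * X => f p.1 p.2) -> fp l -> fp (fun a => all (f a) (l a)).
Proof.
move=> hf hl; have h: fp (fun a => filter (fun x => ~~ f a x) (l a)).
  by apply: (fp_filter (f := fun a x => ~~ f a x)) => //; exact: fp_negb.
apply: fp_ext (fp_nilp h) => a.
by elim: (l a) => //= x s ->; case: (f a x).
Qed.

End Library1.

Section Library2.
Context {A X : Type} {ra : rep A} {rx : rep X}.

Lemma fp_flatten (l : A -> seq (seq X)) : fp l -> fp (fun a => flatten (l a)).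
Proof.
move=> hl; have: fp (fun a => foldl (fun s x => s ++ x) [::] (l a)).
  apply: (fp_foldl_add (f := fun _ s x => s ++ x)) => //; [fpa | exact: (fp_cat (s := fun p : A * seq X * seq X => p.1.2) (t := snd) (fp_snd (fp_fst fp_id)) (fp_snd fp_id)) |].
  exists (fun p => sz p.2); first exact: pbound_snd.
  by move=> a s x; have := @sz_cat X rx s x; cbn [snd]; lia.
apply: fp_ext => a; rewrite -[LHS]cat0s.
by elim: (l a) [::] => /= [|x s IH] t; rewrite ?cats0 // -IH catA.
Qed.

Lemma fp_drop (n : A -> nat) (l : A -> seq X) : fp n -> fp l ->
  fp (fun a => drop (n a) (l a)).
Proof.
move=> hn hl; have: fp (fun a => iter (n a) behead (l a)).
  apply: fp_iter_add => //; first fpa.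
  exists (fun=> 0); first exact: psz_const.
  by move=> _ [|x s]; rewrite ?sz_cons //=; lia.
apply: fp_ext => a; elim: (n a) (l a) => [|i IH] s; first by rewrite drop0.
by rewrite iterSr -IH; case: s.
Qed.

Lemma fp_nth x0 (l : A -> seq X) (n : A -> nat) : fp n -> fp l ->
  fp (fun a => nth x0 (l a) (n a)).
Proof.
move=> hn hl; apply: fp_ext (fp_head x0 (fp_drop hn hl)) => a.
by elim: (n a) (l a) => [|i IH] [|x s] //=; rewrite IH.
Qed.

Lemma fp_find (f : A -> X -> bool) (l : A -> seq X) :
  fp (fun p : A * X => f p.1 p.2) -> fp l -> fp (fun a => find (f a) (l a)).
Proof.
move=> hf hl.
pose g a (s : bool * nat) x := if s.1 then s else if f a x then (true, s.2) else (false, s.2.+1).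
have: fp (fun a => (foldl (g a) (false, 0) (l a)).2).
  apply: fp_snd; apply: fp_foldl_add => //; first fpa.
    have hf' : fp (fun p : A * (bool * nat) * X => f p.1.1 p.2).
      by apply: (fp_comp (f := fun p : A * (bool * nat) * X => (p.1.1, p.2)) hf); fpa.
    by rewrite /g; fpa.
  exists (fun=> 5); first exact: psz_const.
  move=> a [[] n] x; rewrite /g; cbn [fst snd]; first by lia.
  have ->: sz (false, n) = sz n + 2 by rewrite sz_pair addn2.
  case: (f a x); last by rewrite sz_pair !sz_nat (_ : sz false = 1) //; lia.
  by rewrite sz_pair (_ : sz true = 3) //; lia.
apply: fp_ext => a.
have h1: forall s n, foldl (g a) (true, n) s = (true, n) by elim.
rewrite -[LHS]add0n; elim: (l a) 0 => /= [|x s IH] n; first by rewrite addn0.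
by rewrite {2}/g /=; case: (f a x); rewrite ?h1 ?addn0 // addnS -addSn IH.
Qed.

End Library2.

#[global] Hint Resolve fp_catrev fp_rev fp_cat fp_rcons fp_size_seq fp_map fp_filter
  fp_count fp_all fp_flatten fp_drop fp_nth fp_find : fp.

Section Arith.
Context {A : Type} {ra : rep A}.
Implicit Types m n : A -> nat.

Lemma fp_addn m n : fp m -> fp n -> fp (fun a => m a + n a).
Proof.
move=> hm hn; have: fp (fun a => iter (m a) S (n a)).
  apply: fp_iter_add => //; first fpa.
  by exists (fun=> 2); [exact: psz_const | move=> _ s; rewrite !sz_nat; lia].
by apply: fp_ext => a; elim: (m a) => // i IH; rewrite iterS -IH.
Qed.

Lemma fp_subn m n : fp m -> fp n -> fp (fun a => m a - n a).
Proof.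
move=> hm hn; have: fp (fun a => iter (n a) predn (m a)).
  apply: fp_iter_add => //; first fpa.
  by exists (fun=> 2); [exact: psz_const | move=> _ s; rewrite !sz_nat; lia].
by apply: fp_ext => a; elim: (n a) => [|i IH] /=; [rewrite subn0 | lia].
Qed.

End Arith.

Section Arith1.
Context {A : Type} {ra : rep A}.
Implicit Types m n : A -> nat.

Lemma fp_muln m n : fp m -> fp n -> fp (fun a => m a * n a).
Proof.
move=> hm hn; have: fp (fun a => iter (m a) (addn (n a)) 0).
  apply: (fp_iter_add (f := fun a s => n a + s)) => //; first fpa.
    apply: fp_addn; try fpa.
  by exists (fun a => 2 * n a); [apply: psz_mul (psz_const _ _) (pbound_nat hn)
    | move=> a s; rewrite !sz_nat; lia].
by apply: fp_ext => a; elim: (m a) => [|i IH] //=; rewrite mulSn IH.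
Qed.
End Arith1.

#[global] Hint Resolve fp_addn fp_subn fp_muln : fp.

Section Arith2.
Context {A : Type} {ra : rep A}.
Implicit Types m n : A -> nat.

Lemma fp_leq m n : fp m -> fp n -> fp (fun a => m a <= n a).
Proof. by move=> hm hn; rewrite /leq; fpa. Qed.

Lemma fp_expn m d : fp m -> fp (fun a => m a ^ d).
Proof.
move=> hm; elim: d => [|d IH]; first exact: fp_const.
by apply: (fp_ext (g := fun a => m a * m a ^ d)); [move=> a; rewrite expnS | fpa].
Qed.

End Arith2.

#[global] Hint Resolve fp_leq fp_expn : fp.

Section Arith3.
Context {A : Type} {ra : rep A}.
Implicit Types m n : A -> nat.

Lemma fp_eqn m n : fp m -> fp n -> fp (fun a => m a == n a).
Proof.
move=> hm hn; apply: (fp_ext (g := fun a => (m a <= n a) && (n a <= m a))).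
  by move=> a; rewrite eqn_leq.
fpa.
Qed.

Lemma fp_minn m n : fp m -> fp n -> fp (fun a => minn (m a) (n a)).
Proof.
move=> hm hn; apply: (fp_ext (g := fun a => if m a <= n a then m a else n a)).
  by move=> a; case: leqP; lia.
fpa.
Qed.

Lemma fp_maxn m n : fp m -> fp n -> fp (fun a => maxn (m a) (n a)).
Proof.
move=> hm hn; apply: (fp_ext (g := fun a => if m a <= n a then n a else m a)).
  by move=> a; case: leqP; lia.
fpa.
Qed.

Lemma fp_iota m n : fp m -> fp n -> fp (fun a => iota (m a) (n a)).
Proof.
move=> hm hn; have: fp (fun a => iter (n a) (fun s => 0 :: map S s) [::]).
  apply: (fp_iter (f := fun _ s => 0 :: map S s)) => //; try fpa.
  have E: forall i, iter i (fun s => 0 :: map S s) [::] = iota 0 i.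
    elim=> // i; rewrite iterS => ->; rewrite [RHS]/=; congr (_ :: _).
    exact/esym/(iotaDl 1 0).
  exists (fun a => n a * (2 * n a + 2) + 1).
    have pn := pbound_nat hn.
    by do ![apply: psz_add|apply: psz_mul|apply: psz_const|assumption].
  move=> a i h; rewrite E; apply: leq_trans (sz_le (b := 2 * i + 1) _) _.
    by move=> j x0; rewrite size_iota sz_nat => hj; rewrite nth_iota //; lia.
  rewrite size_iota leq_add2r; apply: leq_mul => //; lia.
move=> h; apply: (fp_ext (g := fun a => map (addn (m a)) (iter (n a) (fun s => 0 :: map S s) [::]))).
  move=> a; rewrite -{1}[m a]addn0 iotaDl; congr map.
  elim: (n a) => // i; rewrite iterS => <-; rewrite [LHS]/=; congr (_ :: _).
  exact: (iotaDl 1 0).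
by apply: (fp_map (f := fun a => addn (m a))); fpa.
Qed.
End Arith3.

#[global] Hint Resolve fp_eqn fp_minn fp_maxn fp_iota : fp.

Section Arith4.
Context {A : Type} {ra : rep A}.
Implicit Types m n : A -> nat.

Lemma fp_mkseq X {rx : rep X} (f : A -> nat -> X) n : fp (fun p : A * nat => f p.1 p.2) ->
  fp n -> fp (fun a => mkseq (f a) (n a)).
Proof. by move=> hf hn; rewrite /mkseq; fpa. Qed.

Lemma fp_divn m n : fp m -> fp n -> fp (fun a => m a %/ n a).
Proof.
move=> hm hn; apply: (fp_ext (g := fun a => if n a == 0 then 0 else
  count (fun q => q.+1 * n a <= m a) (iota 0 (m a)))); last first.
  fpa.
move=> a; case: eqP => [->|/eqP]; first by rewrite divn0.
rewrite -lt0n => n0; rewrite -size_filter.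
rewrite (@eq_filter _ _ (fun q => q < m a %/ n a)); last by move=> q; rewrite /= leq_divRL.
rewrite (_ : [seq q <- _ | _] = iota 0 (m a %/ n a)) ?size_iota //.
exact: (filter_iota_ltn 0 (leq_div (m a) (n a))).
Qed.

Lemma fp_nat_of_bool (b : A -> bool) : fp b -> fp (fun a => nat_of_bool (b a)).
Proof. by move=> h; apply: fp_ext (fp_if h (fp_const 1) (fp_const 0)) => a; case: (b a). Qed.

End Arith4.

#[global] Hint Resolve fp_mkseq fp_divn fp_nat_of_bool : fp.

Section Arith5.
Context {A : Type} {ra : rep A}.
Implicit Types m n : A -> nat.

Lemma fp_modn m n : fp m -> fp n -> fp (fun a => m a %% n a).
Proof.
move=> hm hn; apply: (fp_ext (g := fun a => m a - m a %/ n a * n a)); last fpa.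
by move=> a; rewrite {2}(divn_eq (m a) (n a)) addKn.
Qed.

Lemma fp_take X {rx : rep X} n (l : A -> seq X) : fp n -> fp l ->
  fp (fun a => take (n a) (l a)).
Proof.
move=> hn hl; apply: (fp_ext (g := fun a => rev (drop (size (l a) - n a) (rev (l a))))); last fpa.
move=> a; rewrite drop_rev revK; case: (leqP (n a) (size (l a))) => h; first by rewrite subKn.
by rewrite (_ : size (l a) - n a = 0) ?subn0 ?take_size ?take_oversize //; lia.
Qed.

Lemma fp_eqb (b c : A -> bool) : fp b -> fp c -> fp (fun a => b a == c a).
Proof.
move=> hb hc; apply: (fp_ext (g := fun a => if b a then c a else ~~ c a)); last fpa.
by move=> a; case: (b a) (c a) => -[].
Qed.

Lemma fp_odd n : fp n -> fp (fun a => odd (n a)).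
Proof.
move=> hn; have h : fp (fun a => n a %% 2) by apply: fp_modn; fpa.
apply: (fp_ext (g := fun a => n a %% 2 == 1)); last fpa.
by move=> a; rewrite modn2; case: (odd _).
Qed.

End Arith5.

#[global] Hint Resolve fp_modn fp_take fp_eqb fp_odd : fp.

Lemma fp_eqbits A {ra : rep A} (s t : A -> seq bool) : fp s -> fp t ->
  fp (fun a => s a == t a).
Proof.
move=> hs ht; apply: (fp_ext (g := fun a => (size (s a) == size (t a)) &&
  all (fun i => nth false (s a) i == nth false (t a) i) (iota 0 (size (s a))))); last first.
  apply: fp_andb; first fpa.
  apply: (fp_all (f := fun a i => nth false (s a) i == nth false (t a) i)); last fpa.
  by apply: fp_eqb; apply: fp_nth; fpa.
move=> a; apply/eqP/andP => [->|[/eqP e /allP h]].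
  by rewrite eqxx; split=> //; apply/allP => i _.
apply: (@eq_from_nth _ false) => // i hi; apply/eqP/h; by rewrite mem_iota.
Qed.
#[global] Hint Resolve fp_eqbits : fp.

(** * Randomised polynomial-time algorithms *)

Lemma yields_whileZ (Z : Type) w x c m (r : rand Z) (g : Z -> store * nat)
    (h : Z -> rand (store * nat)) B1 B2 : m x <> [::] ->
  yields w c m (bind r (fun z => Ret (g z))) B1 ->
  every r (fun z => yields w (While x c) (g z).1 (h z) B2) ->
  yields w (While x c) m
    (bind r (fun z => bind (h z) (fun o => Ret (o.1, (g z).2 + o.2))))
    (B1 + B2).+1.
Proof.
move=> ne y1 y2; have := yields_seqZ y1 y2; rewrite /yields /=.
by case: (m x) ne.
Qed.

Lemma yields_eq w c m r r' B B' : yields w c m r B -> r = r' -> B <= B' ->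
  yields w c m r' B'.
Proof. by move=> y <-; apply: yields_mono. Qed.

Lemma yields_size w c m r B x : yields w c m r B ->
  every r (fun o => size (o.1 x) <= size (m x) + B).
Proof.
by move=> y; have := run_size w B [:: c] m 0 x; rewrite y every_bind.
Qed.

Fixpoint coins n : rand bits :=
  if n is n'.+1 then
    Flip (bind (coins n') (fun c => Ret (true :: c)))
         (bind (coins n') (fun c => Ret (false :: c)))
  else Ret [::].

(** The randomised oracle counterpart of [fp]: [G w a] is the coin tree of results paired with the
    number of queries made. *)
Definition rp A B {ra : rep A} {rb : rep B} (G : bits -> A -> rand (B * nat)) :=
  exists c u, pbound u /\
    forall w a, yields w c (load [:: ser (tr a)])
      (bind (G w a) (fun o => Ret (load [:: ser (tr o.1)], o.2))) (u a).

Lemma rp_fp A B {ra : rep A} {rb : rep B} (f : A -> B) : fp f ->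
  rp (fun _ a => Ret (f a, 0)).
Proof. by case=> c [u [_ pu h]]; exists c, u; split=> // w a; exact: h. Qed.

Lemma rp_bind A B D {ra : rep A} {rb : rep B} {rd : rep D}
    (G : bits -> A -> rand (B * nat)) (K : bits -> B -> rand (D * nat)) :
  rp G -> rp K ->
  rp (fun w a => bind (G w a) (fun o => bind (K w o.1) (fun o' =>
        Ret (o'.1, o.2 + o'.2)))).
Proof.
case=> c [u [pu h]] [c' [u' [[d pu'] h']]].
exists (Seq c c'), (fun a => (u a + (sz a + u a + 2) ^ d).+1); split.
  apply: psz_le (psz_add (psz_add pu (psz_exp d (psz_add (psz_add (psz_id _) pu)
    (psz_const _ 2)))) (psz_const _ 1)) _ => a; lia.
move=> w a; have H: every (G w a) (fun z : B * nat => yields w c' (load [:: ser (tr z.1)], z.2).1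
   (bind (K w z.1) (fun o' => Ret (load [:: ser (tr o'.1)], o'.2))) ((sz a + u a + 2) ^ d)).
  have := yields_size 0 (h w a); rewrite every_bind.
  apply: every_imp => -[b q] /= hb; apply: yields_mono (h' w b) _.
  apply: leq_trans (pu' b) _; case: (d) => // e; rewrite leq_exp2r //.
  by rewrite leq_add2r.
apply: yields_eq (yields_seqZ (g := fun o => (load [:: ser (tr o.1)], o.2)) (h w a) H) _ (leqnn _).
rewrite !bindA; apply: eq_bind => -[b q] /=; rewrite !bindA.
by apply: eq_bind.
Qed.

Lemma rp_ext A B {ra : rep A} {rb : rep B} (G K : bits -> A -> rand (B * nat)) :
  (forall w a, G w a = K w a) -> rp K -> rp G.
Proof.
by move=> e [c [u [pu h]]]; exists c, u; split=> // w a; rewrite e; exact: h.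
Qed.

Definition join := Seq (mv 0 2) (Seq (mv 2 1) (Seq (Push 1 true) (Seq (mv 1 2) (mv 2 0)))).

Lemma does_join u v : does join (load [:: u; v]) (load [:: true :: u ++ v])
  (20 * (size u + size v) + 30).
Proof.
apply: (does_eq (does_seq (does_mv _ _) (does_seq (does_mv _ _)
  (does_seq (does_push _ _ _) (does_seq (does_mv _ _) (does_mv _ _)))))) => //=.
  by rewrite !catrevE !cats0 !revK rev_cat revK; load_eq.
rewrite !catrevE !(size_cat, size_rev) /=; lia.
Qed.

Lemma bind_ret_add (r : rand (store * nat)) :
  bind r (fun o => Ret (o.1, 0 + o.2)) = r.
Proof. by rewrite -[RHS]bind_ret; apply: eq_bind => -[]. Qed.

Lemma yields_does_l w c1 c2 m m1 r B1 B2 : does c1 m m1 B1 -> yields w c2 m1 r B2 ->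
  yields w (Seq c1 c2) m r (B1 + B2).+1.
Proof.
move=> d y; have := yields_seqZ (g := fun=> (m1, 0)) (r := Ret tt) (h := fun=> r)
   (d w) y.
by rewrite /= bind_ret_add.
Qed.

Lemma yields_does_r (Z : Type) w c1 c2 m (r : rand Z) (g : Z -> store * nat) (g' : Z -> store) B1 B2 :
  yields w c1 m (bind r (fun z => Ret (g z))) B1 ->
  every r (fun z => does c2 (g z).1 (g' z) B2) ->
  yields w (Seq c1 c2) m (bind r (fun z => Ret (g' z, (g z).2))) (B1 + B2).+1.
Proof.
move=> y d; have := yields_seqZ (h := fun z => Ret (g' z, 0)) y (every_imp (fun z h => h w) d).
by move=> y'; apply: yields_eq y' _ (leqnn _); apply: eq_bind => z /=; rewrite addn0.
Qed.

(** [rp_bind] hands over the result only; this form keeps the input beside it for the later stages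
    of a program. *)
Lemma rp_with A B D {ra : rep A} {rb : rep B} {rd : rep D} (f : A -> B)
    (K : bits -> B -> rand (D * nat)) : fp f -> rp K ->
  rp (fun w a => bind (K w (f a)) (fun o => Ret ((a, o.1), o.2))).
Proof.
move=> hf; have sf := fp_size hf; case: hf => c [u [_ pu h]].
case=> c' [u' [pu' h']].
have pu2 := psz_comp pu' sf.
exists (Seq dup (Seq (shift 1 c) (Seq (shift 1 c') join))).
exists (fun a => 12 * sz a + u a + u' (f a) + 20 * (sz a + (sz (f a) + u' (f a))) + 50).
split; first by do ![apply: psz_add | apply: psz_mul | apply: psz_const | apply: psz_id | assumption].
move=> w a.
pose proof (yields_shift 1 (load [:: ser (tr a)]) (h' w (f a))) as y1.
have y2 : yields w (shift 1 c') (load [:: ser (tr a); ser (tr (f a))])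
  (bind (K w (f a)) (fun o => Ret (load [:: ser (tr a); ser (tr o.1)], o.2))) (u' (f a)).
  move: y1; rewrite bindA /= !(glue_load [:: _]) => y1; apply: yields_eq y1 _ (leqnn _).
  by apply: eq_bind => o /=; rewrite (glue_load [:: _]).
have H: every (K w (f a)) (fun o => does join (load [:: ser (tr a); ser (tr o.1)])
    (load [:: ser (tr (a, o.1))]) (20 * (sz a + (sz (f a) + u' (f a))) + 30)).
  have := yields_size 1 y2; rewrite every_bind; apply: every_imp => o /= ho.
  by apply: does_mono (does_join _ _) _; lia.
pose proof (yields_does_r (g := fun o => (load [:: ser (tr a); ser (tr o.1)], o.2)) y2 H) as y3.
have y4 := yields_does_l (does_dup _) (yields_does_l (does_shift [:: _] (h a)) y3).
apply: yields_eq y4 _ _; first by rewrite bindA.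
by rewrite /=; lia.
Qed.

Lemma does_push' x b m : does (Push x b) m (upd m x (b :: m x)) 1.
Proof. by []. Qed.

Lemma does_pop' x m : does (Pop x) m (upd m x (behead (m x))) 1.
Proof. by []. Qed.

Lemma upd_upd m x v v' : upd (upd m x v) x v' = upd m x v'.
Proof. by apply: funext => y; rewrite /upd; case: eqP. Qed.

Lemma updC m x y v v' : x != y -> upd (upd m x v) y v' = upd (upd m y v') x v.
Proof.
move=> xy; apply: funext => z; rewrite /upd.
by case: (eqVneq z y) => // ->; rewrite eq_sym (negPf xy).
Qed.

Lemma upd_at m x v : upd m x v x = v. Proof. by rewrite /upd eqxx. Qed.

Lemma upd_ne m x y v : y != x -> upd m x v y = m y.
Proof. by rewrite /upd => /negPf ->. Qed.

Lemma upd_id m x v : m x = v -> upd m x v = m.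
Proof. by move<-; exact: upd_same. Qed.

Lemma does_pushes' x v m : does (pushes x v) m (upd m x (v ++ m x)) (2 * size v + 1).
Proof.
elim: v => [|b v IH] /=; first by rewrite upd_same; exact: does_skip.
apply: (does_eq (does_seq IH (does_push' _ _ _))); last by rewrite /=; lia.
by rewrite upd_upd upd_at.
Qed.

(** Translates a raw stack of bits into a serialised list, with order reversed. In front of a list,
    the element [false] is written [true, false] and the element [true] is written
    [true, true, false, false]. *)
Definition packl y A := While y (Case y Skip
  (Seq (Pop y) (pushes A [:: true; false]))
  (Seq (Pop y) (pushes A [:: true; true; false; false]))).

Lemma does_packl y A m v (acc : bits) : y != A -> m y = v -> m A = ser (tr acc) ->
  does (packl y A) m (upd (upd m y [::]) A (ser (tr (catrev v acc)))) (13 * size v + 1).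
Proof.
move=> yA; elim: v m acc => [|b v IH] m acc my mA.
  by apply: (does_eq (does_while0 _ _)) => //; rewrite !upd_id // ?upd_ne // eq_sym.
have Ay : A != y by rewrite eq_sym.
set m1 := upd (upd m y v) A (ser (tr (b :: acc))).
apply: (does_eq (does_whileS (m1 := m1) (B1 := 12) _ _ (IH m1 (b :: acc) _ _))).
- by rewrite my.
- apply: does_case; rewrite my; case: b @m1 my => m1 my.
    apply: (does_mono (B := (1 + 9).+1)) => //.
    apply: (does_eq (does_seq (does_pop' _ _) (does_pushes' A [:: true; true; false; false] _))) => //.
    by rewrite my upd_ne // mA.
  apply: (does_mono (B := (1 + 5).+1)) => //.
  apply: (does_eq (does_seq (does_pop' _ _) (does_pushes' A [:: true; false] _))) => //.
  by rewrite my upd_ne // mA.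
- by rewrite /m1 upd_ne // upd_at.
- by rewrite /m1 upd_at.
- by rewrite /m1 (updC _ _ _ Ay) !upd_upd.
- by rewrite /=; lia.
Qed.

(** The flag on [z] controls the loop, because [A] may hold further data after the list and need not
    become empty. *)
Definition unpackl A z y := Seq (Push z true) (While z (Case A Skip
  (Seq (Pop A) (Pop z))
  (Seq (Pop A) (Case A Skip (Seq (Pop A) (Push y false))
     (Seq (Pop A) (Seq (Pop A) (Seq (Pop A) (Push y true)))))))).

Lemma does_unpackl A z y m (v : bits) rest :
  A != z -> A != y -> z != y -> m A = ser (tr v) ++ rest -> m z = [::] ->
  does (unpackl A z y) m (upd (upd m A rest) y (catrev v (m y))) (12 * size v + 9).
Proof.
move=> Az Ay zy mA mz.
have zA : z != A by rewrite eq_sym. have yA : y != A by rewrite eq_sym.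
have yz : y != z by rewrite eq_sym.
apply: (does_mono (B := (1 + (12 * size v + 6)).+1)); last by lia.
apply: does_seq (does_push' _ _ _) _; rewrite mz.
move: mz; elim: v m mA => [|b v IH] m mA mz.
  apply: (does_eq (does_whileS (B1 := 4) (B2 := 1) (m1 := upd m A rest) _ _ (does_while0 _ _))) => //.
  - by rewrite upd_at.
  - apply: does_case; rewrite upd_ne // mA /=.
    apply: (does_eq (does_seq (does_pop' _ _) (does_pop' _ _))) => //.
    by rewrite upd_ne // mA upd_ne // upd_at /= updC // upd_upd (upd_id (x := z)) // upd_ne.
  - by rewrite upd_ne.
  - by rewrite [RHS]upd_id // upd_ne.
set m1 := upd (upd m A (ser (tr v) ++ rest)) y (b :: m y).
have m1z : m1 z = [::] by rewrite /m1 !upd_ne.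
have m1A : m1 A = ser (tr v) ++ rest by rewrite /m1 upd_ne // upd_at.
apply: (does_eq (does_whileS (B1 := 11) (m1 := upd m1 z [:: true]) _ _ (IH m1 m1A m1z))).
- by rewrite upd_at.
- apply: does_case; rewrite upd_ne // mA /=.
  have E : forall u, upd (upd (upd m z [:: true]) A u) y (b :: m y) = upd (upd (upd m A u) y (b :: m y)) z [:: true].
    by move=> u; rewrite (updC _ _ _ zA) (updC _ _ _ zy).
  rewrite /m1 -E; case: b {m1 m1z m1A E} mA => /= mA.
    apply: (does_eq (does_seq (does_pop' _ _) (does_case (B := 7) _))) => //; last first.
    rewrite upd_at upd_ne // mA /=.
    apply: (does_eq (does_seq (does_pop' _ _) (does_seq (does_pop' _ _) (does_seq (does_pop' _ _) (does_push' _ _ _))))) => //.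
    by rewrite !(upd_upd, upd_at) !(upd_ne _ _ yA) (upd_ne _ _ yz).
  apply: (does_eq (does_seq (does_pop' _ _) (does_case (B := 3) _))) => //; last first.
  rewrite upd_at upd_ne // mA /=.
  apply: (does_eq (does_seq (does_pop' _ _) (does_push' _ _ _))) => //.
  by rewrite !(upd_upd, upd_at) !(upd_ne _ _ yA) (upd_ne _ _ yz).
- by rewrite /m1 upd_at (updC _ _ _ yA) !upd_upd /=.
- by rewrite /=; lia.
Qed.

Lemma rp_toss : rp (fun _ (n : nat) => bind (coins n) (fun c => Ret (c, 0))).
Proof.
pose L := While 0 (Case 0 Skip (Pop 0) (Seq (Pop 0) (Seq (Pop 0) (Toss 1)))).
have H: forall w n y, yields w L (load [:: ser (tr n); y])
    (bind (coins n) (fun c => Ret (load [:: [::]; catrev c y], 0))) (n * 8 + 5).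
  move=> w; elim=> [|n IH] y.
    apply: (@does_mono _ _ _ (2 + 1).+1) => //.
    apply: (does_whileS (m1 := load [:: [::]; y])) => //.
    by apply: does_case; exact: does_pop.
  have y1: yields w (Case 0 Skip (Pop 0) (Seq (Pop 0) (Seq (Pop 0) (Toss 1))))
     (load [:: ser (tr n.+1); y])
     (bind (Flip (Ret true) (Ret false)) (fun b => Ret (load [:: ser (tr n); b :: y], 0))) 7.
    by rewrite /yields /= !upd_load.
  have := yields_whileZ (x := 0) (h := fun b => bind (coins n) (fun c =>
     Ret (load [:: [::]; catrev c (b :: y)], 0))) _ y1 (B2 := n * 8 + 5) (conj (IH _) (IH _)).
  move=> /(_ ltac:(done)) y2; apply: yields_eq y2 _ _; last by lia.
  by rewrite /= !bindA.
exists (Seq L (Seq (Push 0 false) (packl 1 0))), (fun n => n * 8 + 5 + (13 * n + 3) + 2); split.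
  have pn : pbound id by exact: pbound_nat fp_id.
  do ![apply: psz_add | apply: psz_mul | apply: psz_const | apply: psz_id | assumption].
move=> w n.
have cs: every (coins n) (fun c => size c = n).
  elim: n => //= n IH; rewrite !every_bind /=.
  by split; apply: every_imp IH => c ->.
have -> : load [:: ser (tr n)] = load [:: ser (tr n); [::]] by load_eq.
apply: yields_eq (yields_does_r (c2 := Seq (Push 0 false) (packl 1 0))
  (g' := fun c => load [:: ser (tr c)]) (B2 := 13 * n + 3) (H w n [::]) _) _ _; last by lia.
  apply: every_imp cs => c sc.
  apply: (does_mono (B := (1 + (13 * n + 1)).+1)); last by lia.
  apply: does_seq (does_push _ _ _) _ => /=.
  have := @does_packl 1 0 (load [:: [:: false]; catrev c [::]]) (rev c) [::] isT.
  rewrite size_rev sc catrevE cats0 => /(_ erefl erefl) d; apply: does_eq d _ (leqnn _).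
  by rewrite !upd_load /= catrevE revK cats0; load_eq.
by rewrite bindA.
Qed.

Lemma rp_query : rp (fun w (s : seq nat) =>
  Ret ([seq nth false w i | i <- s], size s)).
Proof.
(* A query takes its position from the size of a stack, so each serialised number is first spelled
   out as that many symbols on stack 4. *)
pose pn := Seq (Push 3 true) (While 3 (Case 0 Skip (Seq (Pop 0) (Pop 3))
  (Seq (Pop 0) (Seq (Pop 0) (Push 4 true))))).
have Hn: forall n rest y z, does pn (load [:: ser (tr n) ++ rest; y; z])
   (load [:: rest; y; z; [::]; nseq n true]) (9 * n + 8).
  move=> n rest y z; apply: (does_mono (B := (1 + (9 * n + 6)).+1)); last by lia.
  apply: does_seq (does_push _ _ _) _ => /=.
  rewrite (_ : load [:: ser (tr n) ++ rest; y; z; [:: true]] =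
    load [:: ser (tr n) ++ rest; y; z; [:: true]; [::]]); last by load_eq.
  rewrite -(cats0 (nseq n true)).
  have HH: forall acc, does (While 3 (Case 0 Skip (Seq (Pop 0) (Pop 3))
    (Seq (Pop 0) (Seq (Pop 0) (Push 4 true)))))
    (load [:: ser (tr n) ++ rest; y; z; [:: true]; acc])
    (load [:: rest; y; z; [::]; nseq n true ++ acc]) (9 * n + 6); last exact: HH.
  elim: n => [|n IH] acc.
    apply: (@does_mono _ _ _ (4 + 1).+1) => //.
    apply: (does_whileS (m1 := load [:: rest; y; z; [::]; acc])) => //.
    by apply: does_case; exact: (does_seq (does_pop _ _) (does_pop _ _)).
  apply: (does_mono (B := (7 + (9 * n + 6)).+1)); last by lia.
  rewrite (_ : nseq n.+1 true ++ acc = nseq n true ++ (true :: acc)); last first.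
    by rewrite -[true :: acc]/(nseq 1 true ++ acc) catA -nseqD addn1.
  apply: does_whileS (IH (true :: acc)) => //; apply: (does_mono (B := 6)) => //.
  by apply: does_case => /=; exact: (does_seq (does_pop _ _) (does_seq (does_pop _ _) (does_push _ _ _))).
pose body := Case 0 Skip (Seq (Pop 0) (Pop 2))
  (Seq (Pop 0) (Seq pn (Seq (Query 4 1) (clear 4)))).
pose X (s : seq nat) := 15 * size s + 15 * size (ser (@tr _ (rep_seq rep_nat) s)) + 6.
have HL: forall w s y, yields w (While 2 body) (load [:: ser (tr s); y; [:: true]])
    (Ret (load [:: [::]; catrev [seq nth false w i | i <- s] y], size s)) (X s).
  move=> w; elim=> [|n s IH] y.
    apply: (@yields_mono _ _ _ _ (4 + 1).+1); last by rewrite /X; lia.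
    apply: (does_whileS (m1 := load [:: [::]; y]) (m2 := load [:: [::]; y])) => //.
    apply: does_case; apply: (does_eq (does_seq (does_pop _ _) (does_pop _ _))) => //=.
    by load_eq.
  have y1: yields w body (load [:: ser (tr (n :: s)); y; [:: true]])
     (bind (Ret tt) (fun=> Ret (load [:: ser (tr s); nth false w n :: y; [:: true]], 1)))
     (11 * n + 20).
    apply: (yields_mono (B := (1 + (9 * n + 8 + (1 + (2 * n + 1)).+1).+1).+2)); last by lia.
    apply: yields_case; rewrite /=.
    apply: (yields_does_l (does_pop _ _)); apply: (yields_does_l (Hn _ _ _ _)).
    have q1 : yields w (Query 4 1) (load [:: ser (tr s); y; [:: true]; [::]; nseq n true])
       (bind (Ret tt) (fun=> Ret (load [:: ser (tr s); nth false w n :: y; [:: true]; [::]; nseq n true], 1))) 1.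
      by rewrite /yields /= upd_load /= size_nseq.
    have q2 : every (Ret tt) (fun=> does (clear 4)
        (load [:: ser (tr s); nth false w n :: y; [:: true]; [::]; nseq n true])
        (load [:: ser (tr s); nth false w n :: y; [:: true]]) (2 * n + 1)).
      apply: (does_eq (does_clear _ _)) => /=; first by load_eq.
      by rewrite size_nseq.
    exact: (yields_does_r q1 q2).
  have y2 := yields_whileZ (x := 2) (h := fun=> Ret (load [:: [::]; catrev [seq nth false w i | i <- s]
    (nth false w n :: y)], size s)) _ y1 (IH _).
  apply: yields_eq (y2 _) _ _ => //.
  rewrite /X sz_cons sz_nat [size (_ :: _)]/=; lia.
exists (Seq (Push 2 true) (Seq (While 2 body) (Seq (Push 0 false) (packl 1 0)))).
exists (fun s => 50 * sz s + 50); split.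
  by do ![apply: psz_add | apply: psz_mul | apply: psz_const | apply: psz_id | assumption].
move=> w s; have ss := @size_sz _ rep_nat s.
apply: (yields_mono (B := (1 + (X s + (13 * size s + 3)).+1).+1)); last by rewrite /X; lia.
apply: (yields_does_l (does_push _ _ _)) => /=.
apply: (yields_does_r (r := Ret tt) (g := fun=> (load [:: [::]; catrev [seq nth false w i | i <- s] [::]], size s))
  (g' := fun=> load [:: ser (tr [seq nth false w i | i <- s])])).
  exact: HL.
rewrite /=; apply: (does_mono (B := (1 + (13 * size s + 1)).+1)); last by lia.
apply: does_seq (does_push _ _ _) _ => /=.
have := @does_packl 1 0 (load [:: [:: false]; catrev [seq nth false w i | i <- s] [::]])
  (rev [seq nth false w i | i <- s]) [::] isT.
rewrite size_rev size_map catrevE cats0 => /(_ erefl erefl) d; apply: does_eq d _ (leqnn _).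
by rewrite !upd_load /= catrevE revK cats0; load_eq.
Qed.

(** * Calling a given program as a subroutine *)

Fixpoint regs c :=
  match c with
  | Skip => 0
  | Seq c1 c2 => maxn (regs c1) (regs c2)
  | Push x _ | Pop x | Toss x => x.+1
  | Case x c0 c1 c2 => maxn x.+1 (maxn (regs c0) (maxn (regs c1) (regs c2)))
  | While x c1 => maxn x.+1 (regs c1)
  | Query a x => maxn a.+1 x.+1
  end.

Definition cut R (m m2 : store) : store := fun y => if y < R then m y else m2 y.

Lemma cut_at R m m2 x : x < R -> cut R m m2 x = m x.
Proof. by rewrite /cut => ->. Qed.

Lemma upd_cut R m m2 x v : x < R -> upd (cut R m m2) x v = cut R (upd m x v) m2.
Proof.
move=> xR; apply: funext => y; rewrite /upd /cut.
by case: eqP => // ->; rewrite xR.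
Qed.

Lemma run_cut R m2 w t k m q : all (fun c => regs c <= R) k ->
  run w t k (cut R m m2) q =
  bind (run w t k m q) (fun o =>
    Ret (Config (cont o) (cut R (mem o) m2) (asked o))).
Proof.
elim: t k m q => [|t IH] [|[|c1 c2|x b|x|x c0 c1 c2|x c1|x|a x] k] m q //=;
  rewrite ?geq_max -?andbA.
- exact: IH.
- by move=> /and3P [a b c]; rewrite IH //= a b.
- by move=> /andP [h hk]; rewrite cut_at // upd_cut // IH.
- by move=> /andP [h hk]; rewrite cut_at // upd_cut // IH.
- move=> /and5P [hx h0 h1 h2 hk]; rewrite cut_at // IH //= hk andbT.
  by case: (m x) => [|[] ?].
- move=> /and3P [hx h1 hk]; rewrite cut_at //.
  by case: (m x) => [|b s]; rewrite IH //= geq_max hx h1 hk.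
- by move=> /andP [h hk]; rewrite cut_at // !upd_cut // !IH.
- by move=> /and3P [ha hx hk]; rewrite !cut_at // upd_cut // IH.
Qed.

(** Splicing [m] with itself changes nothing, so by [run_cut] the final memory agrees with [m] from
    stack [R] on. *)
Lemma run_frame R w t k m q : all (fun c => regs c <= R) k ->
  every (run w t k m q) (fun o => forall y, R <= y -> mem o y = m y).
Proof.
move=> h; have := run_cut m w t m q h.
have -> : cut R m m = m by apply: funext => y; rewrite /cut; case: ifP.
move=> e; have: every (run w t k m q) (fun o => mem o = cut R (mem o) m).
  rewrite e every_bind; apply: everyT => o /=.
  by apply: funext => y; rewrite /cut; case: ltnP.
apply: every_imp => o -> y Ry; by rewrite /cut ltnNge Ry.
Qed.

(* The called program gets an empty oracle, whose answers are all [false]. *)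
Fixpoint dq c :=
  match c with
  | Seq c1 c2 => Seq (dq c1) (dq c2)
  | Case x c0 c1 c2 => Case x (dq c0) (dq c1) (dq c2)
  | While x c1 => While x (dq c1)
  | Query a x => Push x false
  | c => c
  end.

(** Every coin becomes [false], the branch that [value] follows. This makes the value of a
    randomised program at these coins a deterministic polynomial-time function, which the code uses
    to find the hash length. *)
Fixpoint dr c :=
  match c with
  | Seq c1 c2 => Seq (dr c1) (dr c2)
  | Case x c0 c1 c2 => Case x (dr c0) (dr c1) (dr c2)
  | While x c1 => While x (dr c1)
  | Query a x => Push x false
  | Toss x => Push x false
  | c => c
  end.

Lemma coin_free_dr c : coin_free (dr c).
Proof. by elim: c => //= [c1 -> c2 ->|_ c0 -> c1 -> c2 ->]. Qed.

Lemma run_dq w t k m q q0 :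
  run w t (map dq k) m q = bind (run [::] t k m q0) (fun o =>
    Ret (Config (map dq (cont o)) (mem o) q)).
Proof.
elim: t k m q0 => [|t IH] [|[|c1 c2|x b|x|x c0 c1 c2|x c1|x|a x] k] m q0 //=;
  rewrite -?IH // ?nth_nil //.
- by case: (m x) => [|[] ?].
- by case: (m x) => *; rewrite -IH.
Qed.

Lemma run_dr w t k m q q0 :
  run w t (map dr k) m q = Ret (Config
    (map dr (cont (value (run [::] t k m q0)))) (mem (value (run [::] t k m q0))) q).
Proof.
elim: t k m q0 => [|t IH] [|[|c1 c2|x b|x|x c0 c1 c2|x c1|x|a x] k] m q0 //=;
  rewrite ?nth_nil //.
- exact: (IH [:: c1, c2 & k]).
- by case: (m x) => [|[] s]; [exact: (IH (c0 :: k)) | exact: (IH (c2 :: k)) | exact: (IH (c1 :: k))].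
- by case: (m x) => [|b s]; [exact: IH | exact: (IH [:: c1, While x c1 & k])].
Qed.

Lemma yields_dq w (P : ppt) args :
  yields w (dq P) (load args) (bind (exec P args) (fun o => Ret (mem o, 0)))
    (budget (deg P) args).
Proof.
rewrite /yields (run_dq w _ [:: code P] (load args) 0 0) bindA.
apply: eq_bind_every (ppt_halts P [::] args) _ => o /= -> //.
Qed.

Lemma does_dr (P : ppt) args :
  does (dr P) (load args) (mem (value (exec P args))) (budget (deg P) args).
Proof.
move=> w; rewrite /yields (run_dr w _ [:: code P] (load args) 0 0) /=.
by rewrite (every_value (ppt_halts P [::] args)).
Qed.

Fixpoint clears j n := if n is n'.+1 then Seq (clear j) (clears j.+1 n') else Skip.

Lemma coin_free_clears j n : coin_free (clears j n).
Proof. by elim: n j => //= n IH j; rewrite IH. Qed.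

Lemma does_clears j n m S : (forall y, size (m y) <= S) ->
  does (clears j n) m (fun y => if j <= y < j + n then [::] else m y)
    (n * (2 * S + 2) + 1).
Proof.
elim: n j m => [|n IH] j m hS.
  apply: (does_eq (does_skip _)) => //; apply: funext => y.
  by case: ifP => // /andP []; lia.
apply: (does_mono (B := (2 * size (m j) + 1 + (n * (2 * S + 2) + 1)).+1)); last first.
  by have := hS j; lia.
apply: (does_eq (does_seq (does_clear' _ _) (IH j.+1 _ _))) => //.
  by move=> y; rewrite /upd; case: eqP => // _; exact: hS.
apply: funext => y; rewrite /upd; case: eqP => [->|/eqP ne].
  by rewrite leqnn ltnn addnS ltnS leq_addr.
by rewrite ltn_neqAle eq_sym ne /= addSnnS.
Qed.

Section Call.
Variable n : nat.

Fixpoint unpacks k i := if k is k'.+1 then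
  Seq (Seq (Pop 0) (Seq (unpackl 0 n.+1 n.+2) (mv n.+2 i))) (unpacks k' i.+1) else Skip.

Lemma coin_free_unpacks k i : coin_free (unpacks k i).
Proof. by elim: k i => //= k IH i; rewrite IH. Qed.

Lemma does_unpacks (args don : seq bits) : size don + size args <= n ->
  does (unpacks (size args) (size don).+1) (load (ser (tr args) :: don))
    (load ([:: false] :: (don ++ args))) (40 * sz args + 20).
Proof.
elim: args don => [|v args IH] don h.
  by rewrite cats0; apply: (does_mono (does_skip _)).
have d1: does (Seq (Pop 0) (Seq (unpackl 0 n.+1 n.+2) (mv n.+2 (size don).+1)))
    (load (ser (tr (v :: args)) :: don)) (load (ser (tr args) :: rcons don v))
    (17 * size v + 20).
  apply: (does_mono (B := (1 + (12 * size v + 9 + (5 * size v + 1)).+1).+1)); last by lia.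
  apply: does_seq (does_pop' _ _) _.
  set m1 := upd _ _ _.
  have m1z : m1 n.+1 = [::] by rewrite /m1 upd_ne // /load /= nth_default //=; move: h; rewrite /=; lia.
  have m1y : m1 n.+2 = [::] by rewrite /m1 upd_ne // /load /= nth_default //=; move: h; rewrite /=; lia.
  have d2 : does (unpackl 0 n.+1 n.+2) m1
     (upd (upd m1 0 (ser (tr args))) n.+2 (catrev v (m1 n.+2))) (12 * size v + 9).
    by apply: does_unpackl; rewrite // ?neq_ltn ?ltnSn // /m1 upd_at.
  apply: does_seq d2 _; rewrite m1y; set m2 := upd _ _ _.
  have ne : n.+2 != (size don).+1 by move: h; rewrite /=; lia.
  have m2y : m2 n.+2 = rev v by rewrite /m2 upd_at catrevE cats0.
  apply: (does_eq (does_mv' m2 ne)); last by rewrite m2y size_rev.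
  rewrite m2y; have -> : m2 (size don).+1 = [::].
    rewrite /m2 upd_ne 1?eq_sym // upd_ne // /m1 upd_ne // /load /= nth_default //.
  rewrite catrevE revK cats0 /m2 upd_upd /m1 upd_upd.
  rewrite (updC _ _ _ (_ : 0 != n.+2)) // (upd_id (x := n.+2)); last first.
    by rewrite /load /= nth_default //; move: h; rewrite /=; lia.
  rewrite !upd_load /=; congr (load (_ :: _)).
  by elim: (don) => //= ? ? ->.
apply: (does_eq (does_seq d1 (_ : does _ _ (load ([:: false] :: (rcons don v ++ args))) (40 * sz args + 20)))).
- by rewrite -(size_rcons don v); apply: IH; rewrite size_rcons; move: h; rewrite /=; lia.
- by rewrite cat_rcons.
- by rewrite sz_cons; have := @size_sz _ rep_bool v; lia.
Qed.

End Call.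

(** A called program may leave garbage anywhere. Relocated by one, its results are on stacks 1 and
    2; what lies above is erased and the two results are packed into a pair on stack 0. *)
Definition post R := Seq (clears 3 R) (Seq (clear 0) (Seq (Push 0 false)
  (Seq (mv 2 3) (Seq (packl 3 0) (Seq (Push 0 false) (Seq (mv 1 3)
  (Seq (packl 3 0) (Push 0 true)))))))).

Lemma does_post R m S : (forall y, size (m y) <= S) -> (forall y, R <= y -> m y = [::]) ->
  does (post R) (glue 1 (load [:: [:: false]]) m) (load [:: ser (tr (m 0, m 1))])
    ((R + 20) * (2 * S + 4) + 20 * S + 50).
Proof.
move=> hS hR.
have E: (fun y => if 3 <= y < 3 + R then [::] else glue 1 (load [:: [:: false]]) m y) =
   load [:: [:: false]; m 0; m 1].
  apply: funext => -[|[|[|y]]] //=; rewrite /glue /load /= nth_nil subn1 /=.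
  by case: ifP => // h; apply: hR; move: h; lia.
have d0 := @does_clears 3 R (glue 1 (load [:: [:: false]]) m) S.+1 _.
apply: (does_mono (B := (R * (2 * S.+1 + 2) + 1 + (3 + (1 + (5 * S + 1 + (13 * S + 1 + (1 + (5 * S + 1 +
   (13 * S + 1 + 1).+1).+1).+1).+1).+1).+1).+1).+1)); last by lia.
have h0 := hS 0; have h1 := hS 1.
apply: does_seq; first apply: d0.
  move=> y; rewrite /glue; case: ifP => _; last by apply: leq_trans (hS _) _.
  by rewrite /load; case: y => //= y; rewrite nth_nil.
rewrite E; apply: does_seq (does_clear _ _) _ => /=; apply: does_seq (does_push _ _ _) _ => /=.
apply: does_seq; first by apply: does_mono (does_mv _ _) _ => //=; lia.
rewrite /= catrevE cats0.
apply: (does_seq (m1 := load [:: ser (tr (m 1)); m 0])).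
  have := @does_packl 3 0 (load [:: [:: false]; m 0; [::]; rev (m 1)]) (rev (m 1)) [::] isT erefl erefl.
  move=> d; apply: (does_eq d); last by rewrite size_rev; lia.
  by rewrite catrevE revK cats0 !upd_load; load_eq.
apply: does_seq (does_push _ _ _) _ => /=.
apply: does_seq; first by apply: does_mono (does_mv _ _) _ => //=; lia.
rewrite /= catrevE cats0.
apply: (does_seq (m1 := load [:: ser (tr (m 0)) ++ ser (tr (m 1))])); last first.
  by apply: (does_eq (does_push _ _ _)).
have H: forall v (acc : bits) rest, does (packl 3 0) (load [:: ser (tr acc) ++ rest; [::]; [::]; v])
    (load [:: ser (tr (catrev v acc)) ++ rest]) (13 * size v + 1).
  elim=> [|b v IH] acc rest; first by apply: (does_eq (does_while0 _ _)) => //; load_eq.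
  apply: (does_mono (B := (12 + (13 * size v + 1)).+1)); last by rewrite /=; lia.
  apply: does_whileS (IH (b :: acc) rest) => //; apply: does_case => /=; case: b.
    apply: (does_mono (B := (1 + 9).+1)) => //; apply: does_seq (does_pop _ _) _.
    exact: (does_pushes 0 [:: true; true; false; false] [:: ser (tr acc) ++ rest; [::]; [::]; v]).
  apply: (does_mono (B := (1 + 5).+1)) => //; apply: does_seq (does_pop _ _) _.
  exact: (does_pushes 0 [:: true; false] [:: ser (tr acc) ++ rest; [::]; [::]; v]).
apply: (does_eq (H (rev (m 0)) [::] (ser (tr (m 1))))); last by rewrite size_rev; lia.
by rewrite catrevE revK cats0.
Qed.

Lemma size_flatten_sz (args : seq bits) : size (flatten args) <= sz args.
Proof.
elim: args => // v args IH; rewrite sz_cons /= size_cat.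
by have := @size_sz _ rep_bool v; lia.
Qed.

Lemma size_load_flatten (args : seq bits) y : size (load args y) <= size (flatten args).
Proof.
rewrite /load; elim: args y => [|v args IH] [|y] //=; rewrite size_cat ?leq_addr //.
by apply: leq_trans (IH y) _; exact: leq_addl.
Qed.

Lemma pbound_budget n d : pbound (fun a : n.-tuple bits => budget d a).
Proof.
apply: psz_le (psz_add (psz_exp d (psz_id _)) (psz_const _ d)) _ => a.
rewrite /budget leq_add2r; case: d => // d; rewrite leq_exp2r //.
exact: size_flatten_sz.
Qed.

Lemma call_gen n c (u : n.-tuple bits -> nat) (r : n.-tuple bits -> rand store) :
  pbound u ->
  (forall w (a : n.-tuple bits),
     yields w c (load a) (bind (r a) (fun m => Ret (m, 0))) (u a)) ->
  exists c' u', [/\ coin_free c -> coin_free c', pbound u' &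
   forall w (a : n.-tuple bits), yields w c' (load [:: ser (tr a)])
     (bind (r a) (fun m => Ret (load [:: ser (tr (m 0, m 1))], 0))) (u' a)].
Proof.
move=> pu h; pose R := maxn n (regs c).
exists (Seq (unpacks n n 1) (Seq (shift 1 c) (post R))).
exists (fun a => 40 * sz a + 20 + u a + ((R + 20) * (2 * (sz a + u a) + 4) + 20 * (sz a + u a) + 50) + 2).
split=> [cf||w a].
- by rewrite /= coin_free_unpacks coin_free_shift cf coin_free_clears.
- by do ![apply: psz_add | apply: psz_mul | apply: psz_const | apply: psz_id | assumption].
have d1 := @does_unpacks n a [::] _.
have y1 := yields_shift 1 (load [:: [:: false]]) (h w a).
have sa := size_tuple a.
have H: every (r a) (fun m => (forall y, size (m y) <= sz a + u a) /\
   (forall y, R <= y -> m y = [::])).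
  apply: every_and.
    apply: (@every_imp _ (fun m => forall y, size (m y) <= sz a + u a)) => //.
    have: forall y, every (r a) (fun m => size (m y) <= sz a + u a).
      move=> y; have := yields_size y (h w a); rewrite every_bind.
      apply: every_imp => m /=; have := size_load_flatten a y.
      have : size (flatten a) <= sz a by exact: size_flatten_sz.
      by lia.
    by elim: (r a) => //= r1 IH1 r0 IH0 hh; split; [apply: IH1 => y; case: (hh y)|apply: IH0 => y; case: (hh y)].
  have := @run_frame R w (u a) [:: c] (load a) 0 _.
  rewrite (h w a) !every_bind /= andbT => /(_ (leq_maxr _ _)).
  apply: every_imp => m /= hm y Ry; rewrite hm // /load nth_default // sa.
  by apply: leq_trans Ry; exact: leq_maxl.
have y2: yields w (Seq (shift 1 c) (post R)) (load ([:: [:: false]] ++ a))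
   (bind (r a) (fun m => Ret (load [:: ser (tr (m 0, m 1))], 0)))
   (u a + ((R + 20) * (2 * (sz a + u a) + 4) + 20 * (sz a + u a) + 50)).+1.
  apply: (yields_does_r (g := fun m => (glue 1 (load [:: [:: false]]) m, 0))
     (g' := fun m => load [:: ser (tr (m 0, m 1))])).
    by rewrite -(glue_load [:: [:: false]]); apply: yields_eq y1 _ (leqnn _); rewrite bindA.
  apply: every_imp H => m [h1 h2] /=; exact: does_post.
have {}d1 : does (unpacks n n 1) (load [:: ser (tr a)]) (load ([:: [:: false]] ++ a)) (40 * sz a + 20).
  by have := d1; rewrite sa add0n leqnn => /(_ isT).
apply: yields_mono (yields_does_l d1 y2) _.
by lia.
Qed.

Lemma rp_call (P : ppt) n :
  rp (fun _ (a : n.-tuple bits) => bind (exec P a) (fun o => Ret ((mem o 0, mem o 1), 0))).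
Proof.
have [c [u [_ pu h]]] := @call_gen n (dq P) _ (fun a => bind (exec P a) (fun o => Ret (mem o)))
  (pbound_budget n (deg P)) (fun w a => ltac:(rewrite bindA; exact: yields_dq)).
exists c, u; split=> // w a; apply: yields_eq (h w a) _ (leqnn _).
by rewrite !bindA.
Qed.

Lemma fp_call (P : ppt) n : fp (fun a : n.-tuple bits => value (output P a)).
Proof.
have [c [u [cf pu h]]] := @call_gen n (dr P) _ (fun a => Ret (mem (value (exec P a))))
  (pbound_budget n (deg P)) (fun w a => does_dr P a w).
have: fp (fun a : n.-tuple bits => (mem (value (exec P a)) 0, mem (value (exec P a)) 1)).
  by exists c, u; split=> // [|a w]; [exact: cf (coin_free_dr _) | exact: h].
by move=> /fp_fst; apply: fp_ext => a; rewrite /output value_bind.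
Qed.

(** * From serialised data to programs with raw inputs and outputs *)

Section Wrap.
Variable n : nat.

Fixpoint packs k := if k is k'.+1 then
  Seq (Seq (Push n.+1 false) (Seq (mv k' n.+2) (Seq (packl n.+2 n.+1) (Push n.+1 true))))
    (packs k') else Skip.

Lemma coin_free_packs k : coin_free (packs k).
Proof. by elim: k => //= k ->. Qed.

Lemma load_default (s : seq bits) y : size s <= y -> load s y = [::].
Proof. exact: nth_default. Qed.

Lemma does_packl_rest y A m v (acc : bits) rest : y != A -> m y = v ->
  m A = ser (tr acc) ++ rest ->
  does (packl y A) m (upd (upd m y [::]) A (ser (tr (catrev v acc)) ++ rest)) (13 * size v + 1).
Proof.
move=> yA; elim: v m acc => [|b v IH] m acc my mA.
  by apply: (does_eq (does_while0 _ _)) => //; rewrite !upd_id // ?upd_ne // eq_sym.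
have Ay : A != y by rewrite eq_sym.
set m1 := upd (upd m y v) A (ser (tr (b :: acc)) ++ rest).
apply: (does_eq (does_whileS (m1 := m1) (B1 := 12) _ _ (IH m1 (b :: acc) _ _))).
- by rewrite my.
- apply: does_case; rewrite my; case: b @m1 my => m1 my.
    apply: (does_mono (B := (1 + 9).+1)) => //.
    apply: (does_eq (does_seq (does_pop' _ _) (does_pushes' A [:: true; true; false; false] _))) => //.
    by rewrite my upd_ne // mA.
  apply: (does_mono (B := (1 + 5).+1)) => //.
  apply: (does_eq (does_seq (does_pop' _ _) (does_pushes' A [:: true; false] _))) => //.
  by rewrite my upd_ne // mA.
- by rewrite /m1 upd_ne // upd_at.
- by rewrite /m1 upd_at.
- by rewrite /m1 (updC _ _ _ Ay) !upd_upd.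
- by rewrite /=; lia.
Qed.

Lemma does_packs (ins acc : seq bits) : size ins <= n ->
  does (packs (size ins)) (upd (load ins) n.+1 (ser (tr acc)))
    (upd (load [::]) n.+1 (ser (tr (ins ++ acc)))) (18 * size (flatten ins) + 20 * size ins + 1).
Proof.
elim/last_ind: ins acc => [|ins v IH] acc; first by move=> _; apply: does_mono (does_skip _) _.
rewrite size_rcons => h; rewrite cat_rcons.
apply: (does_mono (B := (18 * size v + 8 + (18 * size (flatten ins) + 20 * size ins + 1)).+1)); last first.
  by rewrite -cats1 flatten_cat size_cat /= cats0; lia.
apply: does_seq (IH (v :: acc) _); last by lia.
have ne : size ins != n.+1 by lia. have ne2 : size ins != n.+2 by lia.
have ne' : n.+1 != size ins by lia. have ne2' : n.+2 != size ins by lia.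
have n12 : n.+2 != n.+1 by lia. have n21 : n.+1 != n.+2 by lia.
set m1 := upd (upd (load (rcons ins v)) n.+1 (ser (tr acc))) n.+1 (false :: ser (tr acc)).
have m1i : m1 (size ins) = v by rewrite /m1 !upd_ne // /load nth_rcons ltnn eqxx.
have m1y : m1 n.+2 = [::] by rewrite /m1 !upd_ne // load_default // size_rcons; lia.
apply: (does_mono (B := (1 + (5 * size v + 1 + (13 * size v + 1 + 1).+1).+1).+1)); last by lia.
apply: (does_seq (m1 := m1)); first by apply: (does_eq (does_push' _ _ _)); rewrite // upd_at.
apply: does_seq; first by have := does_mv' m1 ne2; rewrite m1i m1y; apply.
rewrite catrevE cats0; set m2 := upd _ _ _.
have m2y : m2 n.+2 = rev v by rewrite /m2 upd_at.
have m2A : m2 n.+1 = ser (tr ([::] : bits)) ++ ser (tr acc) by rewrite /m2 !upd_ne // /m1 upd_at.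
apply: does_seq; first by have := does_packl_rest n12 m2y m2A; rewrite size_rev; apply.
apply: (does_eq (does_push' _ _ _)) => //.
rewrite upd_at catrevE revK cats0 upd_upd /m2 upd_upd /m1 upd_upd.
rewrite (updC _ _ _ n12) (updC _ _ _ ne) upd_upd.
rewrite (upd_id (x := n.+2)); last first.
  by rewrite upd_ne // upd_ne // load_default // size_rcons; lia.
rewrite (updC _ _ _ ne'); congr upd; rewrite upd_load; apply: funext => y; rewrite /load nth_set_nth /= nth_rcons.
by case: ltngtP => // hy; rewrite nth_default //; lia.
Qed.

Definition inp := Seq (Push n.+1 false) (Seq (packs n) (Seq (mv n.+1 n.+2) (mv n.+2 0))).

Lemma does_inp (ins : n.-tuple bits) :
  does inp (load ins) (load [:: ser (tr ins)]) (30 * sz ins + 20 * n + 20).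
Proof.
have n12 : n.+2 != n.+1 by lia. have n21 : n.+1 != n.+2 by lia.
have sn := size_tuple ins.
have d1 := @does_packs ins [::]; rewrite cats0 sn leqnn in d1.
have fs := size_flatten_sz ins.
have h0: load ins n.+1 = [::] by rewrite load_default // sn; lia.
apply: (does_mono (B := (1 + (18 * size (flatten ins) + 20 * n + 1 + (5 * sz ins + 1 +
  (5 * sz ins + 1)).+1).+1).+1)); last by rewrite /tr /rep_tuple; move: fs; rewrite /tr; lia.
apply: does_seq (does_push' _ _ _) _; rewrite h0.
apply: does_seq; first exact: d1.
set M := upd _ _ _.
have MA : M n.+1 = ser (tr ins) by rewrite /M upd_at.
have MB : M n.+2 = [::] by rewrite /M upd_ne // load_default.
apply: does_seq; first by have := does_mv' M n21; rewrite MA MB; apply.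
rewrite /M; set m2 := upd _ _ _.
have m2y : m2 n.+2 = rev (ser (tr ins)).
  by rewrite /m2 upd_at catrevE cats0.
have m20 : m2 0 = [::] by rewrite /m2 !upd_ne.
have := @does_mv' n.+2 0 m2 isT; rewrite m2y m20 size_rev => d; apply: (does_eq d) => //.
rewrite catrevE revK cats0 /m2 upd_upd !upd_upd.
apply: funext => y; rewrite /upd /load; case: y => [|y] //=; rewrite nth_nil.
by case: eqP => // _; case: eqP => // _; rewrite nth_nil.
Qed.

Definition outp := Seq (mv 0 2) (Seq (mv 2 1) (Seq (Pop 1) (Seq (unpackl 1 2 3)
  (Seq (mv 3 0) (Seq (unpackl 1 2 3) (mv 3 1)))))).

Lemma does_outp (b0 b1 : bits) :
  does outp (load [:: ser (tr (b0, b1))]) (load [:: b0; b1]) (50 * sz (b0, b1) + 50).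
Proof.
have s0 := @size_sz _ rep_bool b0; have s1 := @size_sz _ rep_bool b1.
pose Z := size (ser (@tr _ (rep_prod (rep_seq rep_bool) (rep_seq rep_bool)) (b0, b1))).
apply: (does_mono (B := (5 * Z + 1 + (5 * Z + 1 + (1 + (12 * size b0 + 9 + (5 * size b0 + 1 +
  (12 * size b1 + 9 + (5 * size b1 + 1)).+1).+1).+1).+1).+1).+1)); last first.
  have : Z = (sz b0 + sz b1).+1 by exact: sz_pair.
  by rewrite /Z; lia.
have H: forall v, does (mv 0 2) (load [:: v]) (load [:: [::]; [::]; rev v]) (5 * size v + 1).
  by move=> v; apply: (does_eq (does_mv _ _)) => //=; rewrite catrevE cats0.
have H': forall v, does (mv 2 1) (load [:: [::]; [::]; rev v]) (load [:: [::]; v; [::]]) (5 * size v + 1).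
  by move=> v; apply: (does_eq (does_mv _ _)) => //=; rewrite ?size_rev // catrevE cats0 revK.
apply: does_seq (H _) _; apply: does_seq (H' _) _.
apply: (does_seq (m1 := load [:: [::]; ser (tr b0) ++ ser (tr b1); [::]])); first exact: does_pop.
have d1 : does (unpackl 1 2 3) (load [:: [::]; ser (tr b0) ++ ser (tr b1); [::]])
   (load [:: [::]; ser (tr b1); [::]; rev b0]) (12 * size b0 + 9).
  apply: (does_eq (@does_unpackl 1 2 3 _ b0 (ser (tr b1)) isT isT isT erefl erefl)) => //.
  by rewrite !upd_load catrevE cats0.
apply: does_seq d1 _.
apply: (does_seq (m1 := load [:: b0; ser (tr b1)])).
  apply: (does_eq (does_mv _ _)) => //=; last by rewrite size_rev.
  by rewrite catrevE revK cats0; load_eq.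
have d2 : does (unpackl 1 2 3) (load [:: b0; ser (tr b1)])
   (load [:: b0; [::]; [::]; rev b1]) (12 * size b1 + 9).
  have E : load [:: b0; ser (tr b1)] 1 = ser (tr b1) ++ [::] by rewrite cats0.
  apply: (does_eq (@does_unpackl 1 2 3 _ b1 [::] isT isT isT E erefl)) => //.
  by rewrite !upd_load catrevE cats0; load_eq.
apply: does_seq d2 _.
apply: (does_eq (does_mv _ _)) => //=; last by rewrite size_rev.
by rewrite catrevE revK cats0; load_eq.
Qed.

(** A [ppt] has to halt within its budget on every list of inputs, also on longer ones. The stacks
    after the first [n] that the program might use are therefore emptied first. *)
Definition wrap c := let p := Seq inp (Seq c outp) in Seq (clears n (regs p)) p.

Definition tup (ins : seq bits) : n.-tuple bits := [tuple nth [::] ins i | i < n].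

Lemma load_tup ins y : y < n -> load (tup ins) y = load ins y.
Proof.
move=> h; rewrite /load /tup /= -[y]/(nat_of_ord (Ordinal h)).
by rewrite (nth_map (Ordinal h)) ?size_enum_ord // nth_ord_enum.
Qed.

Lemma tup_id (ins : n.-tuple bits) : tup ins = ins.
Proof.
apply: eq_from_tnth => i; rewrite tnth_mktuple (tnth_nth [::]) //.
Qed.

Lemma size_flatten_le (s : seq bits) S : (forall y, size (load s y) <= S) ->
  size (flatten s) <= size s * S.
Proof.
elim: s => // v s IH h; rewrite /= size_cat mulSn; apply: leq_add; first exact: (h 0).
by apply: IH => y; exact: (h y.+1).
Qed.

Lemma sz_bits (v : bits) : sz v <= 4 * size v + 1.
Proof. by elim: v => // b v IH; rewrite sz_cons /=; case: b; rewrite /tr /=; move: IH; rewrite /tr; lia. Qed.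

Lemma sz_bitss (s : seq bits) : sz s <= 4 * size (flatten s) + 2 * size s + 1.
Proof.
elim: s => // v s IH; rewrite sz_cons /= size_cat.
by have := sz_bits v; lia.
Qed.

Lemma sz_tup ins : sz (tup ins) <= 4 * (n * size (flatten ins)) + 2 * n + 1.
Proof.
have h1 := sz_bitss (tup ins); apply: (leq_trans h1); rewrite size_tuple !leq_add2r leq_mul2l /=.
have := @size_flatten_le (tup ins) (size (flatten ins)); rewrite size_tuple; apply.
move=> y; case: (ltnP y n) => h; first by rewrite load_tup // size_load_flatten.
by rewrite load_default // size_tuple.
Qed.

(** From [x = 2] on, [x + 2 <= x ^ 2]; the summand [d] covers the two smaller values, where the
    power is at most [3 ^ e]. *)
Lemma pow_budget e : exists d, forall x, (x + 2) ^ e <= x ^ d + d.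
Proof.
exists (2 * e + 3 ^ e) => -[|[|x]].
- rewrite add0n; apply: leq_trans (leq_addl _ _); apply: leq_trans (leq_addl _ _).
  by case: e => // e; rewrite leq_exp2r.
- by apply: leq_trans (leq_addl _ _); apply: leq_trans (leq_addl _ _).
- apply: leq_trans (leq_addr _ _).
  apply: (@leq_trans (x.+2 ^ (2 * e))); last by rewrite leq_exp2l // leq_addr.
  by rewrite expnM; case: e => // e; rewrite leq_exp2r //; lia.
Qed.

Lemma wrap_yields c (u : n.-tuple bits -> nat)
    (r : bits -> n.-tuple bits -> rand (bits * bits * nat)) : pbound u ->
  (forall w a, yields w c (load [:: ser (tr a)])
     (bind (r w a) (fun o => Ret (load [:: ser (tr o.1)], o.2))) (u a)) ->
  exists d (g : seq bits -> bits * bits -> store),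
  (forall ins o, g ins o 0 = o.1 /\ g ins o 1 = o.2) /\ forall w ins,
    yields w (wrap c) (load ins)
     (bind (r w (tup ins)) (fun o => Ret (g ins o.1, o.2))) (budget d ins).
Proof.
move=> pu h; rewrite /wrap; set p := Seq inp (Seq c outp).
have [R RE] : exists R, R = regs p by exists (regs p).
have R4 : 3 < R by rewrite RE /p /= /outp /= !leq_max /= !orbT.
have Rp : all (fun c => regs c <= R) [:: p] by rewrite /all RE leqnn.
rewrite -RE; clear RE.
pose m2 (ins : seq bits) y := if n <= y < n + R then [::] else load ins y.
pose g ins (o : bits * bits) := cut R (load [:: o.1; o.2]) (m2 ins).
pose S (ins : seq bits) := size (flatten ins).
pose szt (a : n.-tuple bits) := size (ser (@tr _ (@rep_tuple _ (rep_seq rep_bool) n) a)).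
pose B Q ins := (Q * (2 * S ins + 2) + 1 + (30 * szt (tup ins) + 20 * n + 20 + (u (tup ins) +
   (50 * (szt (tup ins) + u (tup ins)) + 50)).+1).+1).+1.
have [e He] : psz S (B R).
  move: (R) => Q.
  have p1 : psz S (fun ins => szt (tup ins)).
    apply: psz_le (psz_add (psz_add (psz_mul (psz_const _ 4) (psz_mul (psz_const _ n) (psz_id _)))
      (psz_const _ (2 * n))) (psz_const _ 1)) _ => ins; exact: sz_tup.
  have p2 := psz_comp pu p1.
  apply: (psz_le (v := fun ins => Q * (2 * S ins + 2) + 1 + (30 * szt (tup ins) + 20 * n + 20 +
    (u (tup ins) + (50 * (szt (tup ins) + u (tup ins)) + 50))) + 3)).
    by repeat first [assumption | apply: psz_const | apply: psz_add | apply: psz_mul | apply: psz_id].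
  by move=> ins; rewrite /B; lia.
have [d Hd] := pow_budget e.
exists d, g; split=> [ins o|w ins].
  by rewrite /g !cut_at //; apply: leq_trans R4.
apply: (yields_mono (B := B R ins)); last exact: leq_trans (He ins) (Hd _).
set a := tup ins.
have y1 : yields w p (load a) (bind (r w a) (fun o => Ret (load [:: o.1.1; o.1.2], o.2)))
   (30 * szt a + 20 * n + 20 + (u a + (50 * (szt a + u a) + 50)).+1).+1.
  apply: yields_does_l; first exact: does_inp.
  apply: (yields_does_r (g := fun o => (load [:: ser (tr o.1)], o.2))); first exact: h.
  have := yields_size 0 (h w a); rewrite every_bind.
  apply: every_imp => -[[b0 b1] q] /= hs; apply: does_mono (does_outp _ _) _.
  by rewrite leq_add2r leq_mul2l /=; exact: hs.
have y2 : yields w p (cut R (load a) (m2 ins))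
   (bind (r w a) (fun o => Ret (g ins o.1, o.2)))
   (30 * szt a + 20 * n + 20 + (u a + (50 * (szt a + u a) + 50)).+1).+1.
  by rewrite /yields (run_cut _ _ _ _ _ Rp) y1 !bindA; apply: eq_bind.
have d1 := @does_clears n R (load ins) (S ins) (size_load_flatten ins).
apply: yields_does_l y2; apply: (does_eq d1) => //.
apply: funext => y; rewrite /cut /m2; case: (ltnP y n) => h1 /=.
  by rewrite load_tup //; case: ifP.
case: (ltnP y R) => h2; last by [].
have -> : load a y = [::] by rewrite load_default // size_tuple.
by case: ifP => // h3; lia.
Qed.

End Wrap.

Lemma rp_ppt n (G : bits -> n.-tuple bits -> rand (bits * bits * nat)) : rp G ->
  exists P : ppt, forall w (ins : n.-tuple bits),
    bind (exec_oracle P w ins) (fun o => Ret (mem o 0, mem o 1, asked o)) = G w ins.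
Proof.
case=> c [u [pu h]]; have [d [g [hg y]]] := wrap_yields pu h.
have halt : forall w ins, every (run w (budget d ins) [:: wrap n c] (load ins) 0)
   (fun o => cont o = [::]).
  by move=> w ins; exact: yields_halts (y w ins).
exists (Ppt halt) => w ins; rewrite /exec_oracle /= y tup_id !bindA.
rewrite -[RHS]bind_ret; apply: eq_bind => -[o q] /=.
by have [-> ->] := hg ins o; case: o.
Qed.

Lemma coin_free_wrap n c : coin_free c -> coin_free (wrap n c).
Proof.
rewrite /wrap; move: (regs _) => R cf.
by rewrite /= coin_free_clears coin_free_packs cf.
Qed.

Lemma fp_dpt n (f : n.-tuple bits -> bits) : fp f ->
  exists P : dpt, forall ins : n.-tuple bits, apply P ins = f ins.
Proof.
move=> hf; have hf2 : fp (fun a => (f a, [::] : bits)) by fpa.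
have [c [u [cf pu h]]] := hf2.
have h' : forall w a, yields w c (load [:: ser (tr a)])
   (bind (Ret (f a, [::] : bits, 0)) (fun o => Ret (load [:: ser (tr o.1)], o.2))) (u a).
  by move=> w a; exact: h.
have [d [g [hg y]]] := wrap_yields (r := fun _ a => Ret (f a, [::], 0)) pu h'.
have halt : forall w ins, every (run w (budget d ins) [:: wrap n c] (load ins) 0)
   (fun o => cont o = [::]).
  by move=> w ins; exact: yields_halts (y w ins).
have cf' : coin_free (Ppt halt) by exact: coin_free_wrap.
exists (Dpt cf') => ins; rewrite /apply /output /exec /exec_oracle /= y tup_id /=.
by have [-> _] := hg ins (f ins, [::]).
Qed.

Definition cdiv x y := (x + y.-1) %/ y.

Lemma cdiv_ge x y : 0 < y -> x <= cdiv x y * y.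
Proof.
move=> y0; rewrite /cdiv; have := divn_eq (x + y.-1) y.
by have := ltn_pmod (x + y.-1) y0; lia.
Qed.

Lemma cdiv_le x y : 0 < y -> cdiv x y * y <= x + y.-1.
Proof. by move=> y0; rewrite /cdiv leq_divM. Qed.

Lemma cdiv_leq x y : 0 < y -> cdiv x y <= x.
Proof.
move=> y0; case: x => [|x].
  by rewrite /cdiv add0n divn_small //; case: y y0.
by have := @cdiv_le x.+1 y y0; nia.
Qed.

(** * Primes of polynomial size *)

(** By Legendre's formula the exponent is a sum of terms [2n %/ q ^ k - 2 (n %/ q ^ k)]. Each is 0
    or 1, and it is 0 once [q ^ k] exceeds [2n]. *)
Lemma logn_cbin q n : prime q -> logn q 'C(2 * n, n) <= trunc_log q (2 * n).
Proof.
move=> pq; case: (posnP n) => [->|n0]; first by rewrite bin0 logn1.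
have e : 'C(2 * n, n) * (n`! * n`!) = (2 * n)`!.
  by have := @bin_fact (2 * n) n; rewrite (_ : 2 * n - n = n); [apply|]; lia.
have: logn q 'C(2 * n, n) + (logn q n`! + logn q n`!) = logn q (2 * n)`!.
  by rewrite -e !lognM ?muln_gt0 ?bin_gt0 ?fact_gt0 //; lia.
have ext: \sum_(1 <= k < n.+1) n %/ q ^ k = \sum_(1 <= k < (2 * n).+1) n %/ q ^ k.
  rewrite [RHS](@big_cat_nat _ _ _ n.+1) //=; last by lia.
  rewrite [X in _ + X]big1_seq ?addn0 // => k /andP [_]; rewrite mem_index_iota => /andP [h1 h2].
  by rewrite divn_small //; exact: ltn_trans h1 (ltn_expl k (prime_gt1 pq)).
rewrite !logn_fact // ext => E.
have: logn q 'C(2 * n, n) <= \sum_(1 <= k < (2 * n).+1) (q ^ k <= 2 * n).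
  rewrite -(leq_add2r (\sum_(1 <= k < (2 * n).+1) n %/ q ^ k + \sum_(1 <= k < (2 * n).+1) n %/ q ^ k)).
  rewrite E -!big_split /=; apply: leq_sum => k _.
  have qk : 0 < q ^ k by rewrite expn_gt0 prime_gt0.
  case: (leqP (q ^ k) (2 * n)) => h; last by rewrite divn_small.
  have := divn_eq n (q ^ k); have := ltn_pmod n qk; move: (n %/ _) (n %% _) => x y hy hn.
  rewrite -ltnS ltn_divLR //; nia.
move=> h; apply: leq_trans h _.
rewrite -[trunc_log _ _]muln1.
have -> : \sum_(1 <= k < (2 * n).+1) (q ^ k <= 2 * n) =
   \sum_(1 <= k < (2 * n).+1 | q ^ k <= 2 * n) 1 by rewrite [RHS]big_mkcond.
have le : trunc_log q (2 * n) <= 2 * n.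
  have := trunc_logP (prime_gt1 pq) (_ : 0 < 2 * n); rewrite muln_gt0 n0 => /(_ isT).
  by have := ltn_expl (trunc_log q (2 * n)) (prime_gt1 pq); lia.
apply: (@leq_trans (\sum_(1 <= k < (trunc_log q (2 * n)).+1) 1)); last first.
  by rewrite sum_nat_const_nat; lia.
rewrite (@big_cat_nat _ _ _ (trunc_log q (2 * n)).+1) //=.
rewrite [X in _ + X]big1_seq ?addn0; last first.
  move=> k /andP [hk]; rewrite mem_index_iota => /andP [h1 _].
  by have := trunc_log_max (prime_gt1 pq) hk; lia.
by rewrite big_mkcond /=; apply: leq_sum => k _; case: ifP.
Qed.

Lemma cbin_ge n : 2 ^ n <= 'C(2 * n, n).
Proof.
elim: n => // n IH; have e1 := @mul_bin_diag (2 * n).+1 n.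
have e2 := @mul_bin_left (2 * n).+1 n.
have s : 'C((2 * n).+2, n.+1) = 'C((2 * n).+1, n.+1) + 'C((2 * n).+1, n) by rewrite binS.
have s2: 'C((2 * n).+1, n.+1) = 'C(2 * n, n.+1) + 'C(2 * n, n) by rewrite binS.
have s3 : 'C(2 * n, n) <= 'C((2 * n).+1, n).
  by case: (n) => // k; rewrite (_ : 2 * k.+1 = (2 * k.+1).-1.+1) ?binS //; lia.
have -> : 2 * n.+1 = (2 * n).+2 by lia.
by rewrite expnS s; lia.
Qed.

(** Without a prime in this interval, ['C(2n, n)] with [n = (x + 5) ^ 2] would be a product of at
    most [x] prime powers, each at most [2n <= 2 ^ (x + 6)]. As the coefficient is at least [2 ^ n],
    this contradicts [x (x + 6) < n]. *)
Lemma prime_between x : exists2 q, prime q & x < q <= 2 * (x + 5) ^ 2.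
Proof.
set n := (x + 5) ^ 2.
case: (boolP (has (fun q => prime q) (iota x.+1 (2 * n - x)))) => [/hasP [q]|/hasPn none].
  rewrite mem_iota => h pq; exists q => //; move: h; lia.
have n0 : 0 < n by rewrite expn_gt0 addn_gt0 orbT.
have le : 'C(2 * n, n) <= (2 * n) ^ x.
  rewrite -{1}(@partnT 'C(2 * n, n)); last by rewrite bin_gt0; lia.
  have c0 : 0 < 'C(2 * n, n) by rewrite bin_gt0; lia.
  rewrite (widen_partn _ (leqnn _)).
  have: forall N, \prod_(0 <= q < N | q \in predT) q ^ logn q 'C(2 * n, n) <=
     \prod_(0 <= q < N | (0 < q) && (q <= x)) (2 * n).
    move=> N; rewrite [X in X <= _]big_mkcond [X in _ <= X]big_mkcond /=.
    apply: leq_prod => q _.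
    case: (boolP (prime q)) => pq; last by rewrite lognE (negPf pq) /= expn0; case: ifP; lia.
    have lb := logn_cbin n pq; have tp := @trunc_logP q (2 * n) (prime_gt1 pq).
    have le2 : q ^ logn q 'C(2 * n, n) <= 2 * n.
      by apply: leq_trans (tp _); [rewrite leq_exp2l ?prime_gt1 | lia].
    rewrite prime_gt0 //=; case: (leqP q x) => // xq.
    case: (posnP (logn q 'C(2 * n, n))) => [->//|l0].
    have q2 : q <= 2 * n.
      by apply: leq_trans le2; rewrite -{1}[q]expn1 leq_exp2l ?prime_gt1.
    by move: (none q); rewrite mem_iota pq => /(_ ltac:(lia)).
  move=> /(_ 'C(2 * n, n).+1) h; apply: leq_trans h _.
  rewrite big_const_seq iter_muln_1 leq_exp2l; last by lia.
  have: forall N, count (fun q => (0 < q) && (q <= x)) (index_iota 0 N) <= x.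
    move=> N; rewrite -size_filter.
    apply: (@leq_trans (size (iota 1 x))); last by rewrite size_iota.
    apply: uniq_leq_size; first by rewrite filter_uniq // iota_uniq.
    by move=> q; rewrite mem_filter mem_iota => /andP [/andP [h1 h2] _]; lia.
  exact.
have h1 : 2 * n <= 2 ^ (x + 6).
  rewrite /n; elim: (x) => [|y IH] //.
  rewrite (_ : 2 ^ (y.+1 + 6) = 2 * 2 ^ (y + 6)); last by rewrite addSn expnS.
  by move: IH; rewrite -!mulnn; nia.
have: 2 ^ n <= 2 ^ ((x + 6) * x).
  apply: leq_trans (cbin_ge n) _; apply: leq_trans le _; rewrite expnM.
  by case: (x) h1 => // y h1; rewrite leq_exp2r.
rewrite leq_exp2l // /n !expnS expn0; nia.
Qed.

(** * Greedy codes *)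

Definition ham L (u v : seq bool) := count (fun i => nth false u i != nth false v i) (iota 0 L).

Lemma ham_sym L u v : ham L u v = ham L v u.
Proof. by apply: eq_count => i; rewrite eq_sym. Qed.

Lemma ham_refl L u : ham L u u = 0.
Proof. by rewrite /ham (eq_count (a2 := pred0)) ?count_pred0 // => i; rewrite eqxx. Qed.

Lemma ham_tri L u v w : ham L u w <= ham L u v + ham L v w.
Proof.
rewrite /ham; elim: (iota 0 L) => //= i s IH.
by case: (nth false u i) (nth false v i) (nth false w i) => -[] [] /=; lia.
Qed.

Lemma ham_cons L b c u v : ham L.+1 (b :: u) (c :: v) = (b != c) + ham L u v.
Proof.
rewrite /ham /= -[1]addn0 iotaDl count_map; congr (_ + _).
Qed.

Fixpoint allw L : seq (seq bool) :=
  if L is L'.+1 then map (cons false) (allw L') ++ map (cons true) (allw L') else [:: [::]].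

Lemma size_allw L : size (allw L) = 2 ^ L.
Proof. by elim: L => //= L IH; rewrite size_cat !size_map IH expnS; lia. Qed.

Lemma size_in_allw L w : w \in allw L -> size w = L.
Proof.
elim: L w => [|L IH] w /=; first by rewrite inE => /eqP ->.
by rewrite mem_cat => /orP [] /mapP [v /IH <- ->].
Qed.

(** The binomial theorem: an agreeing position contributes a factor [y], a differing one a factor 1.
    As a generating function of distances it replaces estimates of ball volumes. *)
Lemma sum_allw L y c : \sum_(w <- allw L) y ^ (L - ham L c w) = (y + 1) ^ L.
Proof.
elim: L c => [|L IH] c; first by rewrite /= big_seq1.
have key: forall b (c' : seq bool), \sum_(w <- allw L) y ^ (L.+1 - ham L.+1 c (b :: w)) =
   (if nth false c 0 == b then y else 1) * (y + 1) ^ L.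
  move=> b _; rewrite -(IH (behead c)) big_distrr /=; apply: eq_bigr => w _.
  have -> : ham L.+1 c (b :: w) = (nth false c 0 != b) + ham L (behead c) w.
    case: c => [|c0 c]; last exact: ham_cons.
    rewrite /= -(ham_cons L false b [::] w) /ham; apply: eq_count => -[|i] //=.
    by rewrite nth_nil.
  have hl : ham L (behead c) w <= L by rewrite -{2}(size_iota 0 L) count_size.
  case: eqP => _ /=; first by rewrite add0n subSn // expnS.
  by rewrite mul1n add1n subSS.
rewrite /= big_cat !big_map /= !(key _ c).
by rewrite expnS; case: (nth false c 0) => /=; lia.
Qed.

Definition gbook L D (ws : seq (seq bool)) :=
  foldl (fun acc w => if all (fun c => D <= ham L c w) acc then rcons acc w else acc) [::] ws.

Lemma gbook_pair L D ws i j : i < j < size (gbook L D ws) ->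
  D <= ham L (nth [::] (gbook L D ws) i) (nth [::] (gbook L D ws) j).
Proof.
rewrite /gbook; elim/last_ind: ws i j => [|ws w IH] i j; first by rewrite /= ltn0 andbF.
rewrite foldl_rcons; set b := foldl _ _ _ in IH *.
case: ifP => [/(all_nthP [::]) h|_]; last exact: IH.
rewrite size_rcons ltnS => /andP [ij jb]; rewrite !nth_rcons.
move: jb; rewrite leq_eqVlt => /orP [/eqP jE|jb].
  by rewrite jE ltnn eqxx -jE ij; apply: h; rewrite -jE.
by rewrite jb (ltn_trans ij jb); apply: IH; rewrite ij.
Qed.

Lemma gbook_sub L D ws : {subset gbook L D ws <= ws}.
Proof.
rewrite /gbook; elim/last_ind: ws => [|ws w IH] //.
rewrite foldl_rcons; set b := foldl _ _ _ in IH *.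
case: ifP => _ c; last by move=> /IH h; rewrite mem_rcons inE h orbT.
by rewrite !mem_rcons !inE => /orP [->//|/IH ->]; rewrite orbT.
Qed.

Lemma gbook_cover L D ws w : 0 < D -> w \in ws ->
  has (fun c => ham L c w < D) (gbook L D ws).
Proof.
move=> D0; rewrite /gbook; elim/last_ind: ws => [|ws v IH] //.
rewrite foldl_rcons; set b := foldl _ _ _ in IH *.
rewrite mem_rcons inE => /orP [/eqP ->|/IH h]; case: ifP => hb.
- by rewrite has_rcons ham_refl D0.
- by move/negbT: hb; rewrite -has_predC; apply: sub_has => c /=; rewrite ltnNge.
- by rewrite has_rcons h orbT.
- by [].
Qed.

(** The Gilbert bound. By maximality the balls around the codewords cover all words, and every word
    of the ball around [c] contributes at least [y ^ (L - D)] to the sum in [sum_allw], so a ball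
    has at most [(y + 1) ^ L / y ^ (L - D)] words. *)
Lemma size_gbook L D y : 0 < D <= L -> 0 < y ->
  2 ^ L * y ^ (L - D) <= size (gbook L D (allw L)) * (y + 1) ^ L.
Proof.
move=> /andP [D0 DL] y0; set b := gbook _ _ _.
have h1 : 2 ^ L <= \sum_(c <- b) count (fun w => ham L c w < D) (allw L).
  rewrite -size_allw -sum1_size.
  apply: (@leq_trans (\sum_(w <- allw L) \sum_(c <- b) (ham L c w < D))).
    rewrite !big_seq; apply: leq_sum => w wA.
    have /hasP [c cb hc] := @gbook_cover L D (allw L) w D0 wA.
    by rewrite (big_rem c) //= hc.
  rewrite exchange_big /=; apply: leq_sum => c _.
  by rewrite -sum1_count [X in _ <= X]big_mkcond /=; apply: leq_sum => w _; case: ifP.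
apply: (@leq_trans (\sum_(c <- b) (count (fun w => ham L c w < D) (allw L) * y ^ (L - D)))).
  by rewrite -big_distrl /=; rewrite leq_mul2r h1 orbT.
rewrite -sum1_size big_distrl /=; apply: leq_sum => c _; rewrite mul1n -(sum_allw L y c).
rewrite -sum1_count big_distrl /= big_mkcond /=; apply: leq_sum => w _.
by case: ifP => // h; rewrite mul1n leq_pexp2l //; lia.
Qed.

(** Bernoulli's inequality in integers: [(1 + 1/n) ^ k (n - k) <= n], taken at [n = 2h] and
    [k = h]. *)
Lemma pow_succ_le h : (2 * h + 1) ^ h <= 2 * (2 * h) ^ h.
Proof.
case: (posnP h) => [->//|h0].
have: forall k, k <= 2 * h -> (2 * h + 1) ^ k * (2 * h - k) <= (2 * h) ^ k * (2 * h).
  elim=> [|k IH] kh; first by rewrite !expn0; lia.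
  have {}IH := IH (ltnW kh); rewrite !expnS.
  have s1 : (2 * h + 1) * (2 * h - k.+1) <= 2 * h * (2 * h - k) by nia.
  move: s1 IH; move: (_ ^ k) ((2 * h) ^ k) => X Y s1 IH.
  apply: (@leq_trans (X * (2 * h * (2 * h - k)))).
    by rewrite [_ * X]mulnC -mulnA leq_mul2l s1 orbT.
  by rewrite mulnCA -[2 * h * Y * _]mulnA leq_mul2l IH orbT.
move=> /(_ h); rewrite (_ : 2 * h - h = h); last by lia.
move: (_ ^ h) ((2 * h) ^ h) => X Y; move=> /(_ ltac:(lia)); nia.
Qed.

Lemma pow_succ_le4 u : 0 < u -> (2 ^ u + 1) ^ (2 ^ u) <= 4 * (2 ^ u) ^ (2 ^ u).
Proof.
case: u => // u _; have := pow_succ_le (2 ^ u); rewrite -expnS.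
have E : 2 ^ u.+1 = 2 ^ u * 2 by rewrite expnS mulnC.
have E1 : forall z, z ^ 2 ^ u.+1 = z ^ (2 ^ u) * z ^ (2 ^ u).
  by move=> z; rewrite E expnM -mulnn.
rewrite !E1 => h; apply: leq_trans (leq_mul h h) _.
by rewrite mulnACA.
Qed.

(** Take [y = a] in the Gilbert bound, with length [L = a ^ 2 M] and distance [M]. Then
    [(1 + 1/a) ^ L] costs at most [2 ^ (2 a M)] and [a ^ M] at most [2 ^ (a M)], which is a relative
    loss of [3 / a] in the exponent. *)
Lemma size_gbook_pow u M : 1 < u -> 0 < M ->
  2 ^ ((2 ^ u * 2 ^ u - 3 * 2 ^ u) * M) <=
  size (gbook (2 ^ u * 2 ^ u * M) M (allw (2 ^ u * 2 ^ u * M))).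
Proof.
move=> u1 M0; set a := 2 ^ u; have a4 : 4 <= a by rewrite (_ : 4 = 2 ^ 2) // leq_exp2l.
have a0 : 0 < a by lia. have a3 : 3 * a <= a * a by rewrite leq_mul2r; lia.
have aM0 : 0 < a * M by rewrite muln_gt0 a0.
set L := a * a * M; have ML : M <= L by rewrite /L leq_pmull // muln_gt0 a0.
have := @size_gbook L M a; rewrite M0 ML => /(_ isT a0); set z := size _ => h.
have h2 : (a + 1) ^ L <= 4 ^ (a * M) * a ^ L.
  have -> : L = a * (a * M) by rewrite /L mulnA.
  rewrite (expnM (a + 1)) (expnM a) -expnMn leq_exp2r //.
  by apply: pow_succ_le4; lia.
have h3 : a ^ L = a ^ (L - M) * a ^ M by rewrite -expnD subnK.
have aM : a ^ M <= 2 ^ (a * M).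
  rewrite /a -expnM leq_exp2l // leq_mul2r; apply/orP; right; exact: ltnW (ltn_expl _ _).
have h4: 2 ^ L <= z * (4 ^ (a * M) * 2 ^ (a * M)).
  have p0 : 0 < a ^ (L - M) by rewrite expn_gt0; lia.
  rewrite -(leq_pmul2r p0); apply: leq_trans h _.
  rewrite -mulnA leq_mul2l; apply/orP; right; apply: leq_trans h2 _.
  rewrite h3 -mulnA leq_mul2l; apply/orP; right.
  by rewrite mulnC leq_mul2r aM orbT.
have E : 2 ^ L = 2 ^ ((a * a - 3 * a) * M) * (4 ^ (a * M) * 2 ^ (a * M)).
  have eL : L = (a * a - 3 * a) * M + (2 * (a * M) + a * M).
    by rewrite /L -{1}(subnK a3) mulnDl -(mulnA 3); lia.
  by rewrite {1}eL (expnD 2 ((a * a - 3 * a) * M)) (expnD 2 (2 * (a * M))) (expnM 2 2).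
by move: h4; rewrite E leq_pmul2r // muln_gt0 !expn_gt0.
Qed.

Definition gdec L D (b : seq (seq bool)) w := find (fun c => 2 * ham L c w < D) b.

Lemma gdec_correct L D ws v w : v < size (gbook L D ws) ->
  2 * ham L (nth [::] (gbook L D ws) v) w < D -> gdec L D (gbook L D ws) w = v.
Proof.
set b := gbook _ _ _ => vb h; rewrite /gdec; set P := fun c => _.
have hP : has P b by apply/hasP; exists (nth [::] b v); rewrite ?mem_nth.
have h2 := nth_find [::] hP; rewrite -/P in h2.
have fb : find P b < size b by rewrite -has_find.
apply/eqP; case: ltngtP => // lt.
  have := @gbook_pair L D ws (find P b) v; rewrite -/b lt vb => /(_ isT).
  have := ham_tri L (nth [::] b (find P b)) w (nth [::] b v); rewrite (ham_sym _ w).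
  by move: h2; rewrite /P; lia.
have := @gbook_pair L D ws v (find P b); rewrite -/b lt fb => /(_ isT).
have := ham_tri L (nth [::] b v) w (nth [::] b (find P b)); rewrite (ham_sym _ w).
by move: h2; rewrite /P; lia.
Qed.

(** * Reed-Solomon codes *)

Section RSdef.
Variables (p LEN : nat).

Definition rs_eval (s : seq nat) x := foldl (fun acc c => (c + x * acc) %% p) 0 (rev s).
Definition smod x y := (x + (p - y %% p)) %% p.
Definition rs_comb c1 s1 c2 s2 :=
  mkseq (fun i => smod (c1 * nth 0 s1 i) (c2 * nth 0 s2 i)) LEN.
Definition rs_mulx a s := mkseq (fun i => smod (nth 0 (0 :: s) i) (a * nth 0 s i)) LEN.
Definition rs_disc (f : seq nat * seq nat * nat) a y :=
  smod (rs_eval f.1.1 a) (y * rs_eval f.1.2 a).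

(* One step of the Welch-Berlekamp interpolation: a state is a pair of pairs
   (N, D) with N(a) = y D(a) at the points processed so far, and a bound on
   their weighted degree. *)
Definition rs_step (st : (seq nat * seq nat * nat) * (seq nat * seq nat * nat)) (ay : nat * nat) :=
  let f := if st.1.2 <= st.2.2 then st.1 else st.2 in
  let g := if st.1.2 <= st.2.2 then st.2 else st.1 in
  let a := ay.1 in
  let df := rs_disc f a ay.2 in let dg := rs_disc g a ay.2 in
  if df == 0 then (f, (rs_mulx a g.1.1, rs_mulx a g.1.2, g.2.+1))
  else ((rs_mulx a f.1.1, rs_mulx a f.1.2, f.2.+1),
        (rs_comb df g.1.1 dg f.1.1, rs_comb df g.1.2 dg f.1.2, g.2)).

Definition rs_key K (ys : seq nat) :=
  let st := foldl rs_step (([:: 1], [::], 0), ([::], [:: 1], K.-1))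
     (map (fun i => (i, nth 0 ys i)) (iota 0 (size ys))) in
  if st.1.2 <= st.2.2 then st.1.1 else st.2.1.

(** The quotient as a power series: [v] is the lowest non-zero position of [d], [iv] the inverse of
    the coefficient there. Working upwards from low degrees, no true degree has to be known. *)
Definition rs_quo K (n d : seq nat) :=
  let v := find (fun c => c != 0) d in
  let iv := find (fun x => (x * nth 0 d v) %% p == 1) (iota 0 p) in
  foldl (fun acc i => rcons acc ((smod (nth 0 n (v + i))
    (foldl (fun s j => (s + nth 0 acc j * nth 0 d (v + i - j)) %% p) 0 (iota 0 i)) * iv) %% p))
    [::] (iota 0 K).

Definition rs_dec K ys := let nd := rs_key K ys in rs_quo K nd.1 nd.2.

End RSdef.

Import GRing.Theory.

Section RS.
Local Open Scope ring_scope.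
Variables (p LEN : nat).
Hypothesis pp : prime p.
Notation F := ('F_p).
Local Notation "n %:F" := (n%:R : F).

Definition toP (s : seq nat) : {poly F} := \poly_(i < LEN) (nth 0%N s i)%:F.

Lemma mod_F n : (n %% p)%N%:F = n%:F.
Proof. exact: Fp_nat_mod. Qed.

Lemma smod_F x y : (smod p x y)%:F = x%:F - y%:F.
Proof.
rewrite /smod mod_F natrD natrB; last exact: ltnW (ltn_pmod _ (prime_gt0 pp)).
have -> : p%:F = 0 by rewrite -mod_F modnn.
by rewrite sub0r mod_F.
Qed.

Lemma eqF x y : (x < p)%N -> (y < p)%N -> x%:F = y%:F -> x = y.
Proof.
move=> hx hy /(congr1 (fun z : F => nat_of_ord z)); rewrite !val_Fp_nat //.
by rewrite !modn_small.
Qed.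

Lemma coef_toP s i : (toP s)`_i = if (i < LEN)%N then (nth 0%N s i)%:F else 0.
Proof. by rewrite coef_poly. Qed.

Lemma toP_comb c1 s1 c2 s2 :
  toP (rs_comb p LEN c1 s1 c2 s2) = c1%:F *: toP s1 - c2%:F *: toP s2.
Proof.
apply/polyP => i; rewrite coefB !coefZ !coef_toP; case: ifP => h; last by rewrite !mulr0 subr0.
by rewrite nth_mkseq // smod_F !natrM.
Qed.

Lemma toP_mulx a s : (size (toP s) < LEN)%N ->
  toP (rs_mulx p LEN a s) = ('X - a%:F%:P) * toP s.
Proof.
move=> h; apply/polyP => i; rewrite mulrBl coefB coefXM coefCM !coef_toP.
case: i => [|i] /=.
  by case: ifP => h0; rewrite ?nth_mkseq ?smod_F ?natrM ?mulr0 ?subr0.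
case: ifP => hi; first by rewrite nth_mkseq // smod_F natrM /= (ltnW hi).
rewrite mulr0 subr0; case: ifP => // hi'.
have e : i.+1 = LEN by apply/eqP; rewrite eqn_leq hi' leqNgt hi.
have := nth_default 0 (_ : (size (toP s) <= i)%N); rewrite coef_toP hi' => -> //.
by rewrite -ltnS e.
Qed.

Lemma eval_toP s x : (size s <= LEN)%N -> (rs_eval p s x)%:F = (toP s).[x%:F].
Proof.
move=> h; have -> : toP s = Poly (map (fun n => n%:F) s).
  apply/polyP => i; rewrite coef_toP coef_Poly.
  case: (ltnP i (size s)) => hi; first by rewrite (leq_trans hi h) (nth_map 0%N).
  by rewrite !nth_default ?size_map // if_same.
rewrite horner_Poly /rs_eval foldl_rev; elim: s {h} => //= c s IH.
by rewrite mod_F natrD natrM IH addrC mulrC.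
Qed.

Variables (K E N : nat) (P : {poly F}) (ys : seq nat).
Hypotheses (K0 : (0 < K)%N) (NE : (N = K + 2 * E)%N) (Np : (N <= p)%N).
Hypothesis LENE : (N + K + 2 <= LEN)%N.
Hypothesis Ps : (size P <= K)%N.
Hypothesis sys : size ys = N.

(** The third component is a weight that bounds both [deg N] and [deg D + K - 1]. The truncated
    subtraction is intended: below weight [K - 1] it forces [D = 0]. *)
Definition okc i (f : seq nat * seq nat * nat) :=
  [/\ (size f.1.1 <= LEN)%N, (size f.1.2 <= LEN)%N, (size (toP f.1.1) <= f.2.+1)%N,
      (size (toP f.1.2) <= f.2.+1 - K.-1)%N &
      forall j, (j < i)%N -> (toP f.1.1).[j%:F] = (nth 0%N ys j)%:F * (toP f.1.2).[j%:F]].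

(** The known sum of the weights shows that the lighter pair is light enough at the end; the
    non-zero determinant shows that this pair is not trivial. *)
Definition okst i st := [/\ okc i st.1, okc i st.2, (st.1.2 + st.2.2 = K.-1 + i)%N &
  toP st.1.1.1 * toP st.2.1.2 - toP st.2.1.1 * toP st.1.1.2 != 0].

Lemma okst_swap i f g : okst i (f, g) -> okst i (g, f).
Proof.
case=> h1 h2 h3 h4; split=> //=; first by rewrite addnC.
by rewrite -oppr_eq0 opprB.
Qed.

Lemma okc_mulx i f : (i < N)%N -> okc i f -> (f.2 <= K + N)%N ->
  okc i.+1 (rs_mulx p LEN i f.1.1, rs_mulx p LEN i f.1.2, f.2.+1) /\
  (toP (rs_mulx p LEN i f.1.1) = ('X - i%:F%:P) * toP f.1.1 /\
   toP (rs_mulx p LEN i f.1.2) = ('X - i%:F%:P) * toP f.1.2).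
Proof.
case: f => [[n d] e] /= iN [/= h1 h2 h3 h4 h5] eK.
have s1 : (size (toP n) < LEN)%N by apply: leq_ltn_trans h3 _; lia.
have s2 : (size (toP d) < LEN)%N by apply: leq_ltn_trans h4 _; lia.
have e1 := toP_mulx i s1; have e2 := toP_mulx i s2.
split=> //; split=> /=; rewrite ?size_mkseq ?e1 ?e2 //.
- case: (eqVneq (toP n) 0) => [->|nz]; rewrite ?mulr0 ?size_poly0 //.
  by rewrite size_monicM ?monicXsubC // size_XsubC add2n.
- case: (eqVneq (toP d) 0) => [->|nz]; rewrite ?mulr0 ?size_poly0 //.
  rewrite size_monicM ?monicXsubC // size_XsubC add2n /=.
  have : (0 < size (toP d))%N by rewrite size_poly_gt0.
  by move: (size (toP d)) h4 => z; lia.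
- move=> j; rewrite ltnS leq_eqVlt => /orP [/eqP ->|ji].
    by rewrite !hornerM !hornerXsubC subrr !mul0r mulr0.
  by rewrite !hornerM h5 // mulrCA.
Qed.

(** In both cases one weight rises by one and the determinant is multiplied by [X - i] and a
    non-zero scalar. The lighter pair is subtracted from the heavier one, so that the combination
    keeps the heavier weight. *)
Lemma okst_step i st : (i < N)%N -> okst i st ->
  okst i.+1 (rs_step p LEN st (i, nth 0%N ys i)).
Proof.
move=> iN ok.
set f := if (st.1.2 <= st.2.2)%N then st.1 else st.2.
set g := if (st.1.2 <= st.2.2)%N then st.2 else st.1.
have [{}ok le] : okst i (f, g) /\ (f.2 <= g.2)%N.
  rewrite /f /g; case: leqP => h; first by case: st ok {f g} h.
  by split; [case: st ok {f g h} => f g; exact: okst_swap | exact: ltnW].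
rewrite /rs_step -/f -/g /=.
case: ok => /= okf okg sum det.
have fK : (f.2 <= K + N)%N by lia. have gK : (g.2 <= K + N)%N by lia.
have [okf' [f1 f2]] := okc_mulx iN okf fK.
have [okg' [g1 g2]] := okc_mulx iN okg gK.
have Xn0 : 'X - i%:F%:P != 0 :> {poly F} by rewrite polyXsubC_eq0.
have dF : forall h, okc i h -> (rs_disc p h i (nth 0%N ys i))%:F =
   (toP h.1.1).[i%:F] - (nth 0%N ys i)%:F * (toP h.1.2).[i%:F].
  by move=> h [s1 s2 _ _ _]; rewrite /rs_disc smod_F natrM !eval_toP.
have dlt : forall h y, (rs_disc p h i y < p)%N by move=> h y; rewrite ltn_pmod ?prime_gt0.
case: eqP => df.
  split=> //=; last 2 first.
  - by rewrite addnS sum addnS.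
  - by rewrite g1 g2 mulrCA -mulrA -mulrBr mulf_neq0.
  case: okf => s1 s2 s3 s4 s5; split=> // j; rewrite ltnS leq_eqVlt => /orP [/eqP ->|/s5 //].
  by have := dF f (And5 s1 s2 s3 s4 s5); rewrite df => /esym/eqP; rewrite subr_eq0 => /eqP.
have dfF := dF f okf; have dgF := dF g okg.
move: dfF dgF; move E1 : (rs_disc p f i _) => A; move E2 : (rs_disc p g i _) => B dfF dgF.
have A0 : A%:F != 0.
  apply/eqP => A0; apply: df; rewrite E1; apply: eqF; rewrite ?prime_gt0 //.
  by rewrite -E1 dlt.
case: okf okg => s1 s2 s3 s4 s5 [t1 t2 t3 t4 t5].
split=> //=; last 2 first.
- by rewrite addSn sum addnS.
- rewrite f1 f2 !toP_comb.
  have -> : ('X - i%:F%:P) * toP f.1.1 * (A%:F *: toP g.1.2 - B%:F *: toP f.1.2) -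
     (A%:F *: toP g.1.1 - B%:F *: toP f.1.1) * (('X - i%:F%:P) * toP f.1.2) =
     A%:F *: (('X - i%:F%:P) * (toP f.1.1 * toP g.1.2 - toP g.1.1 * toP f.1.2)).
    by rewrite -!mul_polyC; ring.
  by rewrite scaler_eq0 negb_or A0 mulf_neq0.
split=> /=; rewrite ?size_mkseq // ?toP_comb.
- apply: leq_trans (size_polyD _ _) _; rewrite size_polyN geq_max; apply/andP; split.
    exact: leq_trans (size_scale_leq _ _) t3.
  by apply: leq_trans (size_scale_leq _ _) _; apply: leq_trans s3 _.
- apply: leq_trans (size_polyD _ _) _; rewrite size_polyN geq_max; apply/andP; split.
    exact: leq_trans (size_scale_leq _ _) t4.
  by apply: leq_trans (size_scale_leq _ _) _; apply: leq_trans s4 _; lia.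
- move=> j; rewrite ltnS leq_eqVlt => /orP [/eqP ->|ji].
    rewrite !hornerD !hornerN !hornerZ dfF dgF.
    by ring.
  rewrite !hornerD !hornerN !hornerZ t5 // s5 //.
  by rewrite mulrBr !(mulrCA (nth 0%N ys j)%:F).
Qed.

Lemma okst_init : okst 0 (([:: 1%N], [::], 0%N), ([::], [:: 1%N], K.-1)).
Proof.
have L1 : (1 <= LEN)%N by lia.
have e1 : toP [:: 1%N] = 1.
  apply/polyP => -[|i]; rewrite coef_toP coef1 /= ?nth_nil; first by rewrite L1.
  by case: ifP.
have e0 : toP [::] = 0.
  by apply/polyP => i; rewrite coef_toP coef0 nth_nil; case: ifP.
split=> //=; rewrite ?e1 ?e0 ?addn0 ?mulr1 ?mul0r ?subr0 ?oner_eq0 //.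
  by split=> //=; rewrite ?e1 ?e0 ?size_poly1 ?size_poly0.
by split=> //=; rewrite ?e1 ?e0 ?size_poly1 ?size_poly0 //; lia.
Qed.

Lemma okst_fold i : (i <= N)%N ->
  okst i (foldl (rs_step p LEN) (([:: 1%N], [::], 0%N), ([::], [:: 1%N], K.-1))
    (map (fun i => (i, nth 0%N ys i)) (iota 0 i))).
Proof.
elim: i => [|i IH] h; first exact: okst_init.
rewrite -addn1 iotaD map_cat foldl_cat /= add0n addn1.
by apply: okst_step => //; apply: IH; exact: ltnW.
Qed.

(** The weights sum to [K - 1 + N = 2 (K - 1 + E) + 1], so the lighter one is at most [K - 1 + E].
    Hence [N - P D] has degree below [K + E] but vanishes at the at least [K + E] correct points, so
    it is zero. If [D] were zero, [N] and then the determinant would be too. *)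
Lemma rs_key_correct :
  (count (fun j => P.[j%:F] != (nth 0%N ys j)%:F) (iota 0 N) <= E)%N ->
  let nd := rs_key p LEN K ys in
  toP nd.1 = P * toP nd.2 /\ toP nd.2 != 0.
Proof.
move=> errs; rewrite /rs_key sys; set st := foldl _ _ _.
have ok : okst N st by exact: okst_fold.
set f := if (st.1.2 <= st.2.2)%N then st.1 else st.2.
set g := if (st.1.2 <= st.2.2)%N then st.2 else st.1.
have [{}ok le] : okst N (f, g) /\ (f.2 <= g.2)%N.
  rewrite /f /g; case: leqP => h; first by case: (st) ok {f g} h.
  by split; [case: (st) ok {f g h} => f g; exact: okst_swap | exact: ltnW].
have -> : (if (st.1.2 <= st.2.2)%N then st.1.1 else st.2.1) = f.1.
  by rewrite /f; case: ifP.
case: ok => /= [[s1 s2 s3 s4 s5] _ sum det].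
have fe : (f.2 <= K.-1 + E)%N by lia.
have key : toP f.1.1 = P * toP f.1.2.
  apply/eqP; rewrite -subr_eq0; set Q := _ - _; apply/eqP.
  pose rs := [seq j%:F | j <- iota 0 N & P.[j%:F] == (nth 0%N ys j)%:F].
  have szQ : (size Q <= K + E)%N.
    apply: leq_trans (size_polyD _ _) _; rewrite size_polyN geq_max; apply/andP; split.
      by apply: leq_trans s3 _; lia.
    case: (eqVneq (toP f.1.2) 0) => [->|nz]; first by rewrite mulr0 size_poly0.
    have d0 : (0 < size (toP f.1.2))%N by rewrite size_poly_gt0.
    apply: leq_trans (size_polyMleq _ _) _.
    apply: (@leq_trans (K + (f.2.+1 - K.-1)).-1); last by lia.
    by move: (leq_add Ps s4); move: (size P + _)%N (K + _)%N => x y; lia.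
  apply: (@roots_geq_poly_eq0 _ Q rs).
  - apply/allP => x /mapP [j]; rewrite mem_filter mem_iota => /andP [/eqP hj jN] ->.
    by rewrite rootE /Q !hornerE s5 // hj subrr.
  - rewrite map_inj_in_uniq ?filter_uniq ?iota_uniq // => i j.
    rewrite !mem_filter !mem_iota => /andP [_ hi] /andP [_ hj]; apply: eqF; lia.
  - apply: leq_trans szQ _; rewrite size_map size_filter.
    have := count_predC (fun j => P.[j%:F] == (nth 0%N ys j)%:F) (iota 0 N).
    have e2 : (count (predC (fun j => P.[j%:F] == (nth 0%N ys j)%:F)) (iota 0 N) <= E)%N.
      exact: errs.
    by rewrite size_iota; move: e2; move: (count _ _) (count _ _) => x y; lia.
split=> //; apply: contraNneq det => d0.
by rewrite key d0 mulr0 mul0r mulr0 subrr.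
Qed.

Lemma foldl_sum_mod (h : nat -> nat) i :
  (foldl (fun s j => (s + h j) %% p)%N 0%N (iota 0 i))%:F = \sum_(j < i) (h j)%:F.
Proof.
elim: i => [|i IH]; first by rewrite big_ord0.
have -> : iota 0 i.+1 = iota 0 i ++ [:: i] by rewrite -addn1 iotaD.
by rewrite foldl_cat /= mod_F natrD IH big_ord_recr.
Qed.

Lemma rs_quo_correct n d (msg : seq nat) : size msg = K ->
  (forall i, (nth 0%N msg i < p)%N) ->
  (forall i, (nth 0%N d i < p)%N) ->
  (size d <= LEN)%N -> (size n <= LEN)%N ->
  (P = \poly_(i < K) (nth 0%N msg i)%:F) ->
  toP n = P * toP d -> toP d != 0 -> rs_quo p K n d = msg.
Proof.
move=> sm mp dp sd sn PE key d0; rewrite /rs_quo.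
set v := find _ _; set iv := find _ _.
have hv : (has (fun c => c != 0%N) d).
  apply: contraNT d0 => /hasPn h; apply/eqP/polyP => i; rewrite coef_toP coef0.
  case: ifP => // _; case: (ltnP i (size d)) => hi; last by rewrite nth_default.
  by have /negPn/eqP -> := h _ (mem_nth 0%N hi).
have vd : (v < size d)%N by rewrite -has_find.
have dv : (nth 0%N d v)%:F != 0.
  apply/eqP => e; have := nth_find 0%N hv; rewrite -/v => /eqP; apply.
  by apply: eqF => //; rewrite prime_gt0.
have low : forall i, (i < v)%N -> nth 0%N d i = 0%N.
  by move=> i /(before_find 0%N) /negbT /negPn /eqP.
have hiv : has (fun x => (x * nth 0%N d v) %% p == 1)%N (iota 0 p).
  apply/hasP; exists (nat_of_ord ((nth 0%N d v)%:F^-1)).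
    rewrite mem_iota add0n /=; have := ltn_ord ((nth 0%N d v)%:F^-1).
    by rewrite [X in (_ < X)%N](Fp_cast pp).
  apply/eqP; apply: eqF; rewrite ?ltn_pmod ?prime_gt0 ?prime_gt1 //.
  by rewrite mod_F natrM natr_Zp mulVf.
have ivE : iv%:F * (nth 0%N d v)%:F = 1.
  have := nth_find 0%N hiv; rewrite -/iv nth_iota; last by rewrite -(size_iota 0 p) -has_find.
  by rewrite add0n => /eqP e; rewrite -natrM -mod_F e.
have cP : forall j, P`_j = (nth 0%N msg j)%:F.
  by move=> j; rewrite PE coef_poly; case: ltnP => // h; rewrite nth_default // sm.
have cd : forall j, (toP d)`_j = (nth 0%N d j)%:F.
  move=> j; rewrite coef_toP; case: ltnP => // h; rewrite nth_default //.
  exact: leq_trans sd h.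
have cn : forall j, (toP n)`_j = (nth 0%N n j)%:F.
  move=> j; rewrite coef_toP; case: ltnP => // h; rewrite nth_default //.
  exact: leq_trans sn h.
(* As [d] vanishes below [v], coefficient [v + i] of the product only involves the first [i + 1]
   message symbols, and the last of them with the invertible factor [d_v]. *)
have conv : forall i, (nth 0%N n (v + i))%:F = \sum_(j < i) (nth 0%N msg j)%:F * (nth 0%N d (v + i - j))%:F
    + (nth 0%N msg i)%:F * (nth 0%N d v)%:F.
  move=> i; rewrite -cn key coefM.
  rewrite -(big_mkord predT (fun j => P`_j * (toP d)`_(v + i - j))) /=.
  rewrite (@big_cat_nat _ _ _ i.+1) //=; last by rewrite ltnS leq_addl.
  rewrite [X in _ + X]big1_seq ?addr0; last first.
    move=> j /andP [_]; rewrite mem_index_iota => /andP [h1 h2].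
    by rewrite cd low ?mulr0 //; lia.
  rewrite big_nat_recr //= big_mkord addnK cP cd; congr (_ + _).
  by apply: eq_bigr => j _; rewrite cP cd.
have H: forall k, (k <= K)%N -> foldl (fun acc i => rcons acc ((smod p (nth 0%N n (v + i))
    (foldl (fun s j => (s + nth 0%N acc j * nth 0%N d (v + i - j)) %% p) 0%N (iota 0 i)) * iv) %% p)%N)
    [::] (iota 0 k) = take k msg.
  elim=> [|k IH] kK; first by rewrite take0.
  have -> : iota 0 k.+1 = iota 0 k ++ [:: k] by rewrite -addn1 iotaD.
  rewrite foldl_cat /= IH; last exact: ltnW.
  rewrite (take_nth 0%N) ?sm //; congr rcons.
  apply: eqF; rewrite ?ltn_pmod ?prime_gt0 //.
  rewrite mod_F natrM smod_F foldl_sum_mod conv.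
  rewrite [X in _ - X](eq_bigr (fun j : 'I_k => (nth 0%N msg j)%:F * (nth 0%N d (v + k - j))%:F)); last first.
    by move=> j _; rewrite natrM nth_take.
  by rewrite addrAC subrr add0r -mulrA [X in _ * X]mulrC ivE mulr1.
by rewrite H // -sm take_size.
Qed.


End RS.

Lemma rs_eval_lt p s x : 0 < p -> rs_eval p s x < p.
Proof.
by move=> p0; rewrite /rs_eval foldl_rev; case: s => //= c s; rewrite ltn_pmod.
Qed.

Lemma rs_key_bound p LEN K ys : prime p -> 1 <= LEN ->
  let nd := rs_key p LEN K ys in
  (forall i, nth 0 nd.2 i < p) /\ (size nd.1 <= LEN) && (size nd.2 <= LEN).
Proof.
move=> pp L1; rewrite /rs_key.
pose ok (f : seq nat * seq nat * nat) :=
  (forall i, nth 0 f.1.2 i < p) /\ (size f.1.1 <= LEN) && (size f.1.2 <= LEN).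
have p0 := prime_gt0 pp; have p1 := prime_gt1 pp.
have okm : forall g, (forall i, g i < p) -> forall i, nth 0 (mkseq g LEN) i < p.
  move=> g h i; case: (ltnP i LEN) => hi; first by rewrite nth_mkseq.
  by rewrite nth_default ?size_mkseq.
suff: forall l st, ok st.1 -> ok st.2 ->
   ok (foldl (rs_step p LEN) st l).1 /\ ok (foldl (rs_step p LEN) st l).2.
  move=> /(_ _ (([:: 1], [::], 0), ([::], [:: 1], K.-1))) h.
  case: (h [seq (i, nth 0 ys i) | i <- iota 0 (size ys)]).
  - by split=> /= [i|]; rewrite ?nth_nil ?L1.
  - by split=> /= [[|i]|]; rewrite /= ?nth_nil ?L1.
  - by move=> h1 h2; case: ifP => _; [exact: h1 | exact: h2].
elim=> //= ay l IH st h1 h2; apply: IH; rewrite /rs_step.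
  case: ifP => _; first by case: ifP.
  split=> /=; last by rewrite !size_mkseq leqnn.
  by apply: okm => i; rewrite ltn_pmod.
case: ifP => _ /=; split=> /=; rewrite ?size_mkseq ?leqnn //;
  by apply: okm => i; rewrite ltn_pmod.
Qed.

Lemma rs_correct p LEN K E N (msg ys : seq nat) : prime p ->
  N = K + 2 * E -> N <= p -> N + K + 2 <= LEN -> size msg = K ->
  (forall i, nth 0 msg i < p) -> size ys = N ->

  count (fun j => rs_eval p msg j != nth 0 ys j) (iota 0 N) <= E ->
  rs_dec p LEN K ys = msg.
Proof.
move=> pp NE Np LE sm mp sys errs.
case: (posnP K) => [K0|K0].
  by rewrite /rs_dec /rs_quo K0 /=; apply/esym/size0nil; rewrite sm.
pose P : {poly 'F_p} := (\poly_(i < K) (nth 0%N msg i)%:R)%R.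
have Ps : size P <= K by exact: size_poly.
have PE : forall j, (P.[j%:R] = (rs_eval p msg j)%:R)%R.
  move=> j; rewrite (@eval_toP p LEN pp) ?sm; last by lia.
  congr (_.[_])%R; apply/polyP => i; rewrite coef_poly coef_toP.
  case: (ltnP i K) => h; first by rewrite (_ : i < LEN) //; lia.
  by rewrite nth_default ?sm // if_same.
have errs' : count (fun j => (P.[j%:R] != (nth 0 ys j)%:R)%R) (iota 0 N) <= E.
  apply: leq_trans errs; apply: sub_count => j /=; rewrite PE.
  by apply: contraNneq => ->.
have [h1 h2] := rs_key_correct pp K0 NE Np LE Ps sys errs'.
have L1 : 1 <= LEN by lia.
have [b1 /andP [b2 b3]] := @rs_key_bound p LEN K ys pp L1.
by apply: (rs_quo_correct pp (E := E) (N := N) (ys := ys)) h1 h2.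
Qed.

(** * The concatenated code *)

(** The cap [c] keeps the value, and so its unary representation, polynomial on strings of any
    length; on the strings of interest it is not exceeded. *)
Definition b2n c (s : seq bool) := foldl (fun acc b => minn c (nat_of_bool b + 2 * acc)) 0 (rev s).
Definition n2b m v := mkseq (fun i => odd (iter i half v)) m.

Lemma b2n_small c s : 2 ^ size s <= c -> b2n c s < 2 ^ size s.
Proof.
rewrite /b2n foldl_rev; elim: s c => //= b s IH c h.
have h' : 2 ^ size s <= c by move: h; rewrite expnS; lia.
have := IH c h'; rewrite expnS; set z := foldr _ _ _ => hz.
by apply: leq_ltn_trans (geq_minr _ _) _; case: b; lia.
Qed.

Lemma b2n_cons c b s : 2 ^ (size s).+1 <= c -> b2n c (b :: s) = b + 2 * b2n c s.
Proof.
move=> h; have h' : 2 ^ size s <= c by move: h; rewrite expnS; lia.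
have := b2n_small h'; rewrite /b2n !foldl_rev /=; set z := foldr _ _ _ => hz.
by apply/minn_idPr; move: h; rewrite expnS; case: b; lia.
Qed.

Lemma b2nK c s : 2 ^ size s <= c -> n2b (size s) (b2n c s) = s.
Proof.
elim: s => [|b s IH] h //.
have h' : 2 ^ size s <= c by move: h; rewrite /= expnS; lia.
rewrite b2n_cons //.
have e1 : odd (b + 2 * b2n c s) = b by rewrite oddD oddM addbF oddb.
have e2 : (b + 2 * b2n c s)./2 = b2n c s by case: (b); lia.
apply: (@eq_from_nth _ false); rewrite size_mkseq // => -[|i] hi; rewrite nth_mkseq //.
by rewrite iterSr e2 [RHS]/= -{2}(IH h') nth_mkseq.
Qed.

(** Here [hh] counts bit errors, [c] wrong outer symbols and [x] is [a]. A wrong symbol costs at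
    least [M / 2] bit errors and an inner word has [x ^ 2 M] bits, so a fraction [1 / (6 x ^ 3)] of
    bit errors spoils at most [N / (3 x) <= E] symbols. *)
Lemma ecc_arith x M c hh E N : 0 < x -> 0 < M -> c * M <= 2 * hh ->
  N <= 3 * x * E -> 6 * (x * x * x) * hh <= N * (x * x * M) -> c <= E.
Proof.
move=> x0 M0 h1 h2 h3.
have xx0 : 0 < x * x by rewrite muln_gt0 x0.
have e1 : 6 * x * hh <= N * M.
  rewrite -(leq_pmul2l xx0).
  have -> : x * x * (6 * x * hh) = 6 * (x * x * x) * hh by ring.
  by have -> : x * x * (N * M) = N * (x * x * M) by ring.
have e2 : 3 * x * c * M <= 3 * x * E * M.
  apply: (@leq_trans (N * M)); last by rewrite leq_mul2r h2 orbT.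
  apply: leq_trans e1.
  have -> : 3 * x * c * M = 3 * x * (c * M) by ring.
  have -> : 6 * x * hh = 3 * x * (2 * hh) by ring.
  by rewrite leq_mul2l h1 orbT.
move: e2; rewrite leq_pmul2r // leq_pmul2l // muln_gt0 x0 //.
Qed.

Lemma four_le_pow u : 1 < u -> 4 <= 2 ^ u.
Proof. by move=> u1; rewrite (_ : 4 = 2 ^ 2) // leq_exp2l. Qed.

Lemma aa3_gt0 u : 1 < u -> 0 < 2 ^ u * 2 ^ u - 3 * 2 ^ u.
Proof.
by move=> /four_le_pow; move: (2 ^ u) => x h; rewrite -mulnBl muln_gt0; lia.
Qed.

Lemma size_flatten_const (f : nat -> seq bool) n L : (forall i, i < n -> size (f i) = L) ->
  size (flatten (mkseq f n)) = n * L.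
Proof.
elim: n => // n IH h; rewrite mkseqS flatten_rcons size_cat h // IH; first by lia.
by move=> i hi; apply: h; lia.
Qed.

Lemma flatten_seg (f : nat -> seq bool) n L j : (forall i, i < n -> size (f i) = L) -> j < n ->
  take L (drop (j * L) (flatten (mkseq f n))) = f j.
Proof.
move=> h jn; rewrite /mkseq -(subnKC (ltnW jn)) iotaD map_cat flatten_cat.
have h' : forall i, i < j -> size (f i) = L by move=> i hi; apply: h; lia.
rewrite drop_cat -[flatten (map f (iota 0 j))]/(flatten (mkseq f j)).
rewrite (size_flatten_const h') ltnn subnn drop0 add0n.
have e : iota j (n - j) = j :: iota j.+1 (n - j).-1.
  by have : 0 < n - j; [lia | case: (n - j)].
by rewrite e /= take_cat -(h j jn) ltnn subnn take0 cats0.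
Qed.

Lemma flatten_seg_cat (f : nat -> seq bool) n L j t : (forall i, i < n -> size (f i) = L) -> j < n ->
  take L (drop (j * L) (flatten (mkseq f n) ++ t)) = f j.
Proof.
move=> h jn; rewrite take_drop takel_cat ?(size_flatten_const h); first by rewrite -take_drop flatten_seg.
by rewrite -mulSn leq_mul2r jn orbT.
Qed.

Lemma ham_cat m n x y : ham (m + n) x y = ham m x y + ham n (drop m x) (drop m y).
Proof.
rewrite /ham iotaD count_cat add0n; congr (_ + _).
rewrite -{1}[m]addn0 iotaDl count_map; apply: eq_count => i /=.
by rewrite !nth_drop.
Qed.

Lemma ham_take m x y : ham m (take m x) (take m y) = ham m x y.
Proof.
apply: eq_in_count => i; rewrite mem_iota add0n => /= h.
by rewrite !nth_take.
Qed.

Lemma ham_blocks n L x y : ham (n * L) x y =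
  \sum_(j < n) ham L (take L (drop (j * L) x)) (take L (drop (j * L) y)).
Proof.
elim: n => [|n IH]; first by rewrite big_ord0.
by rewrite mulSn addnC ham_cat IH big_ord_recr /= ham_take.
Qed.

Section Ecc.
Variables (u p : nat).
Hypotheses (u1 : 1 < u) (pp : prime p).

Notation a := (2 ^ u).
(* The outer code is Reed-Solomon of dimension [eK] and length [eN] over [F_p],
   correcting [eE] errors; its symbols carry [em] bits.  The inner code has
   length [eL] and distance [eM]; with [eM / eL = 1 / a ^ 2], the greedy code
   has rate at least [1 - 3 / a]. *)
Definition em := trunc_log 2 p.
Definition eM := cdiv em.+1 (a * a - 3 * a).
Definition eL := a * a * eM.
Definition book := gbook eL eM (allw eL).
Definition eK B := cdiv B em.
Definition eE B := cdiv (eK B) a.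
Definition eN B := eK B + 2 * eE B.
Definition elen B := eN B * eL.

Definition ecc_sym (s : seq bool) i := b2n p (mkseq (fun j => nth false s (i * em + j)) em).
Definition emsg B s := mkseq (ecc_sym s) (eK B).
Definition ecc_enc B s :=
  flatten (mkseq (fun j => nth [::] book (rs_eval p (emsg B s) j)) (eN B)).
Definition ecc_dec B w :=
  let ys := mkseq (fun j => gdec eL eM book (take eL (drop (j * eL) w))) (eN B) in
  let vals := rs_dec p (eN B + eK B + 2) (eK B) ys in
  mkseq (fun q => nth false (n2b em (nth 0 vals (q %/ em))) (q %% em)) B.

Let a4 : 4 <= a := four_le_pow u1.
Let aa3 : 0 < a * a - 3 * a := aa3_gt0 u1.

Lemma em_gt0 : 0 < em.
Proof. by rewrite /em trunc_log_gt0 /= prime_gt1. Qed.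

Lemma em_le : 2 ^ em <= p.
Proof. by apply: trunc_logP; rewrite ?prime_gt0. Qed.

Lemma eM_gt0 : 0 < eM.
Proof. by have := cdiv_ge em.+1 aa3; rewrite -/eM; case: eM. Qed.

(** Evaluations are arbitrary elements of [F_p], not only those below [2 ^ em]. The inner code
    therefore needs [p < 2 ^ (em + 1)] words, which is why [eM] is computed from [em.+1]. *)
Lemma size_book : p < size book.
Proof.
have := size_gbook_pow u1 eM_gt0; apply: leq_trans.
have h : p < 2 ^ em.+1 by exact: trunc_log_ltn.
apply: (leq_trans h); rewrite leq_exp2l // mulnC; exact: cdiv_ge aa3.
Qed.

Lemma size_bookw v : v < p -> size (nth [::] book v) = eL.
Proof.
move=> h; apply: size_in_allw; apply: (@gbook_sub eL eM).
by apply: mem_nth; exact: ltn_trans h size_book.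
Qed.

Lemma size_ecc_enc B s : size (ecc_enc B s) = elen B.
Proof.
by apply: size_flatten_const => j _; apply: size_bookw; rewrite rs_eval_lt ?prime_gt0.
Qed.

Lemma eN_le B : eN B <= 3 * B.
Proof.
have h1 := @cdiv_leq B em em_gt0; have h2 := @cdiv_leq (eK B) a (ltnW (ltnW (ltnW a4))).
by rewrite /eN /eE; rewrite /eK in h1 h2 *; lia.
Qed.

Lemma eN_E B : eN B <= 3 * a * eE B.
Proof.
have h := @cdiv_ge (eK B) a (ltnW (ltnW (ltnW a4))); rewrite -/(eE B) in h.
have := a4; rewrite /eN; move: (eE B) h; move: a => x; nia.
Qed.

Lemma ecc_correct B s w : size s = B -> 3 * B <= p ->
  6 * (a * a * a) * ham (elen B) (ecc_enc B s) w <= elen B ->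
  ecc_dec B w = s.
Proof.
move=> sB Bp errs.
set msg := emsg B s.
have ms : size msg = eK B by rewrite size_mkseq.
have symlt : forall i, ecc_sym s i < p.
  move=> i; apply: leq_trans em_le.
  have := @b2n_small p (mkseq (fun j => nth false s (i * em + j)) em).
  by rewrite size_mkseq => /(_ em_le).
have msp : forall i, nth 0 msg i < p.
  move=> i; case: (ltnP i (eK B)) => h; first by rewrite nth_mkseq.
  by rewrite nth_default ?ms // prime_gt0.
set ys := mkseq (fun j => gdec eL eM book (take eL (drop (j * eL) w))) (eN B).
pose wrong j := rs_eval p msg j != nth 0 ys j.
have segE : forall j, j < eN B -> take eL (drop (j * eL) (ecc_enc B s)) =
    nth [::] book (rs_eval p msg j).
  move=> j hj; apply: (flatten_seg (f := fun j => nth [::] book (rs_eval p msg j))) => // i _.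
  by apply: size_bookw; rewrite rs_eval_lt ?prime_gt0.
have cost : forall j, j < eN B -> wrong j * eM <=
    2 * ham eL (take eL (drop (j * eL) (ecc_enc B s))) (take eL (drop (j * eL) w)).
  move=> j hj; rewrite segE //; case: (boolP (wrong j)) => // hw; rewrite mul1n leqNgt.
  apply: contra hw => h; rewrite /wrong nth_mkseq //.
  have vb : rs_eval p msg j < size book by apply: ltn_trans size_book; rewrite rs_eval_lt ?prime_gt0.
  by rewrite (gdec_correct vb h) eqxx.
have tot : count wrong (iota 0 (eN B)) * eM <= 2 * ham (elen B) (ecc_enc B s) w.
  rewrite /elen ham_blocks big_distrr /= -sum1_count big_distrl /= big_mkcond /=.
  have -> : iota 0 (eN B) = index_iota 0 (eN B) by rewrite /index_iota subn0.
  rewrite big_mkord; apply: leq_sum => j _.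
  by have := cost j (ltn_ord j); case: (wrong j); rewrite ?mul1n.
have cE : count wrong (iota 0 (eN B)) <= eE B.
  have a0 : 0 < a by exact: ltnW (ltnW (ltnW a4)).
  exact: (ecc_arith a0 eM_gt0 tot (eN_E B) errs).
have dec : rs_dec p (eN B + eK B + 2) (eK B) ys = msg.
  apply: (@rs_correct p _ (eK B) (eE B) (eN B)) => //; last by rewrite size_mkseq.
  exact: leq_trans (eN_le B) Bp.
rewrite /ecc_dec -/ys dec; apply: (@eq_from_nth _ false); rewrite size_mkseq // => q hq.
rewrite nth_mkseq //; have m0 := em_gt0.
have qk : q %/ em < eK B.
  rewrite ltn_divLR //; apply: leq_trans hq _; rewrite -?sB; exact: cdiv_ge.
rewrite /msg /emsg nth_mkseq // /ecc_sym; set c := mkseq _ _.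
have sc : size c = em by rewrite size_mkseq.
rewrite -{1}sc b2nK ?sc ?em_le // nth_mkseq ?ltn_pmod //.
by rewrite -divn_eq.
Qed.

End Ecc.

(** * The concatenated code in polynomial time *)

Definition nextp x := x.+1 + find prime (iota x.+1 (2 * (x + 5) ^ 2)).

Lemma nextp_prime x : prime (nextp x) /\ x < nextp x <= x + 2 * (x + 5) ^ 2.
Proof.
have [q pq /andP [h1 h2]] := prime_between x.
have hp : has prime (iota x.+1 (2 * (x + 5) ^ 2)).
  by apply/hasP; exists q => //; rewrite mem_iota; lia.
have lt : find prime (iota x.+1 (2 * (x + 5) ^ 2)) < 2 * (x + 5) ^ 2.
  by rewrite -{2}(size_iota x.+1 (2 * (x + 5) ^ 2)) -has_find.
split; last by rewrite /nextp; lia.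
by have := nth_find 0 hp; rewrite nth_iota.
Qed.

Lemma fp_foldl_nat A X {ra : rep A} {rx : rep X} (l : A -> seq X) (s0 : A -> nat)
    (f : A -> nat -> X -> nat) (c : A -> nat) :
  fp l -> fp s0 -> fp (fun p : A * nat * X => f p.1.1 p.1.2 p.2) ->
  fp c -> (forall a s x, f a s x <= c a) -> fp (fun a => foldl (f a) (s0 a) (l a)).
Proof.
move=> hl hs hf hc le; apply: fp_foldl_reset => //.
exists (fun p => 2 * c p.1 + 1); last by move=> a s x; rewrite sz_nat /=; have := le a s x; lia.
apply: psz_add (psz_mul (psz_const _ 2) _) (psz_const _ 1).
by apply: pbound_nat; fpa.
Qed.

Section F1.
Context {A : Type} {ra : rep A}.
Implicit Types n m x : A -> nat.

Lemma fp_cdiv n m : fp n -> fp m -> fp (fun a => cdiv (n a) (m a)).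
Proof. by move=> hn hm; rewrite /cdiv; fpa. Qed.

Lemma fp_half n : fp n -> fp (fun a => half (n a)).
Proof. by move=> h; apply: fp_ext (fp_divn h (fp_const 2)) => a; rewrite divn2. Qed.

Lemma fp_dvdn n m : fp n -> fp m -> fp (fun a => dvdn (n a) (m a)).
Proof. by move=> hn hm; rewrite /dvdn; fpa. Qed.
End F1.
#[global] Hint Resolve fp_cdiv fp_half fp_dvdn : fp.

Section F2.
Context {A : Type} {ra : rep A}.
Implicit Types n m x : A -> nat.

Lemma fp_prime n : fp n -> fp (fun a => prime (n a)).
Proof.
move=> h; apply: (fp_ext (g := fun a => (1 < n a) && all (fun d => ~~ (d %| n a)) (iota 2 (n a - 2)))); last fpa.
move=> a; apply/primeP/andP => [[p1 h1]|[p1 /allP h1]]; split=> //.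
  apply/allP => d; rewrite mem_iota => hd; apply/negP => /h1 /= /pred2P [] e; lia.
move=> d dv; have d0 : 0 < d by apply: dvdn_gt0 dv; lia.
have dl := dvdn_leq (ltnW p1) dv; apply/pred2P.
case: (ltngtP d 1) => [|d1|->]; [lia| |by left].
case: (ltngtP d (n a)) => [dn||->]; [|lia|by right].
have := h1 d; rewrite mem_iota dv => /(_ _) h2; exfalso; apply: notF; apply: h2; lia.
Qed.

Lemma fp_iter_half n m : fp n -> fp m -> fp (fun a => iter (n a) half (m a)).
Proof.
move=> hn hm; apply: (fp_iter_add (f := fun _ => half)) => //; first fpa.
exists (fun=> 0); first exact: psz_const.
by move=> _ s; rewrite !sz_nat; lia.
Qed.

(** Powers of two are exponential in the unary input, so they are computed up to a cap. *)
Definition powc c i := iter i (fun z => minn c (2 * z)) 1.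

Lemma powcE c i : 0 < c -> powc c i = minn c (2 ^ i).
Proof.
move=> c0; elim: i => [|i IH]; first by rewrite /powc /= expn0; lia.
by rewrite /powc iterS -/(powc c i) IH expnS; lia.
Qed.

Lemma fp_powc n m : fp n -> fp m -> fp (fun a => powc (n a) (m a)).
Proof.
move=> hn hm; rewrite /powc; apply: (fp_iter (f := fun a z => minn (n a) (2 * z))) => //; try fpa.
exists (fun a => 2 * (n a).+1 + 1).
  apply: psz_add (psz_mul (psz_const _ 2) _) (psz_const _ 1).
  by apply: pbound_nat; fpa.
by move=> a [|i] _; rewrite sz_nat /=; lia.
Qed.
End F2.
#[global] Hint Resolve fp_prime fp_iter_half fp_powc : fp.

Section F3.
Context {A : Type} {ra : rep A}.
Implicit Types n m x : A -> nat.

Lemma fp_lg n : fp n -> fp (fun a => trunc_log 2 (n a)).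
Proof.
move=> h; apply: (fp_ext (g := fun a => count (fun i => powc (n a).+1 i.+1 <= n a) (iota 0 (n a)))); last fpa.
move=> a; case: (posnP (n a)) => [->|n0]; first by rewrite trunc_log0.
have le : trunc_log 2 (n a) <= n a.
  have := trunc_logP (isT : 1 < 2) n0; have := ltn_expl (trunc_log 2 (n a)) (isT : 1 < 2); lia.
rewrite -size_filter (@eq_filter _ _ (fun q => q < trunc_log 2 (n a))).
  rewrite (_ : [seq q <- _ | _] = iota 0 (trunc_log 2 (n a))) ?size_iota //.
  exact: (filter_iota_ltn 0 le).
move=> q; change ((powc (n a).+1 q.+1 <= n a) = (q < trunc_log 2 (n a))).
rewrite powcE // geq_min ltnn orFb.
apply/idP/idP => hq.
  exact: (trunc_log_max (isT : 1 < 2) hq).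
apply: leq_trans (trunc_logP (isT : 1 < 2) n0); by rewrite leq_exp2l.
Qed.

Lemma fp_nextp n : fp n -> fp (fun a => nextp (n a)).
Proof. by move=> h; rewrite /nextp; fpa. Qed.

Lemma fp_ham n (s t : A -> seq bool) : fp n -> fp s -> fp t -> fp (fun a => ham (n a) (s a) (t a)).
Proof. by move=> hn hs ht; rewrite /ham; fpa. Qed.

Lemma fp_n2b n m : fp n -> fp m -> fp (fun a => n2b (n a) (m a)).
Proof. by move=> hn hm; rewrite /n2b; fpa. Qed.

Lemma fp_b2n n (s : A -> seq bool) : fp n -> fp s -> fp (fun a => b2n (n a) (s a)).
Proof.
move=> hn hs; rewrite /b2n.
apply: (fp_foldl_nat (f := fun a acc b => minn (n a) (nat_of_bool b + 2 * acc)) (c := n)) => //; try fpa.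
by move=> a s' x; exact: geq_minl.
Qed.

Lemma fp_smod n m x : fp n -> fp m -> fp x -> fp (fun a => smod (n a) (m a) (x a)).
Proof. by move=> hn hm hx; rewrite /smod; fpa. Qed.
End F3.
#[global] Hint Resolve fp_lg fp_nextp fp_ham fp_n2b fp_b2n fp_smod : fp.

Lemma nextp_gt0 x : 0 < nextp x. Proof. by rewrite /nextp. Qed.

Section F4.
Context {A : Type} {ra : rep A}.
Variable X : A -> nat.
Hypothesis hX : fp X.
Notation p a := (nextp (X a)).

Lemma fp_rs_eval (s : A -> seq nat) x : fp s -> fp x ->
  fp (fun a => rs_eval (p a) (s a) (x a)).
Proof.
move=> hs hx; rewrite /rs_eval.
apply: (fp_foldl_nat (f := fun a acc c => (c + x a * acc) %% p a) (c := fun a => p a)); try fpa.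
by move=> a s' c; rewrite ltnW // ltn_pmod ?nextp_gt0.
Qed.

Lemma fp_rs_comb (L : A -> nat) c1 (s1 : A -> seq nat) c2 (s2 : A -> seq nat) :
  fp L -> fp c1 -> fp s1 -> fp c2 -> fp s2 ->
  fp (fun a => rs_comb (p a) (L a) (c1 a) (s1 a) (c2 a) (s2 a)).
Proof. by move=> *; rewrite /rs_comb; fpa. Qed.

Lemma fp_rs_mulx (L : A -> nat) c1 (s1 : A -> seq nat) :
  fp L -> fp c1 -> fp s1 -> fp (fun a => rs_mulx (p a) (L a) (c1 a) (s1 a)).
Proof. by move=> *; rewrite /rs_mulx; fpa. Qed.
End F4.
#[global] Hint Resolve fp_rs_eval fp_rs_comb fp_rs_mulx : fp.

Section F5.
Context {A : Type} {ra : rep A}.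
Variable X : A -> nat.
Hypothesis hX : fp X.
Notation p a := (nextp (X a)).

Lemma fp_rs_disc (f : A -> seq nat * seq nat * nat) x y : fp f -> fp x -> fp y ->
  fp (fun a => rs_disc (p a) (f a) (x a) (y a)).
Proof. by move=> *; rewrite /rs_disc; fpa. Qed.
End F5.
#[global] Hint Resolve fp_rs_disc : fp.

Lemma sz_mkseq_mod p f L : 0 < p -> (forall i, f i < p) -> sz (mkseq f L) <= L * (2 * p + 2) + 1.
Proof.
move=> p0 h; have := @sz_le _ rep_nat (mkseq f L) (2 * p + 1); rewrite size_mkseq.
move=> H; apply: leq_trans (H _) _; last by lia.
move=> i x0 hi; rewrite nth_mkseq // sz_nat; have := h i; lia.
Qed.

Section F6.
Context {A : Type} {ra : rep A}.
Variable X : A -> nat.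
Hypothesis hX : fp X.
Notation p a := (nextp (X a)).

Lemma fp_rs_step (L : A -> nat) st ay : fp L -> fp st -> fp ay ->
  fp (fun a => rs_step (p a) (L a) (st a) (ay a)).
Proof.
move=> hL hst hay; rewrite /rs_step /=.
have hf : fp (fun a => if (st a).1.2 <= (st a).2.2 then (st a).1 else (st a).2) by fpa.
have hg : fp (fun a => if (st a).1.2 <= (st a).2.2 then (st a).2 else (st a).1) by fpa.
move: hf hg; set f := fun a => _; set g := fun a => _ => hf hg.
change (fp (fun a => if rs_disc (p a) (f a) (ay a).1 (ay a).2 == 0
  then (f a, (rs_mulx (p a) (L a) (ay a).1 (g a).1.1, rs_mulx (p a) (L a) (ay a).1 (g a).1.2, (g a).2.+1))
  else ((rs_mulx (p a) (L a) (ay a).1 (f a).1.1, rs_mulx (p a) (L a) (ay a).1 (f a).1.2, (f a).2.+1),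
   (rs_comb (p a) (L a) (rs_disc (p a) (f a) (ay a).1 (ay a).2) (g a).1.1
       (rs_disc (p a) (g a) (ay a).1 (ay a).2) (f a).1.1,
    rs_comb (p a) (L a) (rs_disc (p a) (f a) (ay a).1 (ay a).2) (g a).1.2
       (rs_disc (p a) (g a) (ay a).1 (ay a).2) (f a).1.2, (g a).2)))).
move: f g hf hg => f g hf hg.
fpa.
Qed.
End F6.
#[global] Hint Resolve fp_rs_step : fp.

Section F7.
Context {A : Type} {ra : rep A}.
Variable X : A -> nat.
Hypothesis hX : fp X.
Notation p a := (nextp (X a)).

Lemma fp_rs_key (L K : A -> nat) ys : fp L -> fp K -> fp ys ->
  fp (fun a => rs_key (p a) (L a) (K a) (ys a)).
Proof.
move=> hL hK hys; rewrite /rs_key /=.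
have h: fp (fun a => foldl (rs_step (p a) (L a)) (([:: 1], [::], 0), ([::], [:: 1], (K a).-1))
     (map (fun i => (i, nth 0 (ys a) i)) (iota 0 (size (ys a))))); last first.
  move: h; set st := fun a => foldl _ _ _ => h.
  change (fp (fun a => if (st a).1.2 <= (st a).2.2 then (st a).1.1 else (st a).2.1)).
  by move: st h => st h; fpa.
apply: (fp_foldl (f := fun a st ay => rs_step (p a) (L a) st ay)); try fpa.
pose W a := L a * (2 * p a + 2) + 20.
pose V a := 2 * (K a + size (ys a)) + 20.
exists (fun a => 10 * (W a + V a) + 50).
  have pW : pbound W by apply: pbound_nat; rewrite /W; fpa.
  have pV : pbound V by apply: pbound_nat; rewrite /V; fpa.
  by apply: psz_add (psz_mul (psz_const _ _) (psz_add pW pV)) (psz_const _ _).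
move=> a l1 l2 e.
have sl : size l1 <= size (ys a).
  by have := congr1 size e; rewrite size_map size_iota size_cat => ->; exact: leq_addr.
pose szl (s : seq nat) := size (ser (@tr _ (rep_seq rep_nat) s)).
pose okc i (f : seq nat * seq nat * nat) := [/\ szl f.1.1 <= W a, szl f.1.2 <= W a & f.2 <= K a + i].
have H: okc (size l1) (foldl (rs_step (p a) (L a)) ([:: 1], [::], 0, ([::], [:: 1], (K a).-1)) l1).1 /\
  okc (size l1) (foldl (rs_step (p a) (L a)) ([:: 1], [::], 0, ([::], [:: 1], (K a).-1)) l1).2.
  have w1 : szl [:: 1] <= W a by rewrite /szl sz_cons sz_nat sz_nil /W; lia.
  have w0 : szl ([::] : seq nat) <= W a by rewrite /szl sz_nil /W; lia.
  have wm : forall f, (forall i, f i < p a) -> szl (mkseq f (L a)) <= W a.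
    by move=> f hf; apply: leq_trans (sz_mkseq_mod _ _ hf) _; rewrite ?nextp_gt0 // /W; lia.
  elim/last_ind: l1 {e sl} => [|l x]; first by split; split=> //=; lia.
  rewrite foldl_rcons size_rcons; move: (foldl _ _ _) => st [o1 o2].
  have o1' : okc (size l).+1 st.1 by case: o1 => ? ? ?; split=> //; lia.
  have o2' : okc (size l).+1 st.2 by case: o2 => ? ? ?; split=> //; lia.
  have lt : forall z, z %% p a < p a by move=> z; rewrite ltn_pmod ?nextp_gt0.
  rewrite /rs_step; case: ifP => _; case: ifP => _ /=; split=> //;
    case: o1 o2 => ? ? ? [? ? ?]; split=> /=; try (by apply: wm => i; apply: lt); lia.
move: H sl; move: (foldl _ _ _) => -[[[n1 d1] e1] [[n2 d2] e2]] [[a1 a2 a3] [b1 b2 b3]] sl.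
rewrite /szl in a1 a2 b1 b2; cbn [fst snd] in *.
by rewrite !sz_pair !sz_nat /V; lia.
Qed.

Lemma fp_rs_quo (K : A -> nat) n d : fp K -> fp n -> fp d ->
  fp (fun a => rs_quo (p a) (K a) (n a) (d a)).
Proof.
move=> hK hn hd; rewrite /rs_quo /=.
have hv : fp (fun a => find (fun c => c != 0) (d a)) by fpa.
move: hv; set v := fun a => find _ _ => hv.
have hiv : fp (fun a => find (fun x => (x * nth 0 (d a) (v a)) %% p a == 1) (iota 0 (p a))) by move: v hv => v hv; fpa.
move: hiv; set iv := fun a => find _ (iota _ _) => hiv.
change (fp (fun a => foldl (fun acc i => rcons acc ((smod (p a) (nth 0 (n a) (v a + i))
    (foldl (fun s j => (s + nth 0 acc j * nth 0 (d a) (v a + i - j)) %% p a) 0 (iota 0 i)) * iv a) %% p a))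
    [::] (iota 0 (K a)))).
move: v iv hv hiv => v iv hv hiv.
have inner : fp (fun q : A * seq nat * nat => foldl (fun s j => (s + nth 0 q.1.2 j *
    nth 0 (d q.1.1) (v q.1.1 + q.2 - j)) %% p q.1.1) 0 (iota 0 q.2)).
  apply: (fp_foldl_nat (f := fun (q : A * seq nat * nat) s j => (s + nth 0 q.1.2 j *
    nth 0 (d q.1.1) (v q.1.1 + q.2 - j)) %% p q.1.1) (c := fun q : A * seq nat * nat => p q.1.1)); try fpa.
  by move=> q s x; rewrite ltnW // ltn_pmod ?nextp_gt0.
apply: (fp_foldl_add (f := fun a acc i => rcons acc ((smod (p a) (nth 0 (n a) (v a + i))
    (foldl (fun s j => (s + nth 0 acc j * nth 0 (d a) (v a + i - j)) %% p a) 0 (iota 0 i)) * iv a) %% p a))).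
- fpa.
- fpa.
- apply: fp_rcons; first fpa.
  apply: fp_modn; last fpa; apply: fp_muln; last fpa; apply: fp_smod; [fpa|fpa|exact: inner].
- exists (fun q => 2 * p q.1 + 3).
    by apply: psz_add (psz_mul (psz_const _ 2) _) (psz_const _ 3); apply: pbound_nat; fpa.
  move=> a s x; rewrite -cats1; set y := _ %% _.
  have hy : y < p a by rewrite ltn_pmod ?nextp_gt0.
  have := @sz_cat _ rep_nat s [:: y]; rewrite sz_cons sz_nat sz_nil /=; lia.
Qed.
End F7.
#[global] Hint Resolve fp_rs_key fp_rs_quo : fp.

Section F8.
Context {A : Type} {ra : rep A}.
Variables (u : nat) (X : A -> nat).
Hypotheses (u1 : 1 < u) (hX : fp X).
Notation p a := (nextp (X a)).

Lemma fp_rs_dec (L K : A -> nat) ys : fp L -> fp K -> fp ys ->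
  fp (fun a => rs_dec (p a) (L a) (K a) (ys a)).
Proof. by move=> *; rewrite /rs_dec /=; fpa. Qed.

Lemma fp_em : fp (fun a => em (p a)).
Proof. by rewrite /em; fpa. Qed.

Lemma fp_eM : fp (fun a => eM u (p a)).
Proof. by rewrite /eM /em; fpa. Qed.

Lemma fp_eL : fp (fun a => eL u (p a)).
Proof. by rewrite /eL /eM /em; fpa. Qed.

End F8.
#[global] Hint Resolve fp_rs_dec fp_em fp_eM fp_eL : fp.
#[global] Hint Extern 0 (is_true (1 < _)) => assumption : fp.

Section F8b.
Context {A : Type} {ra : rep A}.
Variables (u : nat) (X : A -> nat).
Hypotheses (u1 : 1 < u) (hX : fp X).
Notation p a := (nextp (X a)).

Lemma eL_le q : eL u q <= 4 * em q + (4 + 4 * (2 ^ u * 2 ^ u)).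
Proof.
have h := cdiv_le (em q).+1 (aa3_gt0 u1); rewrite -/(eM u q) in h.
have h4 := four_le_pow u1; rewrite /eL; move: (eM u q) h h4; move: (2 ^ u) => x M h h4.
have e : x * x <= 4 * (x * x - 3 * x) by nia.
apply: (@leq_trans (4 * (M * (x * x - 3 * x)))).
  by rewrite [M * _]mulnC mulnA leq_mul2r e orbT.
by lia.
Qed.

(** The inner length is logarithmic in [q], so listing all words of that length, as the greedy
    construction does, stays polynomial. *)
Lemma pow_eL q : 0 < q -> 2 ^ eL u q <= 2 ^ (4 + 4 * (2 ^ u * 2 ^ u)) * q ^ 4.
Proof.
move=> q0; apply: (@leq_trans (2 ^ (4 * em q + (4 + 4 * (2 ^ u * 2 ^ u))))).
  by rewrite leq_exp2l // eL_le.
rewrite expnD mulnC leq_mul2l; apply/orP; right.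
by rewrite [4 * em q]mulnC expnM leq_exp2r //; exact: trunc_logP.
Qed.

Lemma sz_allw i : sz (allw i) <= 2 ^ i * (4 * i + 2) + 1.
Proof.
have := @sz_le _ (rep_seq rep_bool) (allw i) (4 * i + 1); rewrite size_allw => H; apply: leq_trans (H _) _; last by lia.
move=> j x0 hj; apply: leq_trans (sz_bits _) _.
by rewrite (size_in_allw (L := i)) // (set_nth_default [::]) ?mem_nth ?size_allw.
Qed.

Lemma fp_allw : fp (fun a => allw (eL u (p a))).
Proof.
apply: (fp_ext (g := fun a => iter (eL u (p a)) (fun ws => map (cons false) ws ++ map (cons true) ws) [:: [::]])).
  by move=> a; elim: (eL u (p a)) => //= n ->.
have E : forall i, iter i (fun ws => map (cons false) ws ++ map (cons true) ws) [:: [::]] = allw i.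
  by elim=> //= i ->.
apply: (fp_iter (f := fun _ ws => map (cons false) ws ++ map (cons true) ws)); [exact: fp_eL|fpa|fpa|].
exists (fun a => 2 ^ (4 + 4 * (2 ^ u * 2 ^ u)) * p a ^ 4 * (4 * eL u (p a) + 2) + 1).
  have pp : pbound (fun a => p a) by apply: pbound_nat; fpa.
  have pL : pbound (fun a => eL u (p a)) by apply: pbound_nat; fpa.
  by repeat first [assumption|apply: psz_const|apply: psz_add|apply: psz_mul|apply: psz_exp].
move=> a i hi; rewrite E; apply: leq_trans (sz_allw i) _; rewrite leq_add2r.
apply: leq_mul; last by lia.
by apply: leq_trans (pow_eL (nextp_gt0 _)); rewrite leq_exp2l.
Qed.

Lemma fp_book : fp (fun a => book u (p a)).
Proof.
have hA := fp_allw; rewrite /book /gbook.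
apply: (fp_foldl_add (f := fun a acc w => if all (fun c => eM u (p a) <= ham (eL u (p a)) c w) acc
   then rcons acc w else acc)) => //; try fpa.
exists (fun q => sz q.2 + 2); first exact: psz_add pbound_snd (psz_const _ _).
move=> a s x; case: ifP => _; last by lia.
by rewrite -cats1; have := @sz_cat _ (rep_seq rep_bool) s [:: x]; rewrite sz_cons sz_nil /=; lia.
Qed.
End F8b.
#[global] Hint Resolve fp_book : fp.

Section F9.
Context {A : Type} {ra : rep A}.
Variables (u : nat) (X : A -> nat).
Hypotheses (u1 : 1 < u) (hX : fp X).
Notation p a := (nextp (X a)).

Lemma fp_eK B : fp B -> fp (fun a => eK (p a) (B a)).
Proof. by move=> h; rewrite /eK; fpa. Qed.

Lemma fp_eN B : fp B -> fp (fun a => eN u (p a) (B a)).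
Proof. by move=> h; have h2 := fp_eK h; rewrite /eN /eE; fpa. Qed.

Lemma fp_elen B : fp B -> fp (fun a => elen u (p a) (B a)).
Proof. by move=> h; have h2 := fp_eN h; rewrite /elen; fpa. Qed.
End F9.
#[global] Hint Resolve fp_eK fp_eN fp_elen : fp.

Section F10.
Context {A : Type} {ra : rep A}.
Variables (u : nat) (X : A -> nat).
Hypotheses (u1 : 1 < u) (hX : fp X).
Notation p a := (nextp (X a)).

Lemma fp_emsg B s : fp B -> fp s -> fp (fun a => emsg (p a) (B a) (s a)).
Proof. by move=> hB hs; rewrite /emsg /ecc_sym; fpa. Qed.
End F10.
#[global] Hint Resolve fp_emsg : fp.

Section F11.
Context {A : Type} {ra : rep A}.
Variables (u : nat) (X : A -> nat).
Hypotheses (u1 : 1 < u) (hX : fp X).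
Notation p a := (nextp (X a)).

Lemma fp_ecc_enc B s : fp B -> fp s -> fp (fun a => ecc_enc u (p a) (B a) (s a)).
Proof.
by move=> hB hs; rewrite /ecc_enc; fpa.
Qed.

Lemma fp_ecc_dec B w : fp B -> fp w -> fp (fun a => ecc_dec u (p a) (B a) (w a)).
Proof.
move=> hB hw; rewrite /ecc_dec /=.
have hy : fp (fun a => mkseq (fun j => gdec (eL u (p a)) (eM u (p a)) (book u (p a))
  (take (eL u (p a)) (drop (j * eL u (p a)) (w a)))) (eN u (p a) (B a))).
  by rewrite /gdec; fpa.
have hd : fp (fun a => rs_dec (p a) (eN u (p a) (B a) + eK (p a) (B a) + 2) (eK (p a) (B a))
  (mkseq (fun j => gdec (eL u (p a)) (eM u (p a)) (book u (p a))
  (take (eL u (p a)) (drop (j * eL u (p a)) (w a)))) (eN u (p a) (B a)))) by fpa.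
move: hd; set V := fun a => rs_dec _ _ _ _ => hd.
change (fp (fun a => mkseq (fun q => nth false (n2b (em (p a)) (nth 0 (V a) (q %/ em (p a)))) (q %% em (p a))) (B a))).
by move: V hd => V hd; fpa.
Qed.
End F11.
#[global] Hint Resolve fp_ecc_enc fp_ecc_dec : fp.

(** * The code *)

Section Code.
Variables (GenH : ppt) (H : dpt) (u : nat).
Hypothesis u1 : 1 < u.
Notation a := (2 ^ u).

(* The output length of the hash function, read off from the seed that [GenH]
   outputs when all its coins are [false]. *)
Definition ellf l := size (apply H [:: value (output GenH [:: unary l]); [::]]).

(* Also on seeds that are not outputs of [GenH], the length is [ellf l]. *)
Definition hsh l s x := mkseq (nth false (apply H [:: s; x])) (ellf l).

(* [ct] is the parameter t, [bsz] the number of message bits of a block, [nb] the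
   number of blocks, [hgt] the height of the tree, [pay] the number of bits of a
   block with its path, [cp] the size of the field, [blk] and [rt] the encoded
   lengths of a block and of the root, and [2 ^ ce] the number of copies. *)
Definition ct l k := (trunc_log 2 (l + k)).+1.
Definition plain l k := k <= (ellf l).+1 * ct l k ^ 4.
Definition bsz l k := if plain l k then k else (ellf l).+1 * ct l k ^ 2.
Definition nb l k := cdiv k (bsz l k).
Definition hgt l k := if plain l k then 0 else (trunc_log 2 (nb l k)).+1.
Definition pay l k := bsz l k + hgt l k * (2 * ellf l).
Definition cX l k := 4 * (pay l k + ellf l + k + l) + 4.
Definition cp l k := nextp (cX l k).
Definition blk l k := elen u (cp l k) (pay l k).
Definition nblk l k := nb l k * blk l k.
Definition rt l k := elen u (cp l k) (ellf l).
Definition ce l k := trunc_log 2 (cdiv (nblk l k) a %/ rt l k).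
Definition ncop l k := if plain l k then 0 else 2 ^ ce l k.
Definition rlen l k := maxn (cdiv (nblk l k) a) (ncop l k * rt l k).
Definition clen l k := nblk l k + rlen l k.

Section Enc.
Variables (l : nat) (s x : bits).
Let k := size x.

Definition dat j := mkseq (fun q => nth false x (j * bsz l k + q)) (bsz l k).
Definition node (v : seq bits) j := nth (nseq (ellf l) false) v j.
Definition pairn (v : seq bits) j := node v (2 * j) ++ node v (2 * j).+1.
(* Every level has [nb] entries, of which only a prefix belongs to the tree;
   missing children count as strings of zeros. *)
Definition lev i := iter i (fun v => mkseq (fun j => hsh l s (pairn v j)) (nb l k))
  (mkseq (fun j => hsh l s (dat j)) (nb l k)).
Definition pathn j := flatten (mkseq (fun i => pairn (lev i) (iter i.+1 half j)) (hgt l k)).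
Definition root := node (lev (hgt l k)) 0.
Definition payld j := dat j ++ pathn j.
Definition encf := flatten (mkseq (fun j => ecc_enc u (cp l k) (pay l k) (payld j)) (nb l k))
  ++ flatten (mkseq (fun=> ecc_enc u (cp l k) (ellf l) root) (ncop l k))
  ++ nseq (rlen l k - ncop l k * rt l k) false.
End Enc.

Section Dec.
Variables (l k : nat) (s : bits).

(* The strings hashed along the path in [y]: the data, then the pair of siblings
   at each level. *)
Definition inpn (y : bits) i := if i is i'.+1 then
   take (2 * ellf l) (drop (bsz l k + i' * (2 * ellf l)) y) else take (bsz l k) y.
Definition veri j y := all (fun i => hsh l s (inpn y i) ==
   (if odd (iter i half j) then drop (ellf l) (inpn y i.+1) else take (ellf l) (inpn y i.+1)))
   (iota 0 (hgt l k)).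
Definition vroot y := hsh l s (inpn y (hgt l k)).

Variable i : nat.
Definition ndc := if plain l k then 0 else ct l k ^ 2 * ce l k.
Definition cidx (c : bits) r := b2n (ncop l k) (take (ce l k) (drop (r * ce l k) c)).
(** The decoder is non-adaptive: its coins fix all positions at once, so it is a composition of
    tossing, querying and a deterministic function of the answers. *)
Definition posf (c : bits) := iota (i %/ bsz l k * blk l k) (blk l k) ++
  (if plain l k then [::] else
   flatten (mkseq (fun r => iota (nblk l k + cidx c r * rt l k) (rt l k)) (ct l k ^ 2))).
(** The empty output stands for the symbol bottom. In the plain case there is no tree, and the
    decoded block is trusted. *)
Definition outf (ans : bits) :=
  let y := ecc_dec u (cp l k) (pay l k) (take (blk l k) ans) in
  let b := [:: nth false y (i %% bsz l k)] in
  if plain l k then b else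
  if veri (i %/ bsz l k) y && (ct l k ^ 2 < 2 * count (fun r =>
       ecc_dec u (cp l k) (ellf l) (take (rt l k) (drop (blk l k + r * rt l k) ans)) == vroot y)
       (iota 0 (ct l k ^ 2)))
  then b else [::].
End Dec.

Definition extf l k s (y y' : bits) :=
  let i := find (fun i => (inpn l k y i != inpn l k y' i) &&
      (hsh l s (inpn l k y i) == hsh l s (inpn l k y' i))) (iota 0 (hgt l k).+1) in
  (inpn l k y i, inpn l k y' i).

Definition colf l (s x w : bits) j :=
  extf l (size x) s (payld l s x j)
    (ecc_dec u (cp l (size x)) (pay l (size x)) (take (blk l (size x)) (drop (j * blk l (size x)) w))).

Lemma cp_prime l k : prime (cp l k).
Proof. by case: (nextp_prime (cX l k)). Qed.

Lemma cp_gt l k : cX l k < cp l k.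
Proof. by case: (nextp_prime (cX l k)) => _ /andP []. Qed.

Lemma size_hsh l s x : size (hsh l s x) = ellf l. Proof. by rewrite size_mkseq. Qed.

Lemma nb_bsz l k : k <= nb l k * bsz l k.
Proof.
by case: (posnP k) => [->//|k0]; apply: cdiv_ge; rewrite /bsz; case: ifP => // _.
Qed.

Lemma bsz_gt0 l k : 0 < k -> 0 < bsz l k.
Proof. by move=> k0; rewrite /bsz; case: ifP => // _; rewrite muln_gt0 expn_gt0. Qed.

Lemma idx_lt l k i : i < k -> i %/ bsz l k < nb l k.
Proof.
by move=> ik; rewrite ltn_divLR; [exact: leq_trans ik (nb_bsz _ _) | apply: bsz_gt0; case: k ik].
Qed.

Section EncLemmas.
Variables (l : nat) (s x : bits).
Let k := size x.

Lemma size_node v j : (forall z, z \in v -> size z = ellf l) -> size (node l v j) = ellf l.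
Proof.
move=> h; rewrite /node; case: (ltnP j (size v)) => hj; first by apply: h; exact: mem_nth.
by rewrite nth_default // size_nseq.
Qed.

Lemma size_lev i z : z \in lev l s x i -> size z = ellf l.
Proof. by case: i => [|i] /mapP [j _ ->]; rewrite size_hsh. Qed.

Lemma size_pairn i j : size (pairn l (lev l s x i) j) = 2 * ellf l.
Proof. by rewrite size_cat !size_node; [lia| |]; exact: size_lev. Qed.

Lemma size_dat j : size (dat l x j) = bsz l k. Proof. by rewrite size_mkseq. Qed.

Lemma size_pathn j : size (pathn l s x j) = hgt l k * (2 * ellf l).
Proof. by apply: size_flatten_const => i _; exact: size_pairn. Qed.

Lemma size_payld j : size (payld l s x j) = pay l k.
Proof. by rewrite size_cat size_dat size_pathn. Qed.

Lemma size_root : size (root l s x) = ellf l.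
Proof. by apply: size_node => z; exact: size_lev. Qed.

Lemma size_eblk j : size (ecc_enc u (cp l k) (pay l k) (payld l s x j)) = blk l k.
Proof. by apply: size_ecc_enc; [exact: u1 | exact: cp_prime]. Qed.

Lemma size_eroot : size (ecc_enc u (cp l k) (ellf l) (root l s x)) = rt l k.
Proof. by apply: size_ecc_enc; [exact: u1 | exact: cp_prime]. Qed.

Lemma size_encf : size (encf l s x) = clen l k.
Proof.
rewrite !size_cat size_nseq (size_flatten_const (L := blk l k)); last by move=> j _; exact: size_eblk.
rewrite (size_flatten_const (L := rt l k)); last by move=> j _; exact: size_eroot.
by rewrite subnKC // leq_maxr.
Qed.

Lemma encf_blk j : j < nb l k ->
  take (blk l k) (drop (j * blk l k) (encf l s x)) = ecc_enc u (cp l k) (pay l k) (payld l s x j).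
Proof.
exact: (flatten_seg_cat (f := fun j => ecc_enc u (cp l k) (pay l k) (payld l s x j)) _ (fun i _ => size_eblk i)).
Qed.

Lemma encf_cop r : r < ncop l k ->
  take (rt l k) (drop (nblk l k + r * rt l k) (encf l s x)) = ecc_enc u (cp l k) (ellf l) (root l s x).
Proof.
move=> hr; rewrite /encf addnC -drop_drop drop_size_cat; last first.
  by rewrite (size_flatten_const (L := blk l k)) // => i _; exact: size_eblk.
exact: (flatten_seg_cat (f := fun=> ecc_enc u (cp l k) (ellf l) (root l s x)) _ (fun _ _ => size_eroot)).
Qed.

Lemma inpn0 j : inpn l k (payld l s x j) 0 = dat l x j.
Proof. by rewrite /inpn /payld take_size_cat // size_dat. Qed.

Lemma inpnS j i : i < hgt l k ->
  inpn l k (payld l s x j) i.+1 = pairn l (lev l s x i) (iter i.+1 half j).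
Proof.
move=> hi; rewrite /inpn /payld addnC -drop_drop drop_size_cat ?size_dat //.
by apply: (flatten_seg (f := fun i => pairn l (lev l s x i) (iter i.+1 half j))) => // i' _; exact: size_pairn.
Qed.

Lemma iter_half_le i j : iter i half j <= j.
Proof. by elim: i => //= i IH; lia. Qed.

Lemma hsh_inpn j i : j < nb l k -> i <= hgt l k ->
  hsh l s (inpn l k (payld l s x j) i) = node l (lev l s x i) (iter i half j).
Proof.
move=> hj; case: i => [|i] hi.
  by rewrite inpn0 /node /lev /= nth_mkseq.
rewrite inpnS // /node /lev iterS -/(lev l s x i) nth_mkseq //.
exact: leq_ltn_trans (iter_half_le i.+1 _) hj.
Qed.

Lemma veri_payld j : j < nb l k -> veri l k s j (payld l s x j).
Proof.
move=> hj; apply/allP => i; rewrite mem_iota => /andP [_ hi].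
have hi' := ltnW hi; rewrite hsh_inpn // inpnS // /pairn.
have e := odd_double_half (iter i half j); rewrite -mul2n in e; rewrite iterS.
case: ifP => o; rewrite o in e.
  by rewrite drop_size_cat ?(size_node _ (@size_lev i)) // -add1n e.
by rewrite take_size_cat ?(size_node _ (@size_lev i)) // -{1}e.
Qed.

Lemma iter_half_small i j : j < 2 ^ i -> iter i half j = 0.
Proof.
elim: i j => [|i IH] j; first by rewrite expn0; case: j.
by rewrite iterSr expnS => h; apply: IH; lia.
Qed.

Lemma vroot_payld j : j < nb l k -> ~~ plain l k -> vroot l k s (payld l s x j) = root l s x.
Proof.
move=> hj np; rewrite /vroot hsh_inpn // iter_half_small //.
by apply: ltn_trans hj _; rewrite /hgt (negPf np); exact: trunc_log_ltn.
Qed.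

End EncLemmas.

(** Descend from the common root value. If no level had a collision, equal hashes would force equal
    hashed strings, and these contain the hash of the level below; so even the data would agree. *)
Lemma extf_correct l k s j y y' : veri l k s j y -> veri l k s j y' ->
  vroot l k s y = vroot l k s y' -> take (bsz l k) y != take (bsz l k) y' ->
  (extf l k s y y').1 != (extf l k s y y').2 /\
  hsh l s (extf l k s y y').1 = hsh l s (extf l k s y y').2.
Proof.
move=> /allP v1 /allP v2 vr ne; rewrite /extf; set P := fun i => _ && _.
suff hP : has P (iota 0 (hgt l k).+1).
  have := nth_find 0 hP; rewrite nth_iota; last by rewrite -[X in _ < X](size_iota 0) -has_find.
  by rewrite add0n => /andP [h1 /eqP h2].
apply/negPn/negP => /hasPn no.
have eq: forall d, d <= hgt l k -> inpn l k y (hgt l k - d) = inpn l k y' (hgt l k - d).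
  have key: forall i, i <= hgt l k -> hsh l s (inpn l k y i) = hsh l s (inpn l k y' i) ->
     inpn l k y i = inpn l k y' i.
    move=> i hi e; have := no i; rewrite mem_iota ltnS hi => /(_ isT).
    by rewrite /P e eqxx andbT negbK => /eqP.
  elim=> [|d IH] hd; first by rewrite subn0; apply: key.
  have e := IH (ltnW hd).
  have m : hgt l k - d.+1 \in iota 0 (hgt l k) by rewrite mem_iota; lia.
  have sS : (hgt l k - d.+1).+1 = hgt l k - d by lia.
  apply: key; first by lia.
  by have /eqP -> := v1 _ m; have /eqP -> := v2 _ m; rewrite sS e.
by have := eq (hgt l k) (leqnn _); rewrite subnn /= => e; rewrite e eqxx in ne.
Qed.

End Code.

(** * Encoder, decoder and collision extraction in polynomial time *)

Section T1.
Context {A : Type} {ra : rep A}.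

Lemma fp_tval n (f : A -> n.-tuple bits) : fp f -> fp (fun a => tval (f a)).
Proof. by move=> h; apply: (fp_cast h). Qed.

Lemma fp_tuple1 (f : A -> bits) : fp f -> fp (fun a => [tuple f a]).
Proof.
move=> hf; have h : fp (fun a => [:: f a]) by fpa.
by apply: (fp_cast h).
Qed.

Lemma fp_tuple2 (f g : A -> bits) : fp f -> fp g -> fp (fun a => [tuple f a; g a]).
Proof.
move=> hf hg; have h : fp (fun a => [:: f a; g a]) by fpa.
by apply: (fp_cast h).
Qed.

Lemma fp_tuple3 (f g h : A -> bits) : fp f -> fp g -> fp h -> fp (fun a => [tuple f a; g a; h a]).
Proof.
move=> hf hg hh; have h' : fp (fun a => [:: f a; g a; h a]) by fpa.
by apply: (fp_cast h').
Qed.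

Lemma fp_tuple5 (f g h i j : A -> bits) : fp f -> fp g -> fp h -> fp i -> fp j ->
  fp (fun a => [tuple f a; g a; h a; i a; j a]).
Proof.
move=> *; have h' : fp (fun a => [:: f a; g a; h a; i a; j a]) by fpa.
by apply: (fp_cast h').
Qed.

Lemma fp_unary (n : A -> nat) : fp n -> fp (fun a => unary (n a)).
Proof.
move=> hn; apply: (fp_ext (g := fun a => mkseq (fun=> true) (n a))); last fpa.
by move=> a; rewrite /unary /mkseq; elim: (n a) 0 => //= m IH i; rewrite -(IH i.+1).
Qed.

Lemma fp_zeros (n : A -> nat) : fp n -> fp (fun a => nseq (n a) false).
Proof.
move=> hn; apply: (fp_ext (g := fun a => mkseq (fun=> false) (n a))); last fpa.
by move=> a; rewrite /mkseq; elim: (n a) 0 => //= m IH i; rewrite -(IH i.+1).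
Qed.

End T1.
#[global] Hint Resolve fp_tval fp_tuple1 fp_tuple2 fp_tuple3 fp_tuple5 fp_unary fp_zeros : fp.

Section T2.
Context {A : Type} {ra : rep A}.

Lemma fp_call1 (P : ppt) (f : A -> bits) : fp f -> fp (fun a => value (output P [:: f a])).
Proof.
move=> hf; pose proof (fp_comp (f := fun a => [tuple f a]) (@fp_call P 1) (fp_tuple1 hf)) as h.
exact: h.
Qed.

Lemma fp_apply2 (P : dpt) (f g : A -> bits) : fp f -> fp g -> fp (fun a => apply P [:: f a; g a]).
Proof.
move=> hf hg; pose proof (fp_comp (f := fun a => [tuple f a; g a]) (@fp_call P 2) (fp_tuple2 hf hg)) as h.
exact: h.
Qed.
End T2.
#[global] Hint Resolve fp_call1 fp_apply2 : fp.

Section FCode.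
Variables (GenH : ppt) (H : dpt) (u : nat).
Hypothesis u1 : 1 < u.
Local Notation ellf := (ellf GenH H).
Local Notation hsh := (hsh GenH H).
Local Notation plain := (plain GenH H).
Local Notation bsz := (bsz GenH H).
Local Notation nb := (nb GenH H).
Local Notation hgt := (hgt GenH H).
Local Notation pay := (pay GenH H).
Local Notation cX := (cX GenH H).
Local Notation cp := (cp GenH H).
Local Notation blk := (blk GenH H u).
Local Notation nblk := (nblk GenH H u).
Local Notation rt := (rt GenH H u).
Local Notation ce := (ce GenH H u).
Local Notation ncop := (ncop GenH H u).
Local Notation rlen := (rlen GenH H u).
Local Notation clen := (clen GenH H u).
Local Notation dat := (dat GenH H).
Local Notation node := (node GenH H).
Local Notation pairn := (pairn GenH H).
Local Notation lev := (lev GenH H).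
Local Notation pathn := (pathn GenH H).
Local Notation root := (root GenH H).
Local Notation payld := (payld GenH H).
Local Notation encf := (encf GenH H u).
Local Notation inpn := (inpn GenH H).
Local Notation veri := (veri GenH H).
Local Notation vroot := (vroot GenH H).
Local Notation ndc := (ndc GenH H u).
Local Notation cidx := (cidx GenH H u).
Local Notation posf := (posf GenH H u).
Local Notation outf := (outf GenH H u).
Local Notation extf := (extf GenH H).
Local Notation colf := (colf GenH H u).

Section C1.
Context {A : Type} {ra : rep A}.
Variables (l k : A -> nat).
Hypotheses (hl : fp l) (hk : fp k).

Lemma fp_ellf : fp (fun a => ellf (l a)).
Proof. by rewrite /ellf; fpa. Qed.

Lemma fp_ct : fp (fun a => ct (l a) (k a)).
Proof. by rewrite /ct; fpa. Qed.
End C1.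
#[local] Hint Resolve fp_ellf fp_ct : fp.

Section C2.
Context {A : Type} {ra : rep A}.
Variables (l k : A -> nat).
Hypotheses (hl : fp l) (hk : fp k).

Lemma fp_hsh s x : fp s -> fp x -> fp (fun a => hsh (l a) (s a) (x a)).
Proof. by move=> hs hx; rewrite /hsh; fpa. Qed.

Lemma fp_plain : fp (fun a => plain (l a) (k a)).
Proof. by rewrite /plain; fpa. Qed.
End C2.
#[local] Hint Resolve fp_hsh fp_plain : fp.

Section C3.
Context {A : Type} {ra : rep A}.
Variables (l k : A -> nat).
Hypotheses (hl : fp l) (hk : fp k).

Lemma fp_bsz : fp (fun a => bsz (l a) (k a)).
Proof. by rewrite /bsz; fpa. Qed.
#[local] Hint Resolve fp_bsz : fp.
Lemma fp_nb : fp (fun a => nb (l a) (k a)).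
Proof. by rewrite /nb; fpa. Qed.
#[local] Hint Resolve fp_nb : fp.
Lemma fp_hgt : fp (fun a => hgt (l a) (k a)).
Proof. by rewrite /hgt; fpa. Qed.
#[local] Hint Resolve fp_hgt : fp.
Lemma fp_pay : fp (fun a => pay (l a) (k a)).
Proof. by rewrite /pay; fpa. Qed.
#[local] Hint Resolve fp_pay : fp.
Lemma fp_cX : fp (fun a => cX (l a) (k a)).
Proof. by rewrite /cX; fpa. Qed.
#[local] Hint Resolve fp_cX : fp.
Lemma fp_blk : fp (fun a => blk (l a) (k a)).
Proof. by rewrite /blk /cp; fpa. Qed.
#[local] Hint Resolve fp_blk : fp.
Lemma fp_nblk : fp (fun a => nblk (l a) (k a)).
Proof. by rewrite /nblk; fpa. Qed.
#[local] Hint Resolve fp_nblk : fp.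
Lemma fp_rt : fp (fun a => rt (l a) (k a)).
Proof. by rewrite /rt /cp; fpa. Qed.
#[local] Hint Resolve fp_rt : fp.
Lemma fp_ce : fp (fun a => ce (l a) (k a)).
Proof. by rewrite /ce; fpa. Qed.
#[local] Hint Resolve fp_ce : fp.
Lemma fp_ncop : fp (fun a => ncop (l a) (k a)).
Proof.
apply: (fp_ext (g := fun a => if plain (l a) (k a) then 0 else
  powc (cdiv (nblk (l a) (k a)) (2 ^ u) %/ rt (l a) (k a)).+1 (ce (l a) (k a)))); last fpa.
move=> a; rewrite /ncop /ce; case: ifP => // _; rewrite powcE //.
move: (_ %/ _) => z; case: (posnP z) => [->|z0]; first by rewrite trunc_log0.
by have := @trunc_logP 2 z isT z0; lia.
Qed.
#[local] Hint Resolve fp_ncop : fp.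
Lemma fp_rlen : fp (fun a => rlen (l a) (k a)).
Proof. by rewrite /rlen; fpa. Qed.
Lemma fp_ndc : fp (fun a => ndc (l a) (k a)).
Proof. by rewrite /ndc; fpa. Qed.
End C3.
#[local] Hint Resolve fp_bsz fp_nb fp_hgt fp_pay fp_cX fp_blk fp_nblk fp_rt fp_ce fp_ncop fp_rlen fp_ndc : fp.

Section C4.
Context {A : Type} {ra : rep A}.
Variables (l : A -> nat) (s x : A -> bits).
Hypotheses (hl : fp l) (hs : fp s) (hx : fp x).

Lemma fp_dat j : fp j -> fp (fun a => dat (l a) (x a) (j a)).
Proof. by move=> hj; rewrite /dat; fpa. Qed.

Lemma fp_node v j : fp v -> fp j -> fp (fun a => node (l a) (v a) (j a)).
Proof.
move=> hv hj; apply: (fp_ext (g := fun a => if j a < size (v a) then nth [::] (v a) (j a)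
   else nseq (ellf (l a)) false)); last fpa.
move=> a; rewrite /node; case: ltnP => h; [exact: set_nth_default | exact: nth_default].
Qed.
End C4.
#[local] Hint Resolve fp_dat fp_node : fp.

Section C5.
Context {A : Type} {ra : rep A}.
Variables (l : A -> nat) (s x : A -> bits).
Hypotheses (hl : fp l) (hs : fp s) (hx : fp x).

Lemma fp_pairn v j : fp v -> fp j -> fp (fun a => pairn (l a) (v a) (j a)).
Proof. by move=> hv hj; rewrite /pairn; fpa. Qed.
End C5.
#[local] Hint Resolve fp_pairn : fp.

Section C6.
Context {A : Type} {ra : rep A}.
Variables (l : A -> nat) (s x : A -> bits).
Hypotheses (hl : fp l) (hs : fp s) (hx : fp x).

Lemma sz_lev a i : sz (lev (l a) (s a) (x a) i) <= nb (l a) (size (x a)) * (4 * ellf (l a) + 2) + 1.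
Proof.
have S : size (lev (l a) (s a) (x a) i) = nb (l a) (size (x a)) by case: i => [|i]; rewrite /lev /= size_mkseq.
pose proof (@sz_le _ (rep_seq rep_bool) (lev (l a) (s a) (x a) i) (4 * ellf (l a) + 1)) as h.
rewrite S in h; apply: leq_trans (h _) _; last by lia.
move=> j x0 hj; apply: leq_trans (sz_bits _) _.
by rewrite (@size_lev GenH H (l a) (s a) (x a) i) // mem_nth // S.
Qed.

Lemma fp_lev i : fp i -> fp (fun a => lev (l a) (s a) (x a) (i a)).
Proof.
move=> hi; rewrite /lev.
apply: (fp_iter (f := fun a v => mkseq (fun j => hsh (l a) (s a) (pairn (l a) v j)) (nb (l a) (size (x a))))
  (s0 := fun a => mkseq (fun j => hsh (l a) (s a) (dat (l a) (x a) j)) (nb (l a) (size (x a))))) => //; try fpa.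
exists (fun a => nb (l a) (size (x a)) * (4 * ellf (l a) + 2) + 1); last by move=> a j _; exact: sz_lev.
by apply: pbound_nat; fpa.
Qed.
End C6.
#[local] Hint Resolve fp_lev : fp.

Section C7.
Context {A : Type} {ra : rep A}.
Variables (l : A -> nat) (s x : A -> bits).
Hypotheses (hl : fp l) (hs : fp s) (hx : fp x).

Lemma fp_payld j : fp j -> fp (fun a => payld (l a) (s a) (x a) (j a)).
Proof. by move=> hj; rewrite /payld /pathn; fpa. Qed.

Lemma fp_root : fp (fun a => root (l a) (s a) (x a)).
Proof. by rewrite /root; fpa. Qed.
End C7.
#[local] Hint Resolve fp_payld fp_root : fp.

Section C8.
Context {A : Type} {ra : rep A}.
Variables (l : A -> nat) (s x : A -> bits).
Hypotheses (hl : fp l) (hs : fp s) (hx : fp x).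

Lemma fp_encf : fp (fun a => encf (l a) (s a) (x a)).
Proof. by rewrite /encf /cp; fpa. Qed.
End C8.

Section C9.
Context {A : Type} {ra : rep A}.
Variables (l k i : A -> nat) (s y c : A -> bits).
Hypotheses (hl : fp l) (hk : fp k) (hi : fp i) (hs : fp s) (hy : fp y) (hc : fp c).

Lemma fp_inpn : fp (fun a => inpn (l a) (k a) (y a) (i a)).
Proof.
apply: (fp_ext (g := fun a => if i a == 0 then take (bsz (l a) (k a)) (y a) else
   take (2 * ellf (l a)) (drop (bsz (l a) (k a) + (i a).-1 * (2 * ellf (l a))) (y a)))); last fpa.
by move=> a; case: (i a).
Qed.

Lemma fp_cidx : fp (fun a => cidx (l a) (k a) (c a) (i a)).
Proof. by rewrite /cidx; fpa. Qed.
End C9.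
#[local] Hint Resolve fp_inpn fp_cidx : fp.

Section C10.
Context {A : Type} {ra : rep A}.
Variables (l k i : A -> nat) (s y c : A -> bits).
Hypotheses (hl : fp l) (hk : fp k) (hi : fp i) (hs : fp s) (hy : fp y) (hc : fp c).

Lemma fp_veri : fp (fun a => veri (l a) (k a) (s a) (i a) (y a)).
Proof. by rewrite /veri; fpa. Qed.

Lemma fp_vroot : fp (fun a => vroot (l a) (k a) (s a) (y a)).
Proof. by rewrite /vroot; fpa. Qed.

Lemma fp_posf : fp (fun a => posf (l a) (k a) (i a) (c a)).
Proof. by rewrite /posf; fpa. Qed.
End C10.
#[local] Hint Resolve fp_veri fp_vroot fp_posf : fp.

Section C11.
Context {A : Type} {ra : rep A}.
Variables (l k i : A -> nat) (s y y' x w c : A -> bits).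
Hypotheses (hl : fp l) (hk : fp k) (hi : fp i) (hs : fp s) (hy : fp y) (hy' : fp y') (hx : fp x) (hw : fp w) (hc : fp c).

Lemma fp_outf : fp (fun a => outf (l a) (k a) (s a) (i a) (c a)).
Proof. by rewrite /outf /cp; fpa. Qed.

Lemma fp_extf : fp (fun a => extf (l a) (k a) (s a) (y a) (y' a)).
Proof.
rewrite /extf; cbv zeta.
have h : fp (fun a => find (fun i => (inpn (l a) (k a) (y a) i != inpn (l a) (k a) (y' a) i) &&
      (hsh (l a) (s a) (inpn (l a) (k a) (y a) i) == hsh (l a) (s a) (inpn (l a) (k a) (y' a) i)))
      (iota 0 (hgt (l a) (k a)).+1)).
  apply: (fp_find (f := fun a i => (inpn (l a) (k a) (y a) i != inpn (l a) (k a) (y' a) i) &&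
      (hsh (l a) (s a) (inpn (l a) (k a) (y a) i) == hsh (l a) (s a) (inpn (l a) (k a) (y' a) i)))); last fpa.
  by apply: fp_andb; [apply: fp_negb; apply: fp_eqbits | apply: fp_eqbits]; fpa.
by apply: fp_pair; apply: fp_inpn.
Qed.
End C11.
#[local] Hint Resolve fp_encf fp_outf fp_extf : fp.

Section C12.
Context {A : Type} {ra : rep A}.
Variables (l i : A -> nat) (s x w : A -> bits).
Hypotheses (hl : fp l) (hi : fp i) (hs : fp s) (hx : fp x) (hw : fp w).

Lemma fp_colf : fp (fun a => colf (l a) (s a) (x a) (w a) (i a)).
Proof. by rewrite /colf /cp; apply: fp_extf; fpa. Qed.
End C12.

Definition decf l k w s i : rand (bits * bits * nat) :=
  bind (coins (ndc l k)) (fun c =>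
    Ret (outf l k s i [seq nth false w p | p <- posf l k i c], [::], size (posf l k i c))).

Lemma code_exists : exists C : local_code, [/\ Gen C = GenH, blen C = clen,
  forall l s x, enc C l s x = encf l s x &
  forall l k w s i, bind (dec_run C l k w s i) (fun o => Ret (mem o 0, mem o 1, asked o)) = decf l k w s i].
Proof.
have [E hE] : exists P : dpt, forall ins : 3.-tuple bits, apply P ins =
    encf (size (nth [::] ins 0)) (nth [::] ins 1) (nth [::] ins 2).
  by apply: (@fp_dpt 3 (fun ins => encf (size (nth [::] ins 0)) (nth [::] ins 1) (nth [::] ins 2))); fpa.
have [D hD] : exists P : ppt, forall w (ins : 4.-tuple bits),
    bind (exec_oracle P w ins) (fun o => Ret (mem o 0, mem o 1, asked o)) =
    decf (size (nth [::] ins 0)) (size (nth [::] ins 1)) w (nth [::] ins 2) (size (nth [::] ins 3)).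
  apply: (@rp_ppt 4 (fun w ins => decf (size (nth [::] ins 0)) (size (nth [::] ins 1)) w (nth [::] ins 2) (size (nth [::] ins 3)))).
  have r1 : rp (fun (w : bits) (ins : 4.-tuple bits) => bind (bind (coins (ndc (size (nth [::] ins 0)) (size (nth [::] ins 1))))
      (fun c => Ret (c, 0))) (fun o => Ret ((ins, o.1), o.2))).
    by apply: (rp_with (f := fun ins : 4.-tuple bits => ndc (size (nth [::] ins 0)) (size (nth [::] ins 1)))
      (K := fun _ n => bind (coins n) (fun c => Ret (c, 0)))); [fpa | exact: rp_toss].
  have f2 : fp (fun q : 4.-tuple bits * bits => posf (size (nth [::] q.1 0)) (size (nth [::] q.1 1))
      (size (nth [::] q.1 3)) q.2) by fpa.
  pose proof (rp_with f2 rp_query) as r2.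
  have f3 : fp (fun q : 4.-tuple bits * bits * bits =>
     (outf (size (nth [::] q.1.1 0)) (size (nth [::] q.1.1 1)) (nth [::] q.1.1 2) (size (nth [::] q.1.1 3)) q.2, [::] : bits)) by fpa.
  pose proof (rp_fp f3) as r3.
  apply: rp_ext (rp_bind r1 (rp_bind r2 r3)) => w ins.
  rewrite /decf !bindA; apply: eq_bind => c.
  by cbn [bind fst snd]; rewrite addn0 add0n.
have hE' l s x : apply E [:: unary l; s; x] = encf l s x.
  by have := hE [tuple unary l; s; x]; rewrite /= size_nseq.
have sE l s x : size (apply E [:: unary l; s; x]) = clen l (size x).
  by rewrite hE' size_encf.
exists (LocalCode GenH D sE); split=> // l k w s i.
by have := hD w [tuple unary l; unary k; s; unary i]; rewrite /= !size_nseq.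
Qed.

End FCode.

(** * Decoding *)

Lemma hamming_ham n (x y : bits) : size x = n -> size y = n -> hamming x y = ham n x y.
Proof.
move=> <- {n}; elim: x y => [|b x IH] [|c y] //= [e].
rewrite /hamming /= -/(hamming x y) IH // /ham /= -addn1; congr (_ + _).
by rewrite (iotaDl 1 0) count_map; apply: eq_count.
Qed.

(** An averaging argument: every bad piece of length [L] holds more than [L / c] of the errors,
    which bounds the number of bad pieces. *)
Lemma count_bad (n L c : nat) (P : pred nat) (h : nat -> nat) :
  (forall j, j < n -> P j -> L < c * h j) ->
  count P (iota 0 n) * L <= c * \sum_(j < n) h j.
Proof.
elim: n => [|n IH] hP; first by rewrite big_ord0 muln0.
rewrite -addn1 iotaD count_cat addn1 big_ord_recr /= mulnDl mulnDr add0n addn0.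
apply: leq_add; first by apply: IH => j hj; apply: hP; lia.
by case: (boolP (P n)) => [/hP h1|_]; [rewrite mul1n; apply: ltnW; apply: h1 | rewrite mul0n].
Qed.

Section Decode.
Variables (GenH : ppt) (H : dpt) (u : nat).
Hypothesis u1 : 1 < u.
Local Notation ellf := (ellf GenH H).
Local Notation hsh := (hsh GenH H).
Local Notation plain := (plain GenH H).
Local Notation bsz := (bsz GenH H).
Local Notation nb := (nb GenH H).
Local Notation hgt := (hgt GenH H).
Local Notation pay := (pay GenH H).
Local Notation cX := (cX GenH H).
Local Notation cp := (cp GenH H).
Local Notation blk := (blk GenH H u).
Local Notation nblk := (nblk GenH H u).
Local Notation rt := (rt GenH H u).
Local Notation ce := (ce GenH H u).
Local Notation ncop := (ncop GenH H u).
Local Notation rlen := (rlen GenH H u).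
Local Notation clen := (clen GenH H u).
Local Notation dat := (dat GenH H).
Local Notation root := (root GenH H).
Local Notation payld := (payld GenH H).
Local Notation encf := (encf GenH H u).
Local Notation inpn := (inpn GenH H).
Local Notation veri := (veri GenH H).
Local Notation vroot := (vroot GenH H).
Local Notation ndc := (ndc GenH H u).
Local Notation cidx := (cidx GenH H u).
Local Notation posf := (posf GenH H u).
Local Notation outf := (outf GenH H u).
Local Notation extf := (extf GenH H).
Local Notation colf := (colf GenH H u).
Local Notation a := (2 ^ u).

Lemma size_posf l k i c : size (posf l k i c) = blk l k + (if plain l k then 0 else ct l k ^ 2 * rt l k).
Proof.
rewrite size_cat size_iota; case: ifP => // _; congr (_ + _).
rewrite size_flatten /shape -map_comp sumnE big_map.
by under eq_bigr do rewrite /= size_iota; rewrite big_const_seq count_predT size_iota iter_addn_0 mulnC.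
Qed.

Section Word.
Variables (l : nat) (s x w : bits).
Let k := size x.
Hypothesis sw : size w = clen l k.

Definition yb j := ecc_dec u (cp l k) (pay l k) (take (blk l k) (drop (j * blk l k) w)).
Definition zc r := ecc_dec u (cp l k) (ellf l) (take (rt l k) (drop (nblk l k + r * rt l k) w)).

Lemma cidx_lt c r : ~~ plain l k -> cidx l k c r < ncop l k.
Proof.
move=> np; rewrite /cidx; set v := take _ _.
have sv : size v <= ce l k by rewrite size_take_min geq_minl.
have le : 2 ^ size v <= ncop l k by rewrite /ncop (negPf np) leq_exp2l.
exact: leq_trans (b2n_small le) le.
Qed.

Lemma outf_word i c : i < k ->
  outf l k s i [seq nth false w p | p <- posf l k i c] =
  let y := yb (i %/ bsz l k) in
  let b := [:: nth false y (i %% bsz l k)] in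
  if plain l k then b else
  if veri l k s (i %/ bsz l k) y &&
     (ct l k ^ 2 < 2 * count (fun r => zc (cidx l k c r) == vroot l k s y) (iota 0 (ct l k ^ 2)))
  then b else [::].
Proof.
move=> ik; rewrite /outf.
have hj := idx_lt GenH H l ik; set j := i %/ _ in hj *.
have le1 : j * blk l k + blk l k <= size w.
  rewrite sw; apply: leq_trans (leq_addr _ _); rewrite /nblk -mulSnr.
  by rewrite leq_mul2r hj orbT.
have -> : take (blk l k) [seq nth false w p | p <- posf l k i c] = take (blk l k) (drop (j * blk l k) w).
  rewrite /posf map_cat take_size_cat ?size_map ?size_iota // map_nth_iota //.
  by move: le1; lia.
rewrite -/(yb j); cbv zeta.
clearbody j.
move: (yb j) => y.
case: (boolP (plain l k)) => np.
  by reflexivity.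
have E r : r < ct l k ^ 2 -> take (rt l k) (drop (blk l k + r * rt l k) [seq nth false w p | p <- posf l k i c]) =
   take (rt l k) (drop (nblk l k + cidx l k c r * rt l k) w); last first.
  have E2 : count (fun r => ecc_dec u (cp l k) (ellf l)
       (take (rt l k) (drop (blk l k + r * rt l k) [seq nth false w p | p <- posf l k i c])) == vroot l k s y)
       (iota 0 (ct l k ^ 2)) = count (fun r => zc (cidx l k c r) == vroot l k s y) (iota 0 (ct l k ^ 2)).
    apply: eq_in_count => r; rewrite mem_iota => /andP [_ hr].
    by rewrite [take _ _](E r hr).
  by rewrite [count _ _ in LHS]E2.
move=> hr.
rewrite /posf (negPf np) map_cat addnC -drop_drop drop_size_cat ?size_map ?size_iota //.
rewrite map_flatten -map_comp.
rewrite [flatten _](_ : _ = flatten (mkseq (fun r => [seq nth false w p | p <- iota (nblk l k + cidx l k c r * rt l k) (rt l k)]) (ct l k ^ 2))) //.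
rewrite (@flatten_seg _ _ (rt l k)) //; last by move=> r' _; rewrite size_map size_iota.
have hc := cidx_lt c r np.
rewrite map_nth_iota // sw /clen subnDl.
have le2 : (cidx l k c r).+1 * rt l k <= rlen l k.
  by apply: leq_trans (leq_maxr _ _); rewrite leq_mul2r hc orbT.
by move: le2; rewrite mulSn; lia.
Qed.

Definition nbad c := count (fun r => zc (cidx l k c r) != root l s x) (iota 0 (ct l k ^ 2)).

Lemma nth_dat i : i < k -> nth false (dat l x (i %/ bsz l k)) (i %% bsz l k) = nth false x i.
Proof.
move=> ik; have k0 : 0 < k by case: k ik.
by rewrite nth_mkseq ?ltn_pmod ?bsz_gt0 // -divn_eq.
Qed.

Lemma nth_payld i : i < k ->
  nth false (payld l s x (i %/ bsz l k)) (i %% bsz l k) = nth false x i.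
Proof.
move=> ik; have k0 : 0 < k by case: k ik.
by rewrite nth_cat size_dat ltn_pmod ?bsz_gt0 // nth_dat.
Qed.

Lemma good_dec i c : i < k -> yb (i %/ bsz l k) = payld l s x (i %/ bsz l k) ->
  (~~ plain l k -> 2 * nbad c < ct l k ^ 2) ->
  outf l k s i [seq nth false w p | p <- posf l k i c] = [:: nth false x i].
Proof.
move=> ik hy hb; rewrite outf_word // hy; cbv zeta; rewrite nth_payld //; case: (boolP (plain l k)) => // np.
have hj := idx_lt GenH H l ik.
rewrite (veri_payld u1) // (vroot_payld u1) // andTb.
have := hb np; rewrite /nbad.
have := count_predC (fun r => zc (cidx l k c r) == root l s x) (iota 0 (ct l k ^ 2)).
rewrite size_iota.
rewrite (@eq_count _ (predC _) (fun r => zc (cidx l k c r) != root l s x)) //.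
set n1 := count _ _; set n2 := count _ _; clearbody n1 n2; move: (ct l k ^ 2) => T h1 h2.
by rewrite (_ : T < 2 * n1) //; lia.
Qed.

(** More than half of the sampled copies equal the recomputed root, and more than half equal the
    true root, so some copy equals both. The decoded and the encoded block then have valid paths to
    one root but different data. *)
Lemma fool_dec i c : i < k -> ~~ plain l k -> 2 * nbad c < ct l k ^ 2 ->
  ohead (outf l k s i [seq nth false w p | p <- posf l k i c]) \notin [:: None; Some (nth false x i)] ->
  (colf l s x w (i %/ bsz l k)).1 != (colf l s x w (i %/ bsz l k)).2 /\
  hsh l s (colf l s x w (i %/ bsz l k)).1 = hsh l s (colf l s x w (i %/ bsz l k)).2.
Proof.
move=> ik np hb; rewrite outf_word // (negPf np); cbv zeta.
have hj := idx_lt GenH H l ik; have k0 : 0 < k by case: k ik.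
set j := i %/ bsz l k in hj *; set y := yb j.
case: ifP => [/andP [v hc]|_]; last by [].
rewrite /= !inE /= => ne.
have : has (fun r => (zc (cidx l k c r) == vroot l k s y) && (zc (cidx l k c r) == root l s x)) (iota 0 (ct l k ^ 2)).
  rewrite has_count; move: hb hc; rewrite /nbad.
  have := count_predUI (fun r => zc (cidx l k c r) == vroot l k s y) (fun r => zc (cidx l k c r) == root l s x) (iota 0 (ct l k ^ 2)).
  have := count_predC (fun r => zc (cidx l k c r) == root l s x) (iota 0 (ct l k ^ 2)).
  have := count_size (predU (fun r => zc (cidx l k c r) == vroot l k s y) (fun r => zc (cidx l k c r) == root l s x)) (iota 0 (ct l k ^ 2)).
  rewrite size_iota /predC /predI /=.
  move: (ct l k ^ 2) (count _ _) (count _ _) (count _ _) (count _ _) (count _ _) => T n1 n2 n3 n4 n5; lia.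
move=> /hasP [r _ /andP [/eqP e1 /eqP e2]].
apply: (@extf_correct GenH H u u1 l k s j) => //; first by exact: (veri_payld u1).
  by rewrite (vroot_payld u1) // -e2 e1.
apply/negP => /eqP e; case/negP: ne; apply/eqP; congr Some.
rewrite -(nth_payld ik) -/j.
have hq : i %% bsz l k < bsz l k by rewrite ltn_pmod ?bsz_gt0.
by rewrite -(nth_take _ hq) -[in RHS](nth_take _ hq) -/y e.
Qed.

Lemma plain_nb : 0 < k -> plain l k -> nb l k = 1.
Proof.
by move=> k0 p; rewrite /nb /bsz p /cdiv; case: k k0 => // m _; rewrite /= divnDl ?divnn // divn_small.
Qed.

Lemma good_blk j : j < nb l k ->
  6 * (a * a * a) * ham (blk l k) (take (blk l k) (drop (j * blk l k) (encf l s x)))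
    (take (blk l k) (drop (j * blk l k) w)) <= blk l k -> yb j = payld l s x j.
Proof.
move=> hj; rewrite encf_blk // => h; apply: ecc_correct => //; first by exact: cp_prime.
  exact: size_payld.
by apply: ltnW; apply: leq_ltn_trans (cp_gt _ _ _ _); rewrite /cX -/k; lia.
Qed.

Lemma good_cop r : r < ncop l k ->
  6 * (a * a * a) * ham (rt l k) (take (rt l k) (drop (nblk l k + r * rt l k) (encf l s x)))
    (take (rt l k) (drop (nblk l k + r * rt l k) w)) <= rt l k -> zc r = root l s x.
Proof.
move=> hj; rewrite encf_cop // => h; apply: ecc_correct => //; first by exact: cp_prime.
  exact: size_root.
by apply: ltnW; apply: leq_ltn_trans (cp_gt _ _ _ _); rewrite /cX -/k; lia.
Qed.

Lemma ham_parts :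
  \sum_(j < nb l k) ham (blk l k) (take (blk l k) (drop (j * blk l k) (encf l s x)))
    (take (blk l k) (drop (j * blk l k) w)) +
  \sum_(r < ncop l k) ham (rt l k) (take (rt l k) (drop (nblk l k + r * rt l k) (encf l s x)))
    (take (rt l k) (drop (nblk l k + r * rt l k) w)) <= ham (clen l k) (encf l s x) w.
Proof.
rewrite /clen ham_cat {1}/nblk ham_blocks leq_add2l.
rewrite -(subnKC (leq_maxr (cdiv (nblk l k) a) (ncop l k * rt l k)) : _ = rlen l k).
rewrite ham_cat ham_blocks; apply: leq_trans (leq_addr _ _).
by apply: eq_leq; apply: eq_bigr => r _; rewrite !drop_drop addnC.
Qed.

Hypothesis herr : 512 * (a * a * a * a) * ham (clen l k) (encf l s x) w <= clen l k.
Hypothesis hn : clen l k <= 2 * nblk l k.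

Lemma herr' : 512 * (a * a * a * a) * ham (clen l k) (encf l s x) w <= 2 * nblk l k.
Proof. exact: leq_trans herr hn. Qed.

Lemma a_gt0 : 0 < a. Proof. by rewrite expn_gt0. Qed.

(** The single block is at least half of the word, so even if all errors fall into it, their
    fraction is at most [1 / (256 a ^ 4)], below the tolerated [1 / (6 a ^ 3)]. *)
Lemma plain_good i : i < k -> plain l k -> yb (i %/ bsz l k) = payld l s x (i %/ bsz l k).
Proof.
move=> ik p; have hj := idx_lt GenH H l ik; have k0 : 0 < k by case: k ik.
apply: good_blk => //; rewrite (plain_nb k0 p) in hj.
have -> : i %/ bsz l k = 0 by case: (i %/ bsz l k) hj.
have h := herr'; have h2 := ham_parts; rewrite /nblk (plain_nb k0 p) big_ord1 mul1n /= in h h2 *.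
move: h h2; set Hs := ham (clen _ _) _ _; set h0 := ham (blk _ _) _ _; move: (\sum_(_ < _) _) => S h h2.
have h3 : h0 <= Hs by apply: leq_trans h2; exact: leq_addr.
have ha := a_gt0; move: h3 h; clear h2; clearbody h0 Hs; move: a ha h0 Hs (blk l k) => z z0 h0 Hs b h3 h.
have h4 : 6 * (z * z * z) * h0 <= 256 * (z * z * z * z) * Hs.
  apply: leq_mul => //; rewrite (_ : 256 * _ = 256 * z * (z * z * z)); last by ring.
  by apply: leq_mul => //; lia.
apply: leq_trans h4 _; rewrite -(@leq_pmul2l 2) // mulnA mulnA; exact: h.
Qed.

(** A bad block takes a fraction [1 / (6 a ^ 3)] of errors and the blocks are half of the word, so
    the constant 42 comes from [2 * 6 * 42 = 504 <= 512]. The slack is spent on the incomplete last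
    block in [good_many]. *)
Lemma bad_blocks : 42 * a * count (fun j => yb j != payld l s x j) (iota 0 (nb l k)) <= nb l k.
Proof.
case: (posnP (nblk l k)) => [n0|n0].
  rewrite (_ : count _ _ = 0) ?muln0 //; apply/eqP; rewrite -leqn0 leqNgt -has_count.
  apply/hasPn => j; rewrite mem_iota add0n => /= hj; rewrite negbK; apply/eqP.
  apply: good_blk => //; rewrite (_ : blk l k = 0) ?take0 ?ham_refl ?muln0 //.
  by apply/eqP; move/eqP: n0; rewrite muln_eq0; case: (nb l k) hj.
have b0 : 0 < blk l k by move: n0; rewrite muln_gt0 => /andP [].
rewrite -(leq_pmul2r b0) -/(nblk l k).
pose h j := ham (blk l k) (take (blk l k) (drop (j * blk l k) (encf l s x)))
    (take (blk l k) (drop (j * blk l k) w)).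
have c2 : count (fun j => yb j != payld l s x j) (iota 0 (nb l k)) * blk l k <=
    6 * (a * a * a) * \sum_(j < nb l k) h j.
  apply: count_bad => j hj; apply: contraR; rewrite -leqNgt => hh; apply/eqP; exact: good_blk.
have h1 := herr'; have h2 := leq_trans (leq_addr _ _) ham_parts.
have h3 : \sum_(j < nb l k) h j <= ham (clen l k) (encf l s x) w by exact: h2.
move: c2 h1 h3; move: (count _ _) (\sum_(_ < _) _) (ham (clen l k) _ _) (nblk l k) (blk l k) => c S E N b.
move: a => z c2 h1 h3.
have h4 : 42 * z * (c * b) <= 42 * z * (6 * (z * z * z) * E).
  by rewrite leq_mul2l (leq_trans c2) ?orbT // leq_mul2l h3 orbT.
rewrite -mulnA; apply: leq_trans h4 _; rewrite -(@leq_pmul2l 2) //; apply: leq_trans h1.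
rewrite (_ : 2 * _ = 504 * (z * z * z * z) * E); last by ring.
by rewrite leq_mul2r leq_mul2r orbT orbT.
Qed.

(** The copies fill at least [1 / (2 a)] of the length of the blocks, the 2 being lost by rounding
    their number down to a power of two. With the factor 2 for the whole word,
    [4 * 16 * 6 = 384 <= 512]. *)
Lemma bad_copies : ~~ plain l k -> 0 < rt l k ->
  16 * count (fun r => zc r != root l s x) (iota 0 (2 ^ ce l k)) <= 2 ^ ce l k.
Proof.
move=> np r0.
have nc : ncop l k = 2 ^ ce l k by rewrite /ncop (negPf np).
pose h r := ham (rt l k) (take (rt l k) (drop (nblk l k + r * rt l k) (encf l s x)))
    (take (rt l k) (drop (nblk l k + r * rt l k) w)).
have c2 : count (fun r => zc r != root l s x) (iota 0 (ncop l k)) * rt l k <=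
    6 * (a * a * a) * \sum_(r < ncop l k) h r.
  apply: count_bad => j hj; apply: contraR; rewrite -leqNgt => hh; apply/eqP; exact: good_cop.
have h1 := herr'; have h2 := leq_trans (leq_addl _ _) ham_parts.
have h3 : \sum_(r < ncop l k) h r <= ham (clen l k) (encf l s x) w by exact: h2.
rewrite nc in c2 h3.
have g1 := cdiv_ge (nblk l k) a_gt0.
have g2 := ltn_ceil (cdiv (nblk l k) a) r0.
have g3 := trunc_log_ltn (cdiv (nblk l k) a %/ rt l k) (isT : 1 < 2); rewrite -/(ce l k) expnS in g3.
have g4 : nblk l k <= 2 * 2 ^ ce l k * rt l k * a.
  apply: leq_trans g1 _; rewrite leq_mul2r (leq_trans (ltnW g2)) ?orbT //.
  by rewrite leq_mul2r g3 orbT.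
clear h2 g1 g2 g3; clearbody h; set c := count _ _ in c2 *; set S := \sum_(_ < _) _ in c2 h3; set E := ham (clen l k) _ _ in h1 h3.
move: c2 h1 h3 g4 r0; clearbody c S E.
have z0 := a_gt0; move: a z0 (nblk l k) (rt l k) (2 ^ ce l k) => z z0 N b e c2 h1 h3 g4 b0.
rewrite -(leq_pmul2r b0) -(leq_pmul2r z0).
have h4 : 16 * (c * b) * z <= 16 * (6 * (z * z * z) * E) * z.
  by rewrite leq_mul2r leq_mul2l (leq_trans c2) ?orbT // leq_mul2l h3 orbT.
rewrite -mulnA mulnA -(mulnA 16); apply: leq_trans h4 _; rewrite -(@leq_pmul2l 4) //.
have h5 : 4 * (16 * (6 * (z * z * z) * E) * z) <= 512 * (z * z * z * z) * E.
  rewrite (_ : 4 * _ = 384 * (z * z * z * z) * E); last by ring.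
  by rewrite leq_mul2r leq_mul2r orbT orbT.
apply: leq_trans h5 _; apply: leq_trans h1 _.
rewrite (_ : 4 * (e * b * z) = 2 * (2 * e * b * z)); last by ring.
by rewrite leq_mul2l g4 orbT.
Qed.

End Word.
End Decode.

From mathcomp Require Import reals.
Require Import Defs.
Import Order.TTheory GRing.Theory Num.Theory.

(** * Probability *)

Section Expectation.
Variable R : realType.
Local Open Scope ring_scope.

Fixpoint Ex (A : Type) (f : A -> R) (r : rand A) : R :=
  match r with
  | Ret a => f a
  | Flip r1 r0 => (Ex f r1 + Ex f r0) / 2
  end.

Lemma Pr_Ex (A : Type) (r : rand A) E : Pr R r E = Ex (fun a => (E a)%:R) r.
Proof. by elim: r => //= r1 -> r0 ->. Qed.

Lemma Ex_bind (A B : Type) (r : rand A) (g : A -> rand B) f :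
  Ex f (bind r g) = Ex (fun a => Ex f (g a)) r.
Proof. by elim: r => //= r1 -> r0 ->. Qed.

Lemma Ex_le (A : Type) (r : rand A) (f g : A -> R) :
  every r (fun a => f a <= g a) -> Ex f r <= Ex g r.
Proof. by elim: r => //= r1 IH1 r0 IH0 [/IH1 h1 /IH0 h0]; lra. Qed.

Lemma Ex_eq (A : Type) (r : rand A) (f g : A -> R) :
  every r (fun a => f a = g a) -> Ex f r = Ex g r.
Proof. by elim: r => //= r1 IH1 r0 IH0 [/IH1 -> /IH0 ->]. Qed.

Lemma Ex_const (A : Type) (r : rand A) c : Ex (fun=> c) r = c.
Proof. by elim: r => //= r1 -> r0 ->; lra. Qed.

Lemma Ex_mull (A : Type) (r : rand A) c (f : A -> R) : Ex (fun a => c * f a) r = c * Ex f r.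
Proof. by elim: r => //= r1 -> r0 ->; lra. Qed.

Lemma Ex_add (A : Type) (r : rand A) (f g : A -> R) : Ex (fun a => f a + g a) r = Ex f r + Ex g r.
Proof. by elim: r => //= r1 -> r0 ->; lra. Qed.

Lemma Ex_ge0 (A : Type) (r : rand A) (f : A -> R) : (forall a, 0 <= f a) -> 0 <= Ex f r.
Proof. by move=> h; elim: r => //= r1 IH1 r0 IH0; lra. Qed.

Lemma Pr_le (A : Type) (r : rand A) (E F : A -> bool) :
  every r (fun a => E a -> F a) -> Pr R r E <= Pr R r F.
Proof.
move=> h; rewrite !Pr_Ex; apply: Ex_le; apply: every_imp h => a; case: (E a); case: (F a) => // h.
by have := h isT.
Qed.

Lemma Pr_ge0 (A : Type) (r : rand A) E : 0 <= Pr R r E.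
Proof. by rewrite Pr_Ex; apply: Ex_ge0 => a; rewrite ler0n. Qed.

Lemma Pr_predC (A : Type) (r : rand A) (E : A -> bool) : Pr R r (fun a => ~~ E a) = 1 - Pr R r E.
Proof. by elim: r => /= [a|r1 -> r0 ->]; [case: (E a) => /=; lra | lra]. Qed.

Lemma size_coins n : every (coins n) (fun c => size c = n).
Proof.
elim: n => //= n IH; rewrite !every_bind /=; split; apply: every_imp IH => c /= ->; by [].
Qed.

Lemma Ex_coinsD m n (f : bits -> R) :
  Ex f (coins (m + n)) = Ex (fun c => Ex (fun c' => f (c ++ c')) (coins n)) (coins m).
Proof.
elim: m f => [|m IH] f //=; rewrite !Ex_bind /=.
by rewrite (IH (fun c => f (true :: c))) (IH (fun c => f (false :: c))).
Qed.

(** A single coin string has weight [2 ^- n]; in the reduction it is the string that guesses the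
    message length. *)
Lemma Ex_coins_ge n (f : bits -> R) c : (forall c, 0 <= f c) -> size c = n ->
  f c / 2 ^+ n <= Ex f (coins n).
Proof.
elim: n f c => [|n IH] f [|b c] //= h; first by rewrite expr0 divr1.
move=> [sc]; rewrite !Ex_bind /= exprS.
have h1 := Ex_ge0 (coins n) (fun c => h (true :: c)).
have h2 := Ex_ge0 (coins n) (fun c => h (false :: c)).
have h3 := IH (fun c => f (b :: c)) c (fun c => h _) sc.
have e : f (b :: c) / (2 * 2 ^+ n) = f (b :: c) / 2 ^+ n / 2.
  by rewrite invfM; ring.
rewrite e; case: b h3 e => h3 _; lra.
Qed.

Lemma sum_double n (f : nat -> R) :
  \sum_(r < (2 * n)%N) f r = \sum_(r < n) (f (2 * r)%N + f (2 * r).+1).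
Proof.
elim: n => [|n IH]; first by rewrite muln0 !big_ord0.
by rewrite mulnS !big_ord_recr /= IH addrA.
Qed.

Lemma Ex_coins_b2n e N (f : nat -> R) : (2 ^ e <= N)%N ->
  Ex (fun c => f (b2n N c)) (coins e) = (\sum_(r < 2 ^ e) f r) / 2 ^+ e.
Proof.
elim: e f => [|e IH] f hN; first by rewrite expn0 big_ord1 expr0 divr1 /=.
have hN' : (2 ^ e <= N)%N by apply: leq_trans hN; rewrite leq_exp2l.
have E b : Ex (fun c => f (b2n N (b :: c))) (coins e) = Ex (fun c => f (b + 2 * b2n N c)%N) (coins e).
  by apply: Ex_eq; apply: every_imp (size_coins e) => c sc; rewrite b2n_cons // sc.
rewrite /= !Ex_bind /= !E expnS sum_double exprS.
rewrite (IH (fun r => f (true + 2 * r)%N)) // (IH (fun r => f (false + 2 * r)%N)) // big_split /=.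
rewrite invfM; set S := \sum_(_ < _) _; set S' := \sum_(_ < _) _.
by ring.
Qed.

Lemma sum_count n (P : pred nat) : \sum_(r < n) (P r)%:R = (count P (iota 0 n))%:R :> R.
Proof.
elim: n => [|n IH]; first by rewrite big_ord0.
have -> : iota 0 n.+1 = iota 0 n ++ [:: n] by rewrite -addn1 iotaD.
by rewrite big_ord_recr /= IH count_cat natrD /= addn0.
Qed.

Section Chernoff.
Variables (e : nat) (P : pred bits).

Definition cnt T (c : bits) := count (fun r => P (take e (drop (r * e) c))) (iota 0 T).

Lemma cnt_cat T c c' : size c = e -> cnt T.+1 (c ++ c') = (P c + cnt T c')%N.
Proof.
move=> sc; rewrite /cnt [iota 0 T.+1]/= [LHS]/= mul0n drop0 take_size_cat //; congr (_ + _)%N.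
rewrite (iotaDl 1 0) count_map; apply: eq_count => r /=.
by rewrite add1n mulSn addnC -drop_drop drop_size_cat.
Qed.

Lemma mgf T : Ex (fun c => (16 : R) ^+ cnt T c) (coins (T * e)) =
  (Ex (fun c => (16 : R) ^+ P c) (coins e)) ^+ T.
Proof.
elim: T => [|T IH]; first by rewrite expr0.
rewrite mulSn Ex_coinsD exprS -IH mulrC -Ex_mull; apply: Ex_eq.
apply: every_imp (size_coins e) => c sc; rewrite mulrC -Ex_mull; apply: Ex_eq.
by apply: everyT => c'; rewrite cnt_cat // exprD.
Qed.

(** The exponential moment with base 16: one sample gives [1 + 15 Pr P <= 2], hence [T] independent
    samples give [2 ^ T]. A bad majority means [16 ^ cnt >= 4 ^ T], and Markov's inequality yields
    [2 ^ T / 4 ^ T]. *)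
Lemma chernoff T : 16 * Pr R (coins e) P <= 1 ->
  Pr R (coins (T * e)) (fun c => T <= 2 * cnt T c)%N <= (2 ^+ T)^-1.
Proof.
move=> hP; have h1 : Ex (fun c => (16 : R) ^+ P c) (coins e) <= 2.
  rewrite (@Ex_eq _ _ _ (fun c => 1 + 15 * (P c)%:R)); last first.
    by apply: everyT => c; case: (P c); rewrite ?expr1 ?expr0 ?mulr1 ?mulr0 ?addr0 // -natr1; ring.
  by rewrite Ex_add Ex_const Ex_mull -Pr_Ex; lra.
have h0 : 0 <= Ex (fun c => (16 : R) ^+ P c) (coins e) by apply: Ex_ge0 => c; rewrite exprn_ge0.
have h2 : Ex (fun c => (16 : R) ^+ cnt T c) (coins (T * e)) <= 2 ^+ T.
  by rewrite mgf lerXn2r // nnegrE.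
have p2 : 0 < (2 : R) ^+ T by rewrite exprn_gt0.
have e4 : (4 : R) ^+ T = 2 ^+ T * 2 ^+ T by rewrite -exprMn; congr (_ ^+ _); ring.
apply: (@le_trans _ _ (Ex (fun c => (4 ^+ T)^-1 * 16 ^+ cnt T c) (coins (T * e)))).
  rewrite Pr_Ex; apply: Ex_le; apply: everyT => c.
  have p4 : 0 < (4 : R) ^+ T by rewrite exprn_gt0.
  case: leqP => h /=; last by rewrite mulr_ge0 ?invr_ge0 ?exprn_ge0.
  rewrite mulrC ler_pdivlMr // mul1r (_ : (16 : R) = 4 ^+ 2) -?exprM; last by ring.
  by rewrite ler_eXn2l //; lra.
rewrite Ex_mull e4 invfM -mulrA ler_piMr //; first by rewrite invr_ge0 ltW.
by rewrite mulrC ler_pdivrMr // mul1r.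
Qed.
End Chernoff.
End Expectation.

Lemma card_block k b n (P : pred nat) : k <= n * b ->
  #|[set j : 'I_k | P (j %/ b)]| <= count P (iota 0 n) * b.
Proof.
move=> kn; rewrite cardsE -sum1_card.
rewrite big_mkcond /= (big_ord_widen _ (fun j => if j \in [pred j : nat | P (j %/ b)] then 1 else 0) kn).
rewrite big_mkcond /=.
apply: (@leq_trans (\sum_(j < n * b) (P (j %/ b) : nat))).
  by apply: leq_sum => j _; rewrite inE; case: ifP => // _; case: (P _).
case: (posnP b) => [->|b0]; first by rewrite muln0 big_ord0.
elim: n {kn} => [|n IH]; first by rewrite mul0n big_ord0.
have -> : iota 0 n.+1 = iota 0 n ++ [:: n] by rewrite -addn1 iotaD.
rewrite mulSnr big_split_ord /= count_cat /= mulnDl addn0; apply: leq_add => //.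
rewrite (eq_bigr (fun=> (P n : nat))); last first.
  by move=> j _; rewrite divnMDl // divn_small ?addn0.
by rewrite sum_nat_const card_ord mulnC.
Qed.

(** * Success and failure probabilities of the decoder *)

Section Probs.
Variables (R : realType) (GenH : ppt) (H : dpt) (u : nat).
Hypothesis u1 : 1 < u.
Local Notation ellf := (ellf GenH H).
Local Notation hsh := (hsh GenH H).
Local Notation plain := (plain GenH H).
Local Notation bsz := (bsz GenH H).
Local Notation nb := (nb GenH H).
Local Notation nblk := (nblk GenH H u).
Local Notation blk := (blk GenH H u).
Local Notation rt := (rt GenH H u).
Local Notation ce := (ce GenH H u).
Local Notation ncop := (ncop GenH H u).
Local Notation clen := (clen GenH H u).
Local Notation root := (root GenH H).
Local Notation payld := (payld GenH H).
Local Notation encf := (encf GenH H u).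
Local Notation ndc := (ndc GenH H u).
Local Notation colf := (colf GenH H u).
Local Notation decf := (decf GenH H u).
Local Notation a := (2 ^ u).
Local Notation nbad := (nbad GenH H u).
Local Notation yb := (yb GenH H u).

Variable C : local_code.
Hypotheses (CG : Gen C = GenH) (Cn : blen C = clen)
  (Ce : forall l s x, enc C l s x = encf l s x)
  (Cd : forall l k w s i,
     bind (dec_run C l k w s i) (fun o => Ret (mem o 0, mem o 1, asked o)) = decf l k w s i).

Lemma Pr_dec l k w s i E : Pr R (dec C l k w s i) E =
  Pr R (coins (ndc l k)) (fun c => E (ohead (outf GenH H u l k s i
     [seq nth false w p | p <- posf GenH H u l k i c]))).
Proof.
have -> : dec C l k w s i = bind (decf l k w s i) (fun o => Ret (ohead o.1.1)).
  by rewrite -Cd bindA.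
by rewrite /decf bindA !Pr_Ex Ex_bind.
Qed.

Lemma every_asked l k w s i (q : nat) :
  blk l k + (if plain l k then 0 else ct l k ^ 2 * rt l k) <= q ->
  every (dec_run C l k w s i) (fun o => asked o <= q).
Proof.
move=> hq.
have : every (decf l k w s i) (fun o => o.2 <= q).
  by rewrite /decf every_bind; apply: everyT => c /=; rewrite size_posf.
by rewrite -Cd every_bind.
Qed.

Lemma dec_complete l s x i : i < size x ->
  every (dec C l (size x) (enc C l s x) s i) (fun b => b = Some (nth false x i)).
Proof.
move=> ix.
have -> : dec C l (size x) (enc C l s x) s i =
    bind (decf l (size x) (enc C l s x) s i) (fun o => Ret (ohead o.1.1)).
  by rewrite -Cd bindA.
rewrite /decf bindA every_bind; apply: everyT => c; rewrite Ce.
cbn [bind fst snd every].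
have hj := idx_lt GenH H l ix.
have sw : size (encf l s x) = clen l (size x) by exact: size_encf.
rewrite (good_dec u1 sw) //.
  by apply: (good_blk u1) => //; rewrite ham_refl muln0.
move=> np; rewrite (_ : nbad l s x (encf l s x) c = 0) ?muln0 ?expn_gt0 //.
apply/eqP; rewrite -leqn0 leqNgt -has_count; apply/hasPn => r _; rewrite negbK; apply/eqP.
by apply: (good_cop u1 sw); [exact: cidx_lt | rewrite ham_refl muln0].
Qed.

Section Word.
Variables (l : nat) (s x w : bits).
Let k := size x.
Hypothesis sw : size w = clen l k.
Hypothesis herr : 512 * (a * a * a * a) * hamming (enc C l s x) w <= clen l k.
Hypothesis hn : clen l k <= 2 * nblk l k.
Hypothesis hr : 0 < rt l k.

Let herr' : 512 * (a * a * a * a) * ham (clen l k) (encf l s x) w <= clen l k.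
Proof. by rewrite -(hamming_ham (n := clen l k)) -?Ce // Ce; exact: size_encf. Qed.

Lemma Pr_nbad : ~~ plain l k ->
  (Pr R (coins (ndc l k)) (fun c => ct l k ^ 2 <= 2 * nbad l s x w c)%N <= (2 ^+ (ct l k ^ 2))^-1)%R.
Proof.
move=> np; rewrite /ndc (negPf np).
pose P (c : bits) := zc GenH H u l x w (b2n (ncop l k) c) != root l s x.
apply: (@chernoff R (ce l k) P (ct l k ^ 2)).
have nc : ncop l k = 2 ^ ce l k by rewrite /ncop (negPf np).
rewrite Pr_Ex (@Ex_coins_b2n R (ce l k) (ncop l k) (fun r => (zc GenH H u l x w r != root l s x)%:R)%R) ?nc //.
have h := @bad_copies GenH H u u1 l s x w sw herr' hn np hr.
rewrite (@sum_count R _ (fun r => zc GenH H u l x w r != root l s x)).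
have p2 : (0 < (2 : R) ^+ ce l k)%R by rewrite exprn_gt0.
by rewrite mulrA ler_pdivrMr // mul1r -natrX -natrM ler_nat.
Qed.

(** The candidate pair depends on the received word and the index, not on the coins of the decoder.
    Unless it collides, every coin string that fools the decoder has drawn a bad majority of
    copies. *)
Lemma fool_small i : i < k ->
  (plain l k \/ ~~ (((colf l s x w (i %/ bsz l k)).1 != (colf l s x w (i %/ bsz l k)).2) &&
     (hsh l s (colf l s x w (i %/ bsz l k)).1 == hsh l s (colf l s x w (i %/ bsz l k)).2))) ->
  (Pr R (dec C l k w s i) (fun b => b \notin [:: None; Some (nth false x i)]) <= (2 ^+ (ct l k ^ 2))^-1)%R.
Proof.
move=> ik hc; rewrite Pr_dec; case: (boolP (plain l k)) hc => [p _|np [//|hc]].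
  rewrite (_ : Pr _ _ _ = 0)%R ?invr_ge0 ?exprn_ge0 //.
  rewrite Pr_Ex -[RHS](Ex_const (coins (ndc l k))); apply: Ex_eq; apply: everyT => c.
  rewrite (good_dec u1 sw) //; last by rewrite p.
    by rewrite !inE eqxx orbT.
  by apply: plain_good.
apply: le_trans (Pr_nbad np); apply: Pr_le; apply: everyT => c hf.
rewrite leqNgt; apply/negP => hb; case/negP: hc.
have [h1 h2] := fool_dec u1 sw ik np hb hf.
by rewrite h1 h2 eqxx.
Qed.

Lemma good_index i : 1 < ct l k -> i < k -> yb l x w (i %/ bsz l k) = payld l s x (i %/ bsz l k) ->
  (2 / 3 < Pr R (dec C l k w s i) (fun b => b == Some (nth false x i)))%R.
Proof.
move=> t2 ik hy; rewrite Pr_dec.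
have h c : (~~ plain l k -> 2 * nbad l s x w c < ct l k ^ 2) ->
   ohead (outf GenH H u l k s i [seq nth false w p | p <- posf GenH H u l k i c]) == Some (nth false x i).
  by move=> hb; rewrite (good_dec u1 sw ik hy hb).
case: (boolP (plain l k)) => [p|np].
  rewrite (_ : Pr _ _ _ = 1)%R; first by lra.
  rewrite Pr_Ex -[RHS](Ex_const (coins (ndc l k))); apply: Ex_eq; apply: everyT => c.
  by rewrite h // p.
have h1 : (1 - Pr R (coins (ndc l k)) (fun c => ct l k ^ 2 <= 2 * nbad l s x w c)%N <=
  Pr R (coins (ndc l k)) (fun c => ohead (outf GenH H u l k s i
     [seq nth false w p | p <- posf GenH H u l k i c]) == Some (nth false x i)))%R.
  rewrite -Pr_predC; apply: Pr_le; apply: everyT => c; rewrite -ltnNge => hb; exact: h.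
apply: lt_le_trans h1; have h2 := Pr_nbad np.
have h3 : ((2 ^+ (ct l k ^ 2))^-1 <= 1 / 4 :> R)%R.
  rewrite div1r lef_pV2 ?posrE ?exprn_gt0 // (_ : (4 : R) = 2 ^+ 2)%R; last by ring.
  by apply: ler_weXn2l; [rewrite ler1n | apply: leq_trans t2 _; rewrite -{1}[ct l k]expn1 leq_pexp2l].
lra.
Qed.

Lemma good_many (t : transcript) : 1 < ct l k -> t_seed t = s -> t_msg t = x -> t_word t = w ->
  ((1 - a%:R^-1) * k%:R <= #|Good R C l k t|%:R :> R)%R.
Proof.
move=> t2 ts tm tw; have a0 : 0 < a by rewrite expn_gt0.
pose P j := yb l x w j != payld l s x j.
have kn := nb_bsz GenH H l k.
have h1 : k - count P (iota 0 (nb l k)) * bsz l k <= #|Good R C l k t|.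
  apply: leq_trans (leq_sub2l k (card_block P kn)) _.
  rewrite leq_subLR.
  have := cardsC [set j : 'I_k | P (j %/ bsz l k)]; rewrite card_ord => e; rewrite -[X in X <= _]e leq_add2l.
  apply: subset_leq_card; apply/fintype.subsetP => j; rewrite !inE negbK => /eqP hj.
  by rewrite ts tm tw; apply: good_index.
(* Rounding up to whole blocks at most doubles the message, [nb * bsz <= 2 k], which the factor 42
   of [bad_blocks] absorbs. *)
have h2 : a * (count P (iota 0 (nb l k)) * bsz l k) <= k.
  case: (posnP k) => [k0|k0].
    by rewrite (_ : iota 0 _ = [::]) ?muln0 // /nb k0 /bsz /plain.
  case: (boolP (plain l k)) => [p|np].
    rewrite (_ : count _ _ = 0) ?mul0n ?muln0 //; apply/eqP; rewrite -leqn0 leqNgt -has_count.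
    apply/hasPn => j; rewrite mem_iota add0n (plain_nb k0 p) => /andP [_ hj]; rewrite negbK; apply/eqP.
    have := @plain_good GenH H u u1 l s x w sw herr' hn 0 k0 p.
    by rewrite div0n; case: j hj.
  have := @bad_blocks GenH H u u1 l s x w sw herr' hn; rewrite -/k -/P => hb.
  have bk : bsz l k <= k.
    move: np; rewrite /bsz /plain; case: ifP => // /negbT; rewrite -ltnNge => h _.
    apply: leq_trans (ltnW h); rewrite leq_mul2l /= leq_pexp2l //.
  have b0 := bsz_gt0 GenH H l k0.
  have := cdiv_le k b0; rewrite -/(nb l k) => hk.
  move: hb hk bk b0; set c := count _ _; move: (bsz l k) (nb l k); clearbody c; clear; clearbody k.
  move: a => z b n hb hk bk b0.
  have h : 42 * z * c * b <= n * b by rewrite leq_mul2r hb orbT.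
  have e : 42 * z * c * b = 42 * (z * (c * b)) by ring.
  move: h; rewrite e; move: (z * (c * b)) (n * b) hk; lia.
have a0' : (0 < (a%:R : R))%R by rewrite ltr0n.
rewrite mulrBl mul1r lerBlDr -(ler_pM2l a0') mulrDr mulrA mulfV ?gt_eqF // mul1r -!natrM -!natrD.
rewrite ler_nat; rewrite leq_subLR in h1; have h3 : a * k <= a * (count P (iota 0 (nb l k)) * bsz l k + #|Good R C l k t|).
  by rewrite leq_mul2l h1 orbT.
by apply: leq_trans h3 _; rewrite mulnDr addnC leq_add2l.
Qed.

End Word.
End Probs.

(** * The reduction to collisions *)

Lemma n2bK c m v : v < 2 ^ m -> 2 ^ m <= c -> b2n c (n2b m v) = v.
Proof.
elim: m v => [|m IH] v hv hc; first by rewrite /n2b /mkseq /=; case: v hv.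
have -> : n2b m.+1 v = odd v :: n2b m v./2.
  rewrite /n2b /mkseq /= (iotaDl 1 0) -map_comp; congr (_ :: _); apply: eq_map => i /=.
  by rewrite -iterSr.
have s2 : size (n2b m v./2) = m by rewrite size_mkseq.
rewrite b2n_cons ?s2 // IH; last by apply: leq_trans hc; rewrite leq_exp2l.
  by rewrite mul2n odd_double_half.
by move: hv; rewrite expnS; lia.
Qed.

(** The number of coins for guessing the message length: [2 ^ guess] exceeds [l ^ c] for positive
    [c] and [l], but is itself at most a polynomial in [l]. *)
Definition guess c l := c * (trunc_log 2 l).+1.

Lemma guess_cap c l : 2 ^ guess c l <= (2 * l + 2) ^ c.
Proof.
rewrite /guess mulnC expnM; case: c => // c; rewrite leq_exp2r // expnS.
case: (posnP l) => [->|l0]; first by rewrite trunc_log0.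
by have := @trunc_logP 2 l isT l0; lia.
Qed.

Section Red.
Variables (R : realType) (GenH : ppt) (H : dpt) (u : nat).
Hypothesis u1 : 1 < u.
Local Notation ellf := (ellf GenH H).
Local Notation hsh := (hsh GenH H).
Local Notation plain := (plain GenH H).
Local Notation bsz := (bsz GenH H).
Local Notation nb := (nb GenH H).
Local Notation nblk := (nblk GenH H u).
Local Notation blk := (blk GenH H u).
Local Notation rt := (rt GenH H u).
Local Notation clen := (clen GenH H u).
Local Notation encf := (encf GenH H u).
Local Notation ndc := (ndc GenH H u).
Local Notation colf := (colf GenH H u).
Local Notation decf := (decf GenH H u).
Local Notation a := (2 ^ u).

(** A round replayed on the given hash seed, which is also the seed of the code. The decoder is
    replaced by the extraction of a candidate collision from the attacked block. *)
Definition attack (A : channel) l k s : rand (bits * bits) :=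
  bind (exec (pick A) [:: unary l; unary k; s]) (fun o =>
  bind (exec (corrupt A) [:: unary l; unary k; s; mem o 1; encf l s (mem o 0)]) (fun o' =>
  Ret (colf l s (mem o 0) (mem o' 0) (size (mem o' 1) %/ bsz l k)))).

Lemma attack_exists (A : channel) c : exists A' : ppt, forall l s,
  bind (exec A' [:: unary l; s]) (fun o => Ret (mem o 0, mem o 1)) =
  bind (coins (guess c l)) (fun b => attack A l (b2n ((2 * l + 2) ^ c) b) s).
Proof.
pose L (ins : 2.-tuple bits) := size (nth [::] ins 0).
pose S (ins : 2.-tuple bits) := nth [::] ins 1.
have fL : fp L by rewrite /L; fpa.
have fS : fp S by rewrite /S; fpa.
pose K (q : 2.-tuple bits * bits) := b2n ((2 * L q.1 + 2) ^ c) q.2.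
have fK : fp K by rewrite /K; fpa.

have [A' hA'] : exists P : ppt, forall w (ins : 2.-tuple bits),
    bind (exec_oracle P w ins) (fun o => Ret (mem o 0, mem o 1, asked o)) =
    bind (coins (guess c (L ins))) (fun b => bind (attack A (L ins) (K (ins, b)) (S ins)) (fun o => Ret (o, 0))).
  apply: (@rp_ppt 2 (fun w ins => bind (coins (guess c (L ins))) (fun b =>
     bind (attack A (L ins) (K (ins, b)) (S ins)) (fun o => Ret (o, 0))))).
  have f1 : fp (fun ins : 2.-tuple bits => guess c (L ins)) by rewrite /guess; fpa.
  pose proof (rp_with f1 rp_toss) as r1.
  have f2 : fp (fun q : 2.-tuple bits * bits => [tuple unary (L q.1); unary (K q); S q.1]) by fpa.
  pose proof (rp_with f2 (rp_call (pick A) 3)) as r2.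
  have f3 : fp (fun q : 2.-tuple bits * bits * (bits * bits) =>
     [tuple unary (L q.1.1); unary (K q.1); S q.1.1; q.2.2; encf (L q.1.1) (S q.1.1) q.2.1]).
    by apply: fp_tuple5; try fpa; apply: fp_encf => //; fpa.
  pose proof (rp_with f3 (rp_call (corrupt A) 5)) as r3.
  have f4 : fp (fun q : 2.-tuple bits * bits * (bits * bits) * (bits * bits) =>
     colf (L q.1.1.1) (S q.1.1.1) q.1.2.1 q.2.1 (size q.2.2 %/ bsz (L q.1.1.1) (K q.1.1))).
    by apply: fp_colf => //; try fpa; apply: fp_divn; first fpa; apply: fp_bsz; fpa.
  pose proof (rp_fp f4) as r4.
  apply: rp_ext (rp_bind r1 (rp_bind r2 (rp_bind r3 r4))) => w ins.
  rewrite !bindA; apply: eq_bind => b.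
  cbn [bind fst snd]; rewrite /attack !bindA; apply: eq_bind => o.
  cbn [bind fst snd]; rewrite !bindA; apply: eq_bind => o'.
  by [].
exists A' => l s.
have := hA' [::] [tuple unary l; s].
have -> : L [tuple unary l; s] = l.
  by rewrite /L /= size_nseq.
move=> e.
have := congr1 (fun r => bind r (fun o => Ret o.1)) e.
rewrite !bindA => {}e; rewrite [LHS]e; apply: eq_bind => b; rewrite bindA bind_ret /K /=.
by rewrite /L /S /= size_nseq.
Qed.

Variable C : local_code.
Hypotheses (CG : Gen C = GenH) (Cn : blen C = clen)
  (Ce : forall l s x, enc C l s x = encf l s x)
  (Cd : forall l k w s i,
     bind (dec_run C l k w s i) (fun o => Ret (mem o 0, mem o 1, asked o)) = decf l k w s i).

Definition okp l k := [&& clen l k <= 2 * nblk l k, 0 < rt l k & 1 < ct l k].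

Variable tau : R.
Hypothesis htau : (tau * (512 * (a * a * a * a))%:R <= 1)%R.

Lemma admissible_ham l k t : admissible C l k tau t ->
  [/\ size (t_msg t) = k, size (t_word t) = clen l k &
   512 * (a * a * a * a) * hamming (enc C l (t_seed t) (t_msg t)) (t_word t) <= clen l k].
Proof.
rewrite /admissible Cn => /and3P [/eqP h1 /eqP h2 h3]; split=> //.
rewrite -(ler_nat R) natrM.
have z0 : (0 <= (512 * (a * a * a * a))%:R :> R)%R by rewrite ler0n.
apply: le_trans (ler_wpM2l z0 h3) _; rewrite mulrA (mulrC _ tau).
by rewrite ler_piMl ?ler0n.
Qed.

(** The bound is combinatorial: by [good_many] every admissible round leaves enough indices
    decodable, so the event is empty. *)
Lemma limit_bound A l k : okp l k ->
  (Pr R (round C A l k) (Limit C l k (1 - a%:R^-1) tau) <= 0)%R.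
Proof.
case/and3P=> hn hr ht.
rewrite (_ : Pr _ _ _ = Pr R (round C A l k) xpred0); first by rewrite Pr_Ex Ex_const.
rewrite !Pr_Ex; apply: Ex_eq; apply: everyT => t; congr (_%:R)%R; congr nat_of_bool.
apply/negP => /andP [/admissible_ham [h1 h2 h3]]; apply/negP; rewrite -leNgt.
rewrite -h1 in h2 h3 hn hr ht *.
by apply: (good_many R u1 Ce Cd h2 h3 hn hr ht).
Qed.

Hypothesis hell : forall l, every (output GenH [:: unary l])
     (fun s => forall x : bits, size (apply H [:: s; x]) = ellf l).

(** On the coin string encoding the true [k], the adversary replays the round exactly, and a fooled
    decoder there means a collision. This string has probability [2 ^- guess], hence the factor. *)
Lemma fool_bound A c : exists A' : ppt, forall l k gamma,
  okp l k -> k < 2 ^ guess c l -> ((2 ^+ (ct l k ^ 2))^-1 <= gamma :> R)%R ->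
  (Pr R (round C A l k) (Fool C l k gamma tau) <= 2 ^+ guess c l * collision_prob R GenH H A' l)%R.
Proof.
have [A' hA'] := attack_exists A c; exists A' => l k gamma /and3P [hn hr ht] hk hg.
pose coll s (p : bits * bits) := (p.1 != p.2) && (apply H [:: s; p.1] == apply H [:: s; p.2]).
have -> : collision_prob R GenH H A' l = Ex (fun s => Ex (fun b =>
    Ex (fun p => (coll s p)%:R)%R (attack A l (b2n ((2 * l + 2) ^ c) b) s)) (coins (guess c l)))
    (output GenH [:: unary l]).
  rewrite /collision_prob Pr_Ex Ex_bind; apply: Ex_eq; apply: everyT => s.
  have E (A0 B0 : Type) (r : rand A0) (h : A0 -> B0) (f : B0 -> R) : Ex f (bind r (fun x => Ret (h x))) = Ex (fun x => f (h x)) r.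
    by rewrite Ex_bind.
  rewrite E -(Ex_bind (coins _)) -hA' E.
  by [].
rewrite -Ex_mull /round /gen CG Pr_Ex Ex_bind; apply: Ex_le; apply: every_imp (hell l) => s hs.
have hsE x : hsh l s x = apply H [:: s; x].
  by rewrite /hsh -(hs x); exact: mkseq_nth.
pose bs := n2b (guess c l) k.
have sb : size bs = guess c l by rewrite size_mkseq.
have g0 b : (0 <= Ex (fun p => (coll s p)%:R) (attack A l (b2n ((2 * l + 2) ^ c) b) s) :> R)%R.
  by apply: Ex_ge0 => p; rewrite ler0n.
have := @Ex_coins_ge R (guess c l) (fun b =>
    Ex (fun p => (coll s p)%:R)%R (attack A l (b2n ((2 * l + 2) ^ c) b) s)) bs g0 sb.
have p2 : (0 < (2 : R) ^+ guess c l)%R by rewrite exprn_gt0.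
rewrite ler_pdivrMr // mulrC; apply: le_trans.
rewrite n2bK ?guess_cap //.
rewrite /attack !Ex_bind; apply: Ex_le; apply: everyT => o; rewrite Ce !Ex_bind.
apply: Ex_le; apply: everyT => o' /=.
rewrite ler_nat; case: (boolP (Fool _ _ _ _ _ _)) => //= /and3P [/admissible_ham /= [h1 h2 h3] hi hf].
rewrite lt0b; apply: contraLR hf => hc; rewrite -leNgt; apply: le_trans hg.
rewrite /fool_prob /= -h1 in h2 h3 hn hr ht hi hc *.
apply: (fool_small R u1 Ce Cd h2 h3 hn hr hi); right.
by rewrite !hsE.
Qed.

End Red.

(** * Asymptotics *)

Lemma trunc_log_lt2 n m : n < 2 ^ m.+1 -> trunc_log 2 n <= m.
Proof.
move=> h; case: (posnP n) => [->|n0]; first by rewrite trunc_log0.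
by rewrite -ltnS -(@ltn_exp2l 2) //; apply: leq_ltn_trans h; exact: trunc_logP.
Qed.

Lemma ct_gt l k : l + k < 2 ^ ct l k.
Proof. exact: trunc_log_ltn. Qed.

(** * Sizes for large parameters *)

Section Sizes.
Variables (GenH : ppt) (H : dpt) (u : nat).
Hypothesis u1 : 1 < u.
Local Notation ellf := (ellf GenH H).
Local Notation plain := (plain GenH H).
Local Notation bsz := (bsz GenH H).
Local Notation nb := (nb GenH H).
Local Notation hgt := (hgt GenH H).
Local Notation pay := (pay GenH H).
Local Notation cX := (cX GenH H).
Local Notation cp := (cp GenH H).
Local Notation blk := (blk GenH H u).
Local Notation nblk := (nblk GenH H u).
Local Notation rt := (rt GenH H u).
Local Notation ce := (ce GenH H u).
Local Notation ncop := (ncop GenH H u).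
Local Notation rlen := (rlen GenH H u).
Local Notation clen := (clen GenH H u).
Local Notation a := (2 ^ u).

(** The prime is the unary output of a polynomial-time function, so it is polynomially bounded and
    its logarithm is [O(t)]. *)
Lemma em_cp_le : exists2 D, 0 < D & forall l k, em (cp l k) <= D * ct l k.
Proof.
have f : fp (fun q : nat * nat => cp q.1 q.2).
  by rewrite /cp; apply: fp_nextp; apply: fp_cX; fpa.
have [d hd] := pbound_nat f; exists (4 * d).+1 => // l k.
have := hd (l, k); rewrite sz_pair !sz_nat => h.
have h2 : 2 * l + 1 + (2 * k + 1) + 1 + 2 <= 2 ^ (ct l k + 3).
  by have := ct_gt l k; rewrite expnD; lia.
apply: trunc_log_lt2; apply: leq_ltn_trans (_ : (2 ^ (ct l k + 3)) ^ d < _).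
  apply: leq_trans h _; case: d {hd} => // d; rewrite leq_exp2r //.
  by apply: leq_trans h2; lia.
rewrite -expnM ltn_exp2l // ltnS.
by have : 0 < ct l k by []; move: (ct l k); nia.
Qed.

Lemma elen_ge p B : prime p -> B <= elen u p B.
Proof.
move=> pp; have e0 := em_gt0 pp; have h := cdiv_ge B e0; rewrite -/(eK p B) in h.
have h2 := cdiv_ge (em p).+1 (aa3_gt0 u1); rewrite -/(eM u p) in h2.
apply: leq_trans h _; rewrite /elen; apply: leq_mul; first by rewrite /eN leq_addr.
apply: leq_trans (ltnW h2) _; rewrite /eL mulnC leq_mul2r leq_subr orbT //.
Qed.

Lemma elen_le D l k B : em (cp l k) <= D * ct l k ->
  elen u (cp l k) B <= 3 * B * ((4 * D + (4 + 4 * (a * a))) * ct l k).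
Proof.
move=> hD; rewrite /elen; apply: leq_mul; first by apply: (eN_le u1); exact: cp_prime.
apply: leq_trans (eL_le u1 _) _; rewrite mulnDl; apply: leq_add.
  by rewrite -mulnA leq_mul2l hD.
by rewrite leq_pmulr.
Qed.

Lemma nb_le l k : nb l k <= k.
Proof.
case: (posnP k) => [->|k0]; last by apply: cdiv_leq; exact: bsz_gt0.
by rewrite /nb /bsz /plain.
Qed.

Lemma hgt_le l k : hgt l k <= ct l k.
Proof.
rewrite /hgt; case: ifP => // _; rewrite /ct ltnS leq_trunc_log //.
by apply: leq_trans (nb_le l k) _; rewrite leq_addl.
Qed.

Lemma nb_bsz_plain l k : 0 < k -> plain l k -> nb l k * bsz l k = k.
Proof.
move=> k0 p; rewrite /nb /bsz p /cdiv; case: k k0 {p} => // m _.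
by rewrite /= divnDl ?divnn // divn_small // addn0 mul1n.
Qed.

(** The padding is less than one block of [(ell + 1) t ^ 2] bits, while a message that is not plain
    has more than [(ell + 1) t ^ 4]. *)
Lemma nb_bsz_le l k : 0 < k -> ct l k ^ 2 * (nb l k * bsz l k - k) <= k.
Proof.
move=> k0; case: (boolP (plain l k)) => p; first by rewrite nb_bsz_plain // subnn muln0.
have := cdiv_le k (bsz_gt0 GenH H l k0); rewrite -/(nb l k) => h.
have h2 : nb l k * bsz l k - k <= bsz l k by lia.
apply: leq_trans (leq_mul (leqnn _) h2) _.
have := p; rewrite /plain -ltnNge => h3; apply: leq_trans (ltnW h3).
by rewrite /bsz (negPf p) (_ : 4 = 2 + 2) // expnD; apply: eq_leq; ring.
Qed.

(** The path has at most [2 t ell] bits against [(ell + 1) t ^ 2] bits of data, a relative cost of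
    at most [2 / t]. *)
Lemma pay_bsz v l k : 2 * v <= ct l k -> v * (pay l k - bsz l k) <= bsz l k.
Proof.
move=> hv; rewrite /pay addKn.
case: (boolP (plain l k)) => p; first by rewrite /hgt p mul0n muln0.
rewrite /bsz (negPf p).
apply: (@leq_trans (v * (ct l k * (2 * ellf l)))).
  by rewrite leq_mul2l leq_mul2r hgt_le !orbT.
rewrite (_ : v * _ = ellf l * (2 * v * ct l k)); last by ring.
by apply: leq_mul => //; rewrite expnS expn1 leq_mul2r hv orbT.
Qed.

Lemma bsz_ge l k : ct l k ^ 2 <= k -> ct l k ^ 2 <= bsz l k.
Proof. by move=> h; rewrite /bsz; case: ifP => // _; rewrite leq_pmull. Qed.

Lemma pay_ge l k : bsz l k <= pay l k. Proof. exact: leq_addr. Qed.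

Lemma pay_em D v l k : em (cp l k) <= D * ct l k -> v * D <= ct l k -> ct l k ^ 2 <= k ->
  v * em (cp l k) <= pay l k.
Proof.
move=> hD hv hk; apply: leq_trans (pay_ge l k); apply: leq_trans (bsz_ge hk).
apply: (@leq_trans (v * (D * ct l k))); first by rewrite leq_mul2l hD orbT.
by rewrite mulnA expnS expn1 leq_mul2r hv orbT.
Qed.

Lemma nblk_ge l k : k <= nblk l k.
Proof.
apply: leq_trans (nb_bsz GenH H l k) _; rewrite leq_mul2l; apply/orP; right.
apply: leq_trans (pay_ge l k) _; apply: elen_ge; exact: cp_prime.
Qed.

(** For large [t] a copy of the root fits into the part reserved for copies, and then so do all of
    them. For small parameters the maximum in [rlen] makes room, as decoding of intact words must
    succeed for every [l]. *)
Lemma rlenE D l k : em (cp l k) <= D * ct l k ->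
  3 * a * (4 * D + (4 + 4 * (a * a))) <= ct l k -> rlen l k = cdiv (nblk l k) a.
Proof.
move=> hD hW; rewrite /rlen; apply/maxn_idPl; rewrite /ncop.
case: (boolP (plain l k)) => p //.
have a0 : 0 < a by rewrite expn_gt0.
have h1 : rt l k * a <= nblk l k.
  have := p; rewrite /plain -ltnNge => hk.
  apply: leq_trans (nblk_ge l k); apply: leq_trans (ltnW hk).
  apply: leq_trans (leq_mul (elen_le (ellf l) hD) (leqnn a)) _.
  move: hW; move: (4 * D + _) (ct l k) (ellf l) => z t e; move: a => b hW.
  apply: (@leq_trans (e * (t * t))).
    by rewrite (_ : _ * b = e * (3 * b * z * t)); [rewrite leq_mul2l leq_mul2r hW !orbT | ring].
  apply: leq_mul => //; case: t {hW} => // t.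
  by rewrite mulnn leq_pexp2l.
have h2 : rt l k <= cdiv (nblk l k) a.
  rewrite -(leq_pmul2r a0); apply: leq_trans h1 _; exact: cdiv_ge.
case: (posnP (rt l k)) => [->|r0]; first by rewrite muln0.
have q0 : 0 < cdiv (nblk l k) a %/ rt l k by rewrite divn_gt0.
apply: (@leq_trans (cdiv (nblk l k) a %/ rt l k * rt l k)); last exact: leq_divM.
by rewrite leq_mul2r trunc_logP ?orbT.
Qed.

Lemma clen_le D l k : em (cp l k) <= D * ct l k ->
  3 * a * (4 * D + (4 + 4 * (a * a))) <= ct l k -> clen l k <= 2 * nblk l k.
Proof.
move=> hD hW; rewrite /clen (rlenE hD hW) mul2n -addnn leq_add2l.
by apply: cdiv_leq; rewrite expn_gt0.
Qed.

Lemma rt_gt0 l k : 0 < ellf l -> 0 < rt l k.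
Proof. by move=> h; apply: leq_trans h _; apply: elen_ge; exact: cp_prime. Qed.

Lemma queries_le D l k : em (cp l k) <= D * ct l k -> 0 < ellf l ->
  blk l k + (if plain l k then 0 else ct l k ^ 2 * rt l k) <=
  24 * (4 * D + (4 + 4 * (a * a))) * ct l k ^ 5 * ellf l.
Proof.
move=> hD e0; have t0 : 0 < ct l k by [].
have hb := elen_le (pay l k) hD; have hr := elen_le (ellf l) hD.
have hp : pay l k <= 3 * (2 * ellf l) * ct l k ^ 4.
  rewrite /pay; apply: (@leq_trans ((ellf l).+1 * ct l k ^ 4 + ct l k ^ 4 * (2 * ellf l))).
    apply: leq_add.
      rewrite /bsz; case: ifP => // _; by rewrite leq_mul2l leq_pexp2l ?orbT.
    by rewrite leq_mul2r (leq_trans (hgt_le l k)) ?orbT // -{1}[ct l k]expn1 leq_pexp2l.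
  have e1 : (ellf l).+1 <= 2 * ellf l by lia.
  move: (leq_mul e1 (leqnn (ct l k ^ 4))); move: (ellf l) (ct l k ^ 4) => e t h.
  apply: leq_trans (leq_add h (leqnn _)) _.
  by rewrite (_ : 3 * _ * _ = 2 * e * t + t * (2 * e) + 2 * e * t); [exact: leq_addr | ring].
set z := 4 * D + _ in hb hr *.
apply: (@leq_trans (3 * (3 * (2 * ellf l) * ct l k ^ 4) * (z * ct l k) + ct l k ^ 4 * (3 * ellf l * (z * ct l k)))).
  apply: leq_add.
    by apply: leq_trans hb _; rewrite leq_mul2r leq_mul2l hp !orbT.
  case: ifP => // _; apply: leq_mul => //; by rewrite leq_pexp2l.
rewrite (_ : 5 = 4 + 1) // expnD expn1; apply: (@leq_trans (21 * z * (ct l k ^ 4 * ct l k) * ellf l)).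
  by apply: eq_leq; ring.
by rewrite !leq_mul2r ?orbT.
Qed.

End Sizes.

From mathcomp Require Import classical_sets reals topology normedtype sequences.
Require Import Defs.
Import numFieldNormedType.Exports.
Local Open Scope classical_set_scope.
Local Open Scope ring_scope.

Lemma nearE_nat (P : nat -> Prop) :
  (\forall l \near \oo, P l) <-> exists N, forall l, (N <= l)%N -> P l.
Proof.
split=> [[N _ h]|[N h]]; first by exists N => l; exact: h.
by exists N => // l; exact: h.
Qed.

Lemma near_lg W : \forall l \near \oo, (W <= trunc_log 2 l)%N.
Proof. by apply/nearE_nat; exists (2 ^ W)%N => l; exact: trunc_log_max. Qed.

(** * One negligible bound for all adversaries *)

Section Dominate.
Variables (R : realType) (g : nat -> nat -> R).
Hypothesis g_neg : forall i, negligible_fun (g i).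

(* Beyond [N j], the functions [g 0], ..., [g j] are all below [l ^- j]; the
   bound at [l] uses the largest such [j <= l]. *)
Lemma dominating : exists2 mu : nat -> R, negligible_fun mu &
  forall i, \forall l \near \oo, `|g i l| <= mu l.
Proof.
have hN j : exists N, forall l i, (N <= l)%N -> (i <= j)%N -> `|g i l| <= (l%:R ^+ j)^-1.
  have {}h i : exists N, forall l, (N <= l)%N -> `|g i l| <= (l%:R ^+ j)^-1.
    by apply/nearE_nat; exact: g_neg.
  pose N i := projT1 (cid (h i)).
  exists (\max_(i < j.+1) N i)%N => l i hl ij.
  apply: (projT2 (cid (h i))); apply: leq_trans hl.
  exact: (@leq_bigmax _ (fun i : 'I_j.+1 => N i) (Ordinal (ij : (i < j.+1)%N))).
pose N j := projT1 (cid (hN j)).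
have hNN j l i : (N j <= l)%N -> (i <= j)%N -> `|g i l| <= (l%:R ^+ j)^-1.
  exact: (projT2 (cid (hN j))).
pose J l := (\max_(j in [pred j : 'I_l.+1 | N j <= l]) j)%N.
have J_ge j l : (j <= l)%N -> (N j <= l)%N -> (j <= J l)%N.
  move=> jl Nj; exact: (@leq_bigmax_cond _ [pred j : 'I_l.+1 | N j <= l]%N (fun j => nat_of_ord j) (Ordinal (jl : (j < l.+1)%N))).
have J_ok l : (N 0 <= l)%N -> (N (J l) <= l)%N.
  move=> N0.
  have c0 : (0 < #|[pred j : 'I_l.+1 | N j <= l]%N|)%N.
    by apply/card_gt0P; exists ord0; rewrite inE.
  by have [j + e] := eq_bigmax_cond (fun j : 'I_l.+1 => nat_of_ord j) c0; rewrite inE /J e.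
exists (fun l => (l%:R ^+ J l)^-1) => [c|i]; apply/nearE_nat.
  exists (maxn 1 (maxn c (N c))) => l; rewrite !geq_max => /and3P [l1 lc lN].
  rewrite ger0_norm ?invr_ge0 ?exprn_ge0 // lef_pV2 ?posrE ?exprn_gt0 ?ltr0n //.
  by apply: ler_weXn2l; [rewrite ler1n | exact: J_ge].
exists (maxn (N 0) (maxn i (N i))) => l; rewrite !geq_max => /and3P [l0 li lN].
by apply: hNN; [exact: J_ok | exact: J_ge].
Qed.
End Dominate.

Fixpoint cmd_tree (c : cmd) : GenTree.tree nat :=
  match c with
  | Skip => GenTree.Node 0 [::]
  | Seq c1 c2 => GenTree.Node 1 [:: cmd_tree c1; cmd_tree c2]
  | Push x b => GenTree.Node 2 [:: GenTree.Leaf x; GenTree.Leaf (nat_of_bool b)]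
  | Pop x => GenTree.Node 3 [:: GenTree.Leaf x]
  | Case x c0 c1 c2 => GenTree.Node 4 [:: GenTree.Leaf x; cmd_tree c0; cmd_tree c1; cmd_tree c2]
  | While x c1 => GenTree.Node 5 [:: GenTree.Leaf x; cmd_tree c1]
  | Toss x => GenTree.Node 6 [:: GenTree.Leaf x]
  | Query a x => GenTree.Node 7 [:: GenTree.Leaf a; GenTree.Leaf x]
  end.

Lemma cmd_tree_inj : injective cmd_tree.
Proof.
elim=> [|c1 IH1 c2 IH2|x b|x|x c0 IH0 c1 IH1 c2 IH2|x c1 IH1|x|a x] [|d1 d2|y d|y|y d0 d1 d2|y d1|y|z y] //=.
- by case=> /IH1 -> /IH2 ->.
- by case=> -> /eqP; case: b; case: d.
- by case=> ->.
- by case=> -> /IH0 -> /IH1 -> /IH2 ->.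
- by case=> -> /IH1 ->.
- by case=> ->.
- by case=> -> ->.
Qed.

(** The proof of halting is left out of the code: program text and degree already determine all
    runs. *)
Definition ppt_code (A : ppt) := pickle (cmd_tree (code A), deg A).

Lemma ppt_code_inj A B : ppt_code A = ppt_code B -> code A = code B /\ deg A = deg B.
Proof. by move=> /(pcan_inj pickleK) [/cmd_tree_inj -> ->]. Qed.

Section Crhf.
Variables (R : realType) (GenH : ppt) (H : dpt) (ell : nat -> nat).
Hypothesis crH : crhf R GenH H ell.

Lemma collision_prob_code A B l : ppt_code A = ppt_code B ->
  collision_prob R GenH H A l = collision_prob R GenH H B l.
Proof.
move=> /ppt_code_inj [e1 e2]; rewrite /collision_prob.
by have -> : exec A = exec B by rewrite /exec /exec_oracle e1 e2.
Qed.

Lemma negligible_mulX (f : nat -> R) c : negligible_fun f -> negligible_fun (fun l => l%:R ^+ c * f l).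
Proof.
move=> h d; have /nearE_nat [N hN] := h (c + d)%N; apply/nearE_nat; exists (maxn 1 N) => l.
rewrite geq_max => /andP [l1 /hN]; rewrite normrM ger0_norm ?exprn_ge0 // => hl.
have p k : 0 < (l%:R : R) ^+ k by rewrite exprn_gt0 // ltr0n.
apply: le_trans (ler_wpM2l (ltW (p c)) hl) _.
by rewrite exprD invfM mulrA mulfV ?gt_eqF // mul1r.
Qed.

Lemma negligible0 : negligible_fun (fun=> 0 : R).
Proof. by move=> c; apply/nearE_nat; exists 0 => l _; rewrite normr0 invr_ge0 exprn_ge0. Qed.

Lemma mu_exists : exists2 mu : nat -> R, negligible_fun mu & forall A c,
  \forall l \near \oo, l%:R ^+ c * collision_prob R GenH H A l <= mu l.
Proof.
(* Each natural number is read as the code of a program; numbers that code none get the zero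
   function. *)
pose f i := if pselect (exists A, ppt_code A = i) is left h then collision_prob R GenH H (projT1 (cid h)) else fun=> 0.
have fE A : f (ppt_code A) = collision_prob R GenH H A.
  rewrite /f; case: pselect => [h|]; last by case; exists A.
  by apply/funext => l; apply: collision_prob_code; exact: (projT2 (cid h)).
have fN i : negligible_fun (f i).
  by rewrite /f; case: pselect => [h|_]; [exact: crH.2 | exact: negligible0].
pose g i := if unpickle i is Some (j, c) then fun l => l%:R ^+ c * f j l else fun=> 0.
have gN i : negligible_fun (g i).
  by rewrite /g; case: unpickle => [[j c]|]; [exact: negligible_mulX | exact: negligible0].
have [mu nmu hmu] := dominating gN; exists mu => // A c.
have := hmu (pickle (ppt_code A, c)); apply: filterS => l.
rewrite /g pickleK fE; apply: le_trans; exact: ler_norm.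
Qed.

Lemma ellE l : ell l = ellf GenH H l.
Proof. by rewrite /ellf; have /every_value -> := crH.1 l. Qed.

(** With hash length 0 any two strings collide, so the program that always outputs [[:: true]] and
    [[::]] would win with probability 1. *)
Lemma ell_gt0 : \forall l \near \oo, (0 < ell l)%N.
Proof.
have [A hA] : exists A : ppt, forall w (ins : 2.-tuple bits),
    bind (exec_oracle A w ins) (fun o => Ret (mem o 0, mem o 1, asked o)) = Ret ([:: true], [::], 0%N).
  apply: (@rp_ppt 2 (fun w ins => Ret ([:: true], [::], 0%N))).
  apply: (rp_fp (f := fun _ : 2.-tuple bits => ([:: true], [::] : bits))); fpa.
have /nearE_nat [N hN] := crH.2 A 1%N; apply/nearE_nat; exists (maxn 2 N) => l.
rewrite geq_max => /andP [l2 /hN h]; rewrite lt0n; apply/negP => /eqP e0.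
move: h; rewrite (_ : collision_prob R GenH H A l = 1); last first.
  rewrite /collision_prob Pr_Ex Ex_bind -[RHS](Ex_const (output GenH [:: unary l])).
  apply: Ex_eq; apply: every_imp (crH.1 l) => s hs.
  have E (f : bits * bits -> R) : Ex (fun o => f (mem o 0, mem o 1)) (exec A [:: unary l; s]) = f ([:: true], [::]).
    have := congr1 (Ex (fun o => f o.1)) (hA [::] [tuple unary l; s]).
    by rewrite Ex_bind.
  rewrite Ex_bind; rewrite (E (fun p => ((p.1 != p.2) && (apply H [:: s; p.1] == apply H [:: s; p.2]))%:R)) /=.
  have z x : apply H [:: s; x] = [::] by apply: size0nil; rewrite hs.
  by rewrite !z.
rewrite normr1 expr1 => h.
have : (1 : R) * l%:R <= 1 by rewrite -ler_pdivlMr ?div1r // ltr0n; lia.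
by rewrite mul1r lern1; lia.
Qed.
End Crhf.

(** The failure bound [2 ^- (t ^ 2)] with [t] computed from [l] alone, because gamma is fixed before
    the message length is known. *)
Definition gam (R : realType) l : R := (2 ^+ ((trunc_log 2 l).+1 ^ 2))^-1.

Lemma gam_negligible (R : realType) : negligible_fun (gam R).
Proof.
move=> c; have := near_lg c; apply: filterS2 (nbhs_infty_ge 1) => l l1 hc.
rewrite ger0_norm ?invr_ge0 ?exprn_ge0 // lef_pV2 ?posrE ?exprn_gt0 ?ltr0n //.
rewrite -!natrX ler_nat; apply: leq_trans (_ : (2 ^ ((trunc_log 2 l).+1 * c) <= _)%N).
  by rewrite expnM; case: c {hc} => // c; rewrite leq_exp2r // ltnW // trunc_log_ltn.
by rewrite leq_exp2l // expnS expn1 leq_mul2l ltnW.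
Qed.

(** Every loss of rate that disappears has this form: a size [x] is rounded up or extended to [y],
    at a relative cost of at most [1 / v]. *)
Lemma ratio_cvg1 (R : realType) (x y v : nat -> nat) :
  (\forall l \near \oo, [&& 0 < x l, x l <= y l & v l * (y l - x l) <= x l]%N) ->
  (forall W, \forall l \near \oo, (W <= v l)%N) ->
  (x l)%:R / (y l)%:R @[l --> \oo] --> (1 : R).
Proof.
move=> h hv; apply/cvgrPdist_le => e e0.
have := hv (Num.truncn e^-1).+1; apply: filterS2 h => l /and3P [x0 xy vx] hW.
have y0 : 0 < ((y l)%:R : R) by rewrite ltr0n; exact: leq_trans x0 xy.
have -> : 1 - (x l)%:R / (y l)%:R = (y l - x l)%:R / (y l)%:R :> R.
  by rewrite natrB // mulrBl divff ?gt_eqF.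
rewrite ger0_norm ?divr_ge0 ?ler0n // ler_pdivrMr //.
have ie : e^-1 <= (v l)%:R.
  apply: le_trans (_ : (Num.truncn e^-1).+1%:R <= _); last by rewrite ler_nat.
  have e1 : 0 <= e^-1 by rewrite invr_ge0 ltW.
  by have /andP [_ /ltW] := truncn_itv e1.
have h2 : (v l)%:R * (y l - x l)%:R <= (y l)%:R :> R by rewrite -natrM ler_nat (leq_trans vx).
have h3 : e^-1 * (y l - x l)%:R <= (y l)%:R.
  by apply: le_trans h2; rewrite ler_wpM2r ?ler0n.
by rewrite -(ler_pM2l (_ : 0 < e^-1)) ?invr_gt0 // mulrA mulVf ?gt_eqF // mul1r.
Qed.

(** The rate as a telescoping product: padding, paths, division into symbols, outer code, inner
    code, root part. The factors are written in terms of ratios that tend to 1, so the limit follows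
    by continuity. *)
Lemma rate_factors (F : realFieldType) (k n b p K m E M cd a A N : F) :
  0 < k -> 0 < n -> 0 < b -> 0 < p -> 0 < K -> 0 < m -> 0 < E -> 0 < M -> 0 < cd -> 0 < a -> 0 < A ->
  N = n * ((K + 2 * E) * (a * a * M)) ->
  k / (N + cd) = k / (n * b) * (b / p) * (p / (K * m)) * (1 + 2 / a * (K / (a * E))^-1)^-1 *
    (A / (a * a) * (m / (M * A)) * (1 + a^-1 * (N / (a * cd))^-1)^-1).
Proof.
move=> k0 n0 b0 p0 K0 m0 E0 M0 c0 a0 A0 NE.
have N0 : 0 < N by rewrite NE !mulr_gt0 // addr_gt0 // mulr_gt0.
have -> : (1 + 2 / a * (K / (a * E))^-1)^-1 = K / (K + 2 * E).
  by field; rewrite !gt_eqF // addr_gt0 // mulr_gt0.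
have -> : (1 + a^-1 * (N / (a * cd))^-1)^-1 = N / (N + cd).
  by field; rewrite !gt_eqF // addr_gt0.
have Nc : N + cd != 0 by rewrite gt_eqF // addr_gt0.
move: Nc; rewrite NE => Nc; field.
by rewrite Nc !gt_eqF // addr_gt0 // mulr_gt0.
Qed.

Lemma rate_limit (F : realFieldType) (a : F) : 0 < a ->
  (1 - 3 / a) / ((1 + 2 / a) * (1 + 1 / a)) =
  1 * 1 * 1 * (1 + 2 / a * 1^-1)^-1 * ((a * a - 3 * a) / (a * a) * 1 * (1 + a^-1 * 1^-1)^-1).
Proof. by move=> a0; field; rewrite !gt_eqF //; lra. Qed.

Lemma lg_sqr_small C x : (16 * C <= x %/ 4)%N -> (C * x ^ 2 <= 2 ^ x)%N.
Proof.
move=> h; set y := (x %/ 4)%N in h.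
have hx : (x <= 4 * 2 ^ y)%N.
  have := ltn_ceil x (isT : (0 < 4)%N); have := ltn_expl y (isT : (1 < 2)%N); rewrite -/y; lia.
have h4 : (2 ^ (y + y + (y + y)) <= 2 ^ x)%N.
  by rewrite leq_exp2l //; have := leq_divM x 4; rewrite -/y; lia.
apply: leq_trans h4; rewrite !expnD.
have hC : (16 * C <= 2 ^ y * 2 ^ y)%N.
  apply: leq_trans h _; apply: leq_trans (ltnW (ltn_expl y (isT : (1 < 2)%N))) _.
  by rewrite leq_pmulr // expn_gt0.
apply: (@leq_trans (C * (4 * 2 ^ y * (4 * 2 ^ y)))%N).
  by rewrite leq_mul2l expnS expn1 leq_mul ?orbT.
by rewrite (_ : (C * _ = 16 * C * (2 ^ y * 2 ^ y))%N); [rewrite leq_mul2r hC orbT | ring].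
Qed.

Section Poly.
Variables (k : nat -> nat) (c : nat).
Hypothesis hk : \forall l \near \oo, ((l <= k l ^ c) && (k l <= l ^ c))%N.

Lemma near_k W : \forall l \near \oo, (W <= k l)%N.
Proof.
apply: filterS2 hk (nbhs_infty_ge (W ^ c).+1) => l /andP [h1 _] h2.
rewrite leqNgt; apply/negP => h; move: h2; rewrite ltnNge; case/negP.
by apply: leq_trans h1 _; case: c => // d; rewrite leq_exp2r // ltnW.
Qed.

Lemma near_lgk W : \forall l \near \oo, (W <= trunc_log 2 (k l))%N.
Proof. by apply: filterS (near_k (2 ^ W)) => l; exact: trunc_log_max. Qed.

Lemma near_ct : \forall l \near \oo, forall n, (k l <= n)%N ->
  (ct l (k l) <= (2 * c + 3) * trunc_log 2 n)%N.
Proof.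
apply: filterS3 hk (near_k 1) (near_lgk 1) => l /andP [h1 _] k1 g1 n kn.
have gn : (1 <= trunc_log 2 n)%N by apply: leq_trans g1 _; exact: leq_trunc_log.
have h2 : (l + k l < 2 ^ (c.+1 * (trunc_log 2 n).+1).+1)%N.
  have hn : (k l < 2 ^ (trunc_log 2 n).+1)%N by apply: leq_ltn_trans kn _; exact: trunc_log_ltn.
  have a1 : (k l ^ c <= k l ^ c.+1)%N by rewrite leq_pexp2l.
  have a2 : (k l <= k l ^ c.+1)%N by rewrite -{1}[k l]expn1 leq_pexp2l.
  have a3 : (k l ^ c.+1 < (2 ^ (trunc_log 2 n).+1) ^ c.+1)%N by rewrite ltn_exp2r.
  by move: a3; rewrite -expnM (mulnC _ c.+1) (expnS 2 (c.+1 * _)); lia.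
have := trunc_log_lt2 h2; rewrite -/(ct l (k l)) /ct.
move: (trunc_log 2 n) gn (trunc_log 2 (l + k l)) => g gn t; nia.
Qed.

Lemma near_ct_sqr : \forall l \near \oo, (ct l (k l) ^ 2 <= k l)%N.
Proof.
apply: filterS3 near_ct (near_lgk (4 * (16 * (2 * c + 3) ^ 2))) (near_k 1) => l h hg k1.
have h1 := h _ (leqnn (k l)).
apply: (@leq_trans ((2 * c + 3) ^ 2 * trunc_log 2 (k l) ^ 2)%N); first by rewrite -expnMn leq_exp2r.
apply: leq_trans (lg_sqr_small _) (trunc_logP (isT : (1 < 2)%N) k1).
by rewrite leq_divRL // mulnC.
Qed.

Lemma near_ct_ge W : \forall l \near \oo, (W <= ct l (k l))%N.
Proof.
apply: filterS (near_lg W) => l h; apply: leq_trans h _; apply: leqW.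
by apply: leq_trunc_log; exact: leq_addr.
Qed.

Section Rate.
Variables (R : realType) (GenH : ppt) (H : dpt) (u : nat).
Hypothesis u1 : (1 < u)%N.
Local Notation a := (2 ^ u)%N.
Local Notation K l := (eK (cp GenH H l (k l)) (pay GenH H l (k l))).
Local Notation E l := (eE u (cp GenH H l (k l)) (pay GenH H l (k l))).
Local Notation m l := (em (cp GenH H l (k l))).
Local Notation M l := (eM u (cp GenH H l (k l))).

Definition rate : R := (1 - 3 / a%:R) / ((1 + 2 / a%:R) * (1 + 1 / a%:R)).

Lemma cvg_rate : (k l)%:R / (clen GenH H u l (k l))%:R @[l --> \oo] --> rate.
Proof.
have [D D0 hD] := em_cp_le GenH H u1.
have a4 := four_le_pow u1.
have a0 : (0 < a)%N by apply: leq_trans a4.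
(* [v] is a common speed of convergence for the six ratios. [W] dominates the constants 2, [D], [a],
   [a ^ 2] and [a D] by which it is multiplied there. *)
pose W := (2 * D * a * a)%N; have W0 : (0 < W)%N by rewrite !muln_gt0 a0 D0.
pose v l := (trunc_log 2 l %/ W)%N.
have hv W' : \forall l \near \oo, (W' <= v l)%N.
  by apply: filterS (near_lg (W' * W)) => l h; rewrite leq_divRL.
have vct l z : (z <= W)%N -> (v l * z <= trunc_log 2 l)%N.
  by move=> h; apply: leq_trans (leq_divM _ W); rewrite leq_mul2l h orbT.
have lct l : (trunc_log 2 l <= ct l (k l))%N.
  by apply: leqW; apply: leq_trunc_log; exact: leq_addr.
have W2 : (2 <= W)%N by rewrite /W -!mulnA leq_pmulr // !muln_gt0 D0 a0.
have WD : (D <= W)%N by rewrite /W (_ : 2 * D * a * a = D * (2 * a * a))%N; [rewrite leq_pmulr // !muln_gt0 a0 | ring].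
have Wa : (a <= W)%N by rewrite /W leq_pmull // !muln_gt0 D0 a0.
have Wa2 : (a * a <= W)%N by rewrite /W -mulnA leq_pmull // !muln_gt0 D0.
have WaD : (a * D <= W)%N by rewrite /W (_ : 2 * D * a * a = a * D * (2 * a))%N; [rewrite leq_pmulr // !muln_gt0 a0 | ring].
have m0 l : (0 < m l)%N by apply: em_gt0; exact: cp_prime.
have A3 := aa3_gt0 u1.
have pay_ge l z : (ct l (k l) ^ 2 <= k l)%N -> (z * D <= W)%N -> (v l * z * m l <= pay GenH H l (k l))%N.
  move=> h hz; apply: (pay_em (hD _ _)) => //; rewrite -mulnA; exact: leq_trans (vct _ _ hz) (lct l).
have sqr_ct l : (v l * a <= ct l (k l) ^ 2)%N.
  by apply: leq_trans (vct _ _ Wa) (leq_trans (lct l) _); rewrite -{1}[ct l (k l)]expn1 leq_pexp2l.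
have f1 : (k l)%:R / (nb GenH H l (k l) * bsz GenH H l (k l))%:R @[l --> \oo] --> (1 : R).
  apply: (ratio_cvg1 (v := v)) => //; apply: filterS (near_k 1) => l k1.
  rewrite k1 nb_bsz /=; apply: leq_trans (nb_bsz_le GenH H u1 l k1); rewrite leq_mul2r.
  by rewrite (leq_trans _ (sqr_ct l)) ?orbT // leq_pmulr.
have f2 : (bsz GenH H l (k l))%:R / (pay GenH H l (k l))%:R @[l --> \oo] --> (1 : R).
  apply: (ratio_cvg1 (v := v)) => //; apply: filterS (near_k 1) => l k1.
  rewrite bsz_gt0 //= leq_addr /=; apply: pay_bsz; rewrite mulnC; exact: leq_trans (vct _ _ W2) (lct l).
have f3 : (pay GenH H l (k l))%:R / (K l * m l)%:R @[l --> \oo] --> (1 : R).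
  apply: (ratio_cvg1 (v := v)) => //; apply: filterS2 (near_k 1) near_ct_sqr => l k1 h.
  have b0 := leq_trans (bsz_gt0 GenH H l k1) (leq_addr _ _ : (_ <= pay GenH H l (k l))%N).
  have h1 := cdiv_ge (pay GenH H l (k l)) (m0 l); have h2 := cdiv_le (pay GenH H l (k l)) (m0 l).
  rewrite b0 h1 /=; apply: leq_trans (pay_ge l 1%N h _); last by rewrite mul1n.
  by rewrite muln1 leq_mul2l; apply/orP; right; rewrite /eK; lia.
have Kge l : (ct l (k l) ^ 2 <= k l)%N -> (v l * a <= K l)%N.
  move=> h; rewrite -(leq_pmul2r (m0 l)); apply: leq_trans (pay_ge l a h WaD) _.
  exact: cdiv_ge.
have f4 : (K l)%:R / (a * E l)%:R @[l --> \oo] --> (1 : R).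
  apply: (ratio_cvg1 (v := v)) => //; apply: filterS2 (hv 1%N) near_ct_sqr => l v1 h.
  have h0 := Kge l h.
  have h1 := cdiv_ge (K l) a0; have h2 := cdiv_le (K l) a0; rewrite -/(E l) mulnC in h1 h2.
  rewrite h1 (leq_trans _ h0) ?muln_gt0 ?v1 //=; apply: leq_trans h0; rewrite leq_mul2l; lia.
have f5 : (m l)%:R / (M l * (a * a - 3 * a))%:R @[l --> \oo] --> (1 : R).
  apply: (ratio_cvg1 (v := v)) => //; apply: nearW => l.
  have h1 := cdiv_ge (m l).+1 A3; have h2 := cdiv_le (m l).+1 A3; rewrite -/(M l) in h1 h2.
  rewrite m0 ltnW //=; apply: (@leq_trans (v l * (a * a))%N); first by rewrite leq_mul2l; lia.
  apply: leq_trans (vct _ _ Wa2) _; apply: leq_trunc_log; apply: ltnW.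
  by apply: leq_ltn_trans (cp_gt GenH H _ _); rewrite /cX; lia.
have f6 : (nblk GenH H u l (k l))%:R / (a * cdiv (nblk GenH H u l (k l)) a)%:R @[l --> \oo] --> (1 : R).
  apply: (ratio_cvg1 (v := v)) => //; apply: filterS2 (near_k 1) near_ct_sqr => l k1 h.
  have h0 := nblk_ge GenH H u1 l (k l).
  have h1 := cdiv_ge (nblk GenH H u l (k l)) a0; have h2 := cdiv_le (nblk GenH H u l (k l)) a0.
  rewrite (mulnC a) h1 (leq_trans k1 h0) /=.
  apply: leq_trans (leq_trans (sqr_ct l) (leq_trans h h0)); rewrite leq_mul2l; lia.
have aR : (a%:R : R) != 0 by rewrite pnatr_eq0; lia.
pose proof (cvgV (oner_neq0 R) f4) as i4; pose proof (cvgV (oner_neq0 R) f6) as i6.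
have ar : 1 + 2 / a%:R * 1^-1 != 0 :> R by rewrite gt_eqF // addr_gt0 // mulr_gt0 // ?invr_gt0 ?mulr_gt0 ?invr_gt0 ?ltr0n.
have br : 1 + a%:R^-1 * 1^-1 != 0 :> R by rewrite gt_eqF // addr_gt0 // mulr_gt0 // ?invr_gt0 ?ltr0n.
pose proof (cvgV ar (cvgD (cvg_cst (1 : R)) (cvgM (cvg_cst (2 / a%:R : R)) i4))) as g4.
pose proof (cvgV br (cvgD (cvg_cst (1 : R)) (cvgM (cvg_cst (a%:R^-1 : R)) i6))) as g6.
pose proof (cvgM (cvg_cst ((a * a - 3 * a)%:R / (a * a)%:R : R)) f5) as g5.
pose proof (cvgM (cvgM (cvgM (cvgM f1 f2) f3) g4) (cvgM g5 g6)) as G.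
have -> : rate = 1 * 1 * 1 * (1 + 2 / a%:R * 1^-1)^-1 * ((a * a - 3 * a)%:R / (a * a)%:R * 1 * (1 + a%:R^-1 * 1^-1)^-1).
  have le : (3 * a <= a * a)%N by rewrite leq_mul2r; lia.
  by rewrite /rate natrB // !natrM; apply: rate_limit; rewrite ltr0n.
apply: cvg_trans G; apply: near_eq_cvg.
apply: filterS3 (near_k 1) (near_ct_ge (3 * a * (4 * D + (4 + 4 * (a * a))))) (filterI near_ct_sqr (hv 1%N)) => l k1 ht [hs v1] /=.
rewrite /clen (rlenE u1 (hD _ _) ht).
have b0 := bsz_gt0 GenH H l k1.
have n0 : (0 < nb GenH H l (k l))%N by have := nb_bsz GenH H l (k l); case: (nb _ _ _ _) => //; rewrite mul0n; lia.
have p0 : (0 < pay GenH H l (k l))%N := leq_trans b0 (leq_addr _ _).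
have K0 : (0 < K l)%N by apply: leq_trans (Kge l hs); rewrite muln_gt0 v1.
have E0 : (0 < E l)%N by have := cdiv_ge (K l) a0; rewrite -/(E l); case: (E l) => //; rewrite mul0n; lia.
have M0 : (0 < M l)%N by apply: eM_gt0.
have N0 : (0 < nblk GenH H u l (k l))%N := leq_trans k1 (nblk_ge GenH H u1 l (k l)).
have c0 : (0 < cdiv (nblk GenH H u l (k l)) a)%N.
  by have := cdiv_ge (nblk GenH H u l (k l)) a0; case: (cdiv _ _) => //; rewrite mul0n; lia.
have le : (3 * a <= a * a)%N by rewrite leq_mul2r; lia.
have key : (k l)%:R / (nblk GenH H u l (k l) + cdiv (nblk GenH H u l (k l)) a)%:R =
    (k l)%:R / (nb GenH H l (k l) * bsz GenH H l (k l))%:R * ((bsz GenH H l (k l))%:R / (pay GenH H l (k l))%:R) *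
    ((pay GenH H l (k l))%:R / (K l * m l)%:R) * (1 + 2 / a%:R * ((K l)%:R / (a * E l)%:R)^-1)^-1 *
    ((a * a - 3 * a)%:R / (a * a)%:R * ((m l)%:R / (M l * (a * a - 3 * a))%:R) *
     (1 + a%:R^-1 * ((nblk GenH H u l (k l))%:R / (a * cdiv (nblk GenH H u l (k l)) a)%:R)^-1)^-1) :> R.
  rewrite natrD !natrM; apply: rate_factors; rewrite ?ltr0n //.
  by rewrite /eN natrD natrM.
by rewrite key.
Qed.
End Rate.
End Poly.

(** * The parameter [u] as a function of the error rate *)

Section Radius.
Variable R : realType.

(* The largest [u] with [tau <= 2 ^- (4 u + 9)]; at [tau = 0], where
   [tau^-1 = 0], any [u] would do. *)
Definition upar (tau : R) := maxn 2 ((trunc_log 2 (Num.truncn tau^-1) - 9) %/ 4).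

Lemma upar_gt1 tau : (1 < upar tau)%N. Proof. exact: leq_maxl. Qed.

(** The factor [512 a ^ 4] is [2 ^ (4 u + 9)]; the radius [2 ^- 17] is its inverse at [u = 2], the
    least value of [upar]. *)
Lemma upar_tau tau : 0 <= tau <= (2 ^+ 17)^-1 ->
  tau * (512 * (2 ^ upar tau * 2 ^ upar tau * 2 ^ upar tau * 2 ^ upar tau))%:R <= 1.
Proof.
move=> /andP [t0 t1]; have [->|tn] := eqVneq tau 0; first by rewrite mul0r ler01.
have tp : 0 < tau by rewrite lt_def tn.
have i0 : 0 <= tau^-1 by rewrite invr_ge0.
have hV : (2 ^ 17 <= Num.truncn tau^-1)%N.
  rewrite truncn_ge_nat // natrX -[leLHS]invrK lef_pV2 ?posrE // invr_gt0 exprn_gt0 //.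
have h17 := trunc_log_max (isT : (1 < 2)%N) hV.
have hu : (4 * upar tau + 9 <= trunc_log 2 (Num.truncn tau^-1))%N.
  by rewrite /upar; move: (trunc_log _ _) h17 => L h17; have := leq_divM (L - 9)%N 4; rewrite /maxn; case: ifP; lia.
have V0 : (0 < Num.truncn tau^-1)%N by apply: leq_trans hV; rewrite expn_gt0.
have hp : (2 ^ (4 * upar tau + 9) <= Num.truncn tau^-1)%N.
  by apply: leq_trans (trunc_logP (isT : (1 < 2)%N) V0); rewrite leq_exp2l.
rewrite mulrC -ler_pdivlMr // div1r.
apply: le_trans (_ : (Num.truncn tau^-1)%:R <= _); last by rewrite truncn_le.
rewrite ler_nat; apply: leq_trans hp; rewrite (_ : (4 * _ + 9 = 9 + upar tau + upar tau + upar tau + upar tau)%N); last by lia.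
by rewrite !expnD !mulnA.
Qed.

Lemma cvg_upar : (2 ^ upar tau)%:R^-1 @[tau --> 0^'+] --> (0 : R).
Proof.
apply/cvgrPdist_le => e e0; pose U := (Num.truncn e^-1).+1.
have p0 : 0 < (2 ^+ (4 * U + 9))^-1 :> R by rewrite invr_gt0 exprn_gt0.
apply: filterS2 (nbhs_right_gt (0 : R)) (nbhs_right_lt p0) => tau t0 t1.
have i0 : 0 <= tau^-1 by rewrite invr_ge0 ltW.
have hV : (2 ^ (4 * U + 9) <= Num.truncn tau^-1)%N.
  by rewrite truncn_ge_nat // natrX -[leLHS]invrK lef_pV2 ?posrE // ltW.
have hU : (U <= upar tau)%N.
  have := trunc_log_max (isT : (1 < 2)%N) hV; rewrite /upar; move: (trunc_log _ _) => L hL.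
  by rewrite leq_max leq_divRL // mulnC; apply/orP; right; lia.
rewrite sub0r normrN ger0_norm ?invr_ge0 ?ler0n // -[leRHS]invrK.
rewrite lef_pV2 ?posrE ?invr_gt0 ?ltr0n ?expn_gt0 //.
have e1 : 0 <= e^-1 by rewrite invr_ge0 ltW.
have /andP [_ /ltW h] := truncn_itv e1; apply: le_trans h _.
rewrite ler_nat -/U; apply: leq_trans (ltnW (ltn_expl U (isT : (1 < 2)%N))) _.
by rewrite leq_exp2l.
Qed.

Lemma cvg_rho : (1 - (2 ^ upar tau)%:R^-1) @[tau --> 0^'+] --> (1 : R).
Proof.
rewrite -[X in _ --> X]subr0; apply: cvgB; first exact: cvg_cst.
exact: cvg_upar.
Qed.

Lemma cvg_rate0 : rate R (upar tau) @[tau --> 0^'+] --> (1 : R).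
Proof.
have lin c : (1 + c * (2 ^ upar tau)%:R^-1) @[tau --> 0^'+] --> (1 : R).
  have h : c * (2 ^ upar tau)%:R^-1 @[tau --> 0^'+] --> c * 0.
    by apply: cvgM; [exact: cvg_cst | exact: cvg_upar].
  rewrite mulr0 in h; rewrite -[X in _ --> X]addr0.
  by apply: cvgD; [exact: cvg_cst | exact: h].
rewrite -[X in _ --> X]divr1 -[X in _ / X]mulr1.
have -> : (fun tau => rate R (upar tau)) = (fun tau => (1 + (-3) * (2 ^ upar tau)%:R^-1) /
    ((1 + 2 * (2 ^ upar tau)%:R^-1) * (1 + 1 * (2 ^ upar tau)%:R^-1))).
  by apply/funext => tau; rewrite /rate mulNr.
apply: cvgM; first exact: lin.
by apply: cvgV; [rewrite mulr1 oner_neq0 | apply: cvgM; exact: lin].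
Qed.

Lemma rate_itv u : (1 < u)%N -> 0 < rate R u < 1 /\ 0 < (1 - (2 ^ u)%:R^-1 : R) < 1.
Proof.
move=> u1; have a4 : 4 <= (2 ^ u)%:R :> R by rewrite ler_nat; exact: four_le_pow.
rewrite /rate; move: (2 ^ u)%:R a4 => a a4; have a0 : 0 < a by lra.
have i0 : 0 < a^-1 by rewrite invr_gt0.
have i1 : a^-1 <= 1 / 4 by rewrite div1r lef_pV2 ?posrE.
move: (a^-1) i0 i1 => z i0 i1.
have p : 0 < (1 + 2 * z) * (1 + 1 * z) by apply: mulr_gt0; lra.
split; last by lra.
by rewrite divr_gt0 //=; [rewrite ltr_pdivrMr //; nra | lra].
Qed.
End Radius.

(** * Queries, completeness and security of the code *)

Section Main.
Variables (R : realType) (GenH : ppt) (H : dpt) (ell : nat -> nat).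
Hypothesis crH : crhf R GenH H ell.
Variables (mu : nat -> R).
Hypothesis hmu : forall A c, \forall l \near \oo, l%:R ^+ c * collision_prob R GenH H A l <= mu l.
Variables (u : nat) (tau : R).
Hypotheses (u1 : (1 < u)%N) (htau : tau * (512 * (2 ^ u * 2 ^ u * 2 ^ u * 2 ^ u))%:R <= 1).
Variable C : local_code.
Hypotheses (CG : Gen C = GenH) (Cn : blen C = clen GenH H u)
  (Ce : forall l s x, enc C l s x = encf GenH H u l s x)
  (Cd : forall l k w s i,
     bind (dec_run C l k w s i) (fun o => Ret (mem o 0, mem o 1, asked o)) = decf GenH H u l k w s i).
Variables (k : nat -> nat) (c : nat).
Hypothesis hk : \forall l \near \oo, ((l <= k l ^ c) && (k l <= l ^ c))%N.

Definition queries l := (blk GenH H u l (k l) +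
  (if plain GenH H l (k l) then 0 else ct l (k l) ^ 2 * rt GenH H u l (k l)))%N.

Lemma near_okp : \forall l \near \oo, okp GenH H u l (k l).
Proof.
have [D _ hD] := em_cp_le GenH H u1.
apply: filterS3 (ell_gt0 crH) (near_ct_ge k 2)
  (near_ct_ge k (3 * 2 ^ u * (4 * D + (4 + 4 * (2 ^ u * 2 ^ u))))) => l e0 t2 ht.
apply/and3P; split=> //; first exact: (clen_le u1 (hD _ _)).
by apply: rt_gt0 => //; rewrite -(ellE crH).
Qed.

(** Five logarithms come from [queries_le], and the sixth absorbs the constants, among them the
    factor between [t] and the logarithm of the blocklength. *)
Lemma near_queries : \forall l \near \oo,
  (queries l <= ell l * trunc_log 2 (blen C l (k l)) ^ 6)%N.
Proof.
have [D _ hD] := em_cp_le GenH H u1; pose Z := (24 * (4 * D + (4 + 4 * (2 ^ u * 2 ^ u))))%N.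
apply: filterS3 (ell_gt0 crH) (near_ct hk) (near_lgk hk (Z * (2 * c + 3) ^ 5)) => l e0 ht hg.
have kn : (k l <= blen C l (k l))%N.
  by rewrite Cn; apply: leq_trans (nblk_ge GenH H u1 l (k l)) (leq_addr _ _).
rewrite (ellE crH) in e0 *.
apply: leq_trans (queries_le u1 (hD l (k l)) e0) _.
rewrite mulnC leq_mul2l; apply/orP; right; rewrite -/Z.
have h1 := ht _ kn; have h2 := leq_trans hg (leq_trunc_log 2 kn).
apply: (@leq_trans (Z * ((2 * c + 3) * trunc_log 2 (blen C l (k l))) ^ 5)%N).
  by rewrite leq_mul2l leq_exp2r // h1 orbT.
by rewrite expnMn mulnA (expnS _ 5) leq_mul2r h2 orbT.
Qed.

Lemma near_lg_blen : \forall l \near \oo, (trunc_log 2 l <= trunc_log 2 (blen C l (k l)) ^ 2)%N.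
Proof.
apply: filterS2 (near_ct hk) (near_lgk hk (2 * c + 3)) => l ht hg.
have kn : (k l <= blen C l (k l))%N.
  by rewrite Cn; apply: leq_trans (nblk_ge GenH H u1 l (k l)) (leq_addr _ _).
have h1 := ht _ kn; have h2 := leq_trans hg (leq_trunc_log 2 kn).
apply: leq_trans (_ : (ct l (k l) <= _)%N); first by apply: leqW; apply: leq_trunc_log; exact: leq_addr.
by apply: leq_trans h1 _; rewrite expnS expn1 leq_mul2r h2 orbT.
Qed.

Lemma code_strong : strong_crldc C k queries tau (1 - (2 ^ u)%:R^-1) (gam R) mu.
Proof.
split=> [l s w i _ _|l s x i <- ix|A|A].
- exact: every_asked.
- exact: (dec_complete u1 Ce Cd).
- have hell l : every (output GenH [:: unary l]) (fun s => forall x : bits, size (apply H [:: s; x]) = ellf GenH H l).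
    by rewrite -(ellE crH); exact: crH.1.
  have [A' hA'] := fool_bound u1 CG Cn Ce Cd htau hell A c.+1.
  (* The exponent [c.+1] makes the guess range strictly larger than [k <= l ^ c]. Its size is at
     most [(2 l + 2) ^ (c + 1)], and [2 l + 2 <= l ^ 3] from [l = 2] on, hence the power
     [3 * c.+1]. *)
  apply: filterS3 (filterI near_okp hk) (hmu A' (3 * c.+1)) (nbhs_infty_ge 2) => l [ok /andP [_ kl]] hm l2.
  have c0 : 0 <= collision_prob R GenH H A' l by exact: Pr_ge0.
  apply: le_trans hm; apply: le_trans (hA' l (k l) (gam R l) ok _ _) _.
  + apply: leq_ltn_trans kl _; rewrite /guess mulnC expnM.
    apply: (@leq_trans ((2 ^ (trunc_log 2 l).+1) ^ c.+1)); last by [].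
    apply: (@leq_ltn_trans (l ^ c.+1)%N); first by rewrite leq_pexp2l // ltnW.
    by rewrite ltn_exp2r // trunc_log_ltn.
  + rewrite /gam lef_pV2 ?posrE ?exprn_gt0 //; apply: ler_weXn2l; first by rewrite ler1n.
    by rewrite leq_exp2r // ltnS; apply: leq_trunc_log; exact: leq_addr.
  apply: ler_wpM2r => //; rewrite -!natrX ler_nat; apply: leq_trans (guess_cap _ _) _.
  by rewrite expnM leq_exp2r // !expnS expn0; nia.
(* The bound on [Limit] is 0, so only [0 <= mu l] is left; it follows from the domination of any
   collision probability, here with [GenH] in the role of the adversary. *)
apply: filterS2 near_okp (hmu GenH 0) => l ok hm.
apply: le_trans (limit_bound u1 Cn Ce Cd htau A ok) _.
by apply: le_trans hm; rewrite mulr_ge0 ?exprn_ge0 //; exact: Pr_ge0.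
Qed.
End Main.

Theorem mainTheorem3 (R : realType) (GenH : ppt) (H : dpt) (ell : nat -> nat)
    (crH : crhf R GenH H ell) :
  exists (tau' : R) (mu gamma : nat -> R),
    [/\ 0 < tau' < 1, negligible_fun mu, negligible_fun gamma &
    exists r rho : R -> R,
      [/\ forall tau : R, 0 <= tau <= tau' -> 0 < r tau < 1 /\ 0 < rho tau < 1,
          r tau @[tau --> 0^'+] --> (1 : R),
          rho tau @[tau --> 0^'+] --> (1 : R) &
      forall tau : R, 0 <= tau <= tau' ->
      exists C : local_code,
      exists d : nat,
      forall k : nat -> nat, poly_related k ->
        let n := fun l => blen C l (k l) in
        [/\ (k l)%:R / (n l)%:R @[l --> \oo] --> r tau,
            exists2 q : nat -> nat, times_polylog d ell n q &
              strong_crldc C k q tau (rho tau) gamma mu &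
            (exists e : nat, times_polylog e (fun=> 1%N) id ell) ->
            linearly_related n ->
            exists d' : nat,
            exists2 q : nat -> nat, times_polylog d' (fun=> 1%N) n q &
              strong_crldc C k q tau (rho tau) gamma mu]]].
Proof.
have [mu nmu hmu] := mu_exists crH.
exists ((2 ^+ 17)^-1), mu, (gam R); split=> //.
- by rewrite invr_gt0 exprn_gt0 //= invf_lt1 ?exprn_gt0 // exprn_egt1 // ltr1n.
- exact: gam_negligible.
exists (fun tau => rate R (upar tau)), (fun tau => 1 - (2 ^ upar tau)%:R^-1); split.
- by move=> tau _; apply: rate_itv; exact: upar_gt1.
- exact: cvg_rate0.
- exact: cvg_rho.
move=> tau ht; have u1 := upar_gt1 tau.
have [C [CG Cn Ce Cd]] := code_exists GenH H u1.
exists C, 6%N => k [c hk] n.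
have st := code_strong crH hmu u1 (upar_tau ht) CG Cn Ce Cd hk.
split.
- by rewrite /n Cn; exact: (cvg_rate hk).
- by exists (queries GenH H (upar tau) k) => //; exact: (near_queries crH u1 Cn hk).
(* As [log l <= (log n) ^ 2] for large [l], a hash length of at most [(log l) ^ e] contributes [2 e]
   further logarithms of [n]. *)
move=> [e he] _; exists (2 * e + 6)%N; exists (queries GenH H (upar tau) k) => //.
apply: filterS3 (near_queries crH u1 Cn hk) (near_lg_blen u1 Cn hk) he => l h1 h2 h3.
apply: leq_trans h1 _; rewrite mul1n expnD; apply: leq_mul => //.
rewrite mul1n in h3; apply: leq_trans h3 _; rewrite expnM.
by case: (e) => // e'; rewrite leq_exp2r.
Qed.
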